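(* Let $N$ be a second countable closed normal subgroup of a hereditary Lindelöf locally compact group $G$. Suppose that $N$ is of type I and that all $G$-orbits of $\widehat{N}\cong\operatorname{Prim} C^{\ast}(N)$ are locally closed. Then for every factor representation $\pi$ of $G$ there exists a unique orbit $G\cdot\sigma$ of $\widehat{N}$ such that $\pi\,|\,N$ is weakly equivalent to $G\cdot\sigma$, i.e., \[\ker_{C^{\ast}(N)}\pi=\bigcap_{g\in G}\ker_{C^{\ast}(N)}g\cdot\sigma .\]
   Context: Locally compact means locally quasi-compact and Hausdorff. A space is Lindelöf if every open cover has a countable subcover, and hereditary Lindelöf if every open subset is Lindelöf in the relative topology. A subset of a topological space is locally closed if it is the intersection of a closed and an open subset. $C^{\ast}(N)$ is the full group $C^\ast$-algebra of $N$; $\operatorname{Prim} C^{\ast}(N)$ is its space of primitive ideals with the hull-kernel topology; $\widehat N$ is the set of equivalence classes of irreducible unitary representations of $N$ with the initial topology for the canonical map $\widehat N\to\operatorname{Prim}C^\ast(N)$, $\sigma\mapsto\ker_{C^\ast(N)}\sigma$. $G$ acts on $N$ by conjugation and hence on $C^\ast(N)$ and on $\widehat N$, with $(g\cdot\sigma)(n)=\sigma(g^{-1}ng)$. A factor representation of $G$ is a strongly continuous unitary representation $\pi$ of $G$ on a (non-zero) Hilbert space such that the von Neumann algebra $\pi(G)''$ is a factor. $\ker_{C^\ast(N)}\pi$ denotes the kernel of the representation of $C^\ast(N)$ obtained by integrating the restriction $\pi\,|\,N$. *)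

(* Defs.v *)
From HB Require Import structures.
From mathcomp Require Import all_boot all_order all_algebra.
From mathcomp Require Import all_classical all_reals all_analysis.
From mathcomp Require Import complex.

Set Implicit Arguments.
Unset Strict Implicit.
Unset Printing Implicit Defensive.

Import Order.TTheory GRing.Theory Num.Theory.
Import numFieldNormedType.Exports.

Local Open Scope classical_set_scope.
Local Open Scope ring_scope.

(* The library puts no topology on [R[i]]; this is the one of the modulus. *)
HB.instance Definition _ (R : realType) :=
  NormedModule.copy R[i] (R[i] : numFieldType)^o.

HB.mixin Record Group_isTopologicalGroup G of Group G & Topological G := {
  mulg_continuous : continuous (fun xy : G * G => (xy.1 * xy.2)%g);
  invg_continuous : continuous (fun x : G => (x^-1)%g)
}.

#[short(type="topGroupType")]
HB.structure Definition TopologicalGroup :=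
  {G of Group G & Topological G & Group_isTopologicalGroup G}.

Record normalSubgroup (G : topGroupType) := NormalSubgroup {
  nsub_set :> set G;
  nsub1 : nsub_set 1%g;
  nsubM : forall x y, nsub_set x -> nsub_set y -> nsub_set (x * y)%g;
  nsubV : forall x, nsub_set x -> nsub_set (x^-1)%g;
  nsubJ : forall g x, nsub_set x -> nsub_set (g * x * g^-1)%g
}.

(* The normal subgroup as a topological group in its own right; [set_type]
   carries the relative topology. *)
Definition nsubType (G : topGroupType) (N : normalSubgroup G) : Type :=
  set_type N.

Section NormalSubgroupType.
Variables (G : topGroupType) (N : normalSubgroup G).
Local Notation T := (nsubType N).

HB.instance Definition _ := Topological.copy T (set_type N).

Definition nsub_val (x : T) : G := val (x : set_type N).

Lemma nsub_valP (x : T) : nsub_set N (nsub_val x).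
Proof. exact: set_valP. Qed.

Definition nsub_mk (x : G) (Nx : nsub_set N x) : T := exist _ x (mem_set Nx).

Lemma nsub_val_inj : injective nsub_val.
Proof. exact: val_inj. Qed.

Lemma nsub_val_continuous : continuous nsub_val.
Proof. exact: (@initial_continuous (set_type N) G set_val). Qed.

Lemma nsub_continuous (X : topologicalType) (f : X -> T) :
  continuous (nsub_val \o f) -> continuous f.
Proof.
exact: (@continuous_comp_initial (set_type N) X G set_val f).
Qed.

Let one : T := nsub_mk (nsub1 N).
Let inv (x : T) : T := nsub_mk (nsubV (nsub_valP x)).
Let mul (x y : T) : T := nsub_mk (nsubM (nsub_valP x) (nsub_valP y)).

Let mulA : associative mul.
Proof. by move=> x y z; apply: nsub_val_inj; exact: mulgA. Qed.
Let mul1 : left_id one mul.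
Proof. by move=> x; apply: nsub_val_inj; exact: mul1g. Qed.
Let mulr1 : right_id one mul.
Proof. by move=> x; apply: nsub_val_inj; exact: mulg1. Qed.
Let mulV : left_inverse one inv mul.
Proof. by move=> x; apply: nsub_val_inj; exact: mulVg. Qed.
Let mulrV : right_inverse one inv mul.
Proof. by move=> x; apply: nsub_val_inj; exact: mulgV. Qed.

HB.instance Definition _ := isGroup.Build T mulA mul1 mulr1 mulV mulrV.

Lemma nsub_val1 : nsub_val 1%g = 1%g. Proof. by []. Qed.
Lemma nsub_valM x y : nsub_val (x * y)%g = (nsub_val x * nsub_val y)%g.
Proof. by []. Qed.

Let mul_cts : continuous (fun xy : T * T => (xy.1 * xy.2)%g).
Proof.
apply: nsub_continuous => xy.
apply: (@continuous_comp _ _ _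
  (fun z : T * T => (nsub_val z.1, nsub_val z.2))
  (fun z : G * G => (z.1 * z.2)%g)); last exact: mulg_continuous.
apply: cvg_pair.
  by apply: (continuous_comp (@cvg_fst _ _ _ _ _)); exact: nsub_val_continuous.
by apply: (continuous_comp (@cvg_snd _ _ _ _ _)); exact: nsub_val_continuous.
Qed.

Let inv_cts : continuous (fun x : T => (x^-1)%g).
Proof.
apply: nsub_continuous => x.
apply: (@continuous_comp _ _ _ nsub_val (fun z : G => z^-1%g)).
  exact: nsub_val_continuous.
exact: invg_continuous.
Qed.

HB.instance Definition _ := Group_isTopologicalGroup.Build T mul_cts inv_cts.

Definition nsub_conj (g : G) (n : T) : T :=
  nsub_mk (nsubJ (g^-1)%g (nsub_valP n)).

Lemma nsub_conjE g n : nsub_val (nsub_conj g n) = (g^-1 * nsub_val n * g)%g.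
Proof.
have -> : nsub_val (nsub_conj g n) = (g^-1 * nsub_val n * g^-1^-1)%g by [].
by rewrite invgK.
Qed.

End NormalSubgroupType.

(* Relatively open subsets of [A] are traces of open sets, so covers may be
   taken by open sets of the ambient space. *)
Definition lindelof (T : topologicalType) (A : set T) :=
  forall F : set (set T), (forall U, F U -> open U) ->
    A `<=` \bigcup_(U in F) U ->
    exists F' : set (set T),
      [/\ F' `<=` F, countable F' & A `<=` \bigcup_(U in F') U].

Definition hereditary_lindelof (T : topologicalType) :=
  forall A : set T, open A -> lindelof A.

Record hilbertSpace (R : realType) := HilbertSpace {
  hspace :> completeNormedModType R[i];
  hdot : hspace -> hspace -> R[i];
  hdot_linear : forall a x y z,
    hdot (a *: x + y) z = a * hdot x z + hdot y z;
  hdotC : forall x y, hdot y x = (hdot x y)^*%C;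
  hdot_norm : forall x, `|x| ^+ 2 = hdot x x
}.

Section Operators.
Variables (R : realType) (H : hilbertSpace R).
Implicit Types (S M : set (H -> H)) (T P : H -> H).

Definition bounded_operator T := linear T /\ continuous T.

Definition opnorm T : R :=
  sup [set complex.Re `|T x| | x in [set x | `|x| <= 1]].

Definition closed_subspace (V : set H) :=
  [/\ V 0, (forall a x y, V x -> V y -> V (a *: x + y)) & closed V].

Definition irreducible_operators S :=
  (exists x : H, x != 0) /\
  forall V, closed_subspace V -> (forall T x, S T -> V x -> V (T x)) ->
    V = [set 0] \/ V = [set: H].

Definition commutant S : set (H -> H) :=
  [set T | bounded_operator T /\ forall U : H -> H, S U -> T \o U = U \o T].

Definition center M : set (H -> H) := M `&` commutant M.

Definition factor M :=
  (exists x : H, x != 0) /\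
  center M = [set T | exists c : R[i], forall x, T x = c *: x].

Definition projection P :=
  [/\ bounded_operator P, P \o P = P & forall x y, hdot (P x) y = hdot x (P y)].

Definition abelian_projection M P :=
  [/\ M P, projection P &
    forall T U : H -> H, M T -> M U ->
      P \o T \o P \o U \o P = P \o U \o P \o T \o P].

(* A von Neumann algebra is of type I when every nonzero central projection
   majorizes a nonzero abelian projection. *)
Definition type_I_algebra M :=
  forall Z, projection Z -> center M Z -> (exists x, Z x != 0) ->
    exists P, [/\ abelian_projection M P, (exists x, P x != 0) & Z \o P = P].

End Operators.

Record unitaryRep (R : realType) (L : topGroupType) := UnitaryRep {
  rep_space : hilbertSpace R;
  rep_op :> L -> rep_space -> rep_space;
  rep_linear : forall x, linear (rep_op x);
  rep1 : forall v, rep_op 1%g v = v;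
  repM : forall x y v, rep_op (x * y)%g v = rep_op x (rep_op y v);
  rep_unitary : forall x v w, hdot (rep_op x v) (rep_op x w) = hdot v w;
  rep_continuous : forall v, continuous (fun x => rep_op x v)
}.
Arguments rep_op {R L} u _ _.

Section Pullback.
Variables (R : realType) (L M : topGroupType) (f : M -> L).
Hypotheses (f1 : f 1%g = 1%g) (fM : forall x y, f (x * y)%g = (f x * f y)%g).
Hypothesis fcont : continuous f.
Variable pi : unitaryRep R L.

Let op (x : M) := pi (f x).
Let op1 v : op 1%g v = v.
Proof. by rewrite /op f1 rep1. Qed.
Let opM x y v : op (x * y)%g v = op x (op y v).
Proof. by rewrite /op fM repM. Qed.
Let op_continuous v : continuous (fun x => op x v).
Proof.
move=> x; apply: (@continuous_comp _ _ _ f (fun y => pi y v)); first exact: fcont.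
exact: rep_continuous.
Qed.

Definition pullback : unitaryRep R M :=
  UnitaryRep (fun x => @rep_linear _ _ pi (f x)) op1 opM
    (fun x => @rep_unitary _ _ pi (f x)) op_continuous.

End Pullback.

Definition unitary_equiv (R : realType) (L : topGroupType)
    (pi rho : unitaryRep R L) :=
  exists U : rep_space pi -> rep_space rho,
    [/\ linear U, (forall v w, hdot (U v) (U w) = hdot v w),
        (forall w, exists v, U v = w)
      & forall x v, U (pi x v) = rho x (U v)].

Record irrep (R : realType) (L : topGroupType) := Irrep {
  irrep_rep :> unitaryRep R L;
  irrepP : irreducible_operators (range (rep_op irrep_rep))
}.

Section RepTypes.
Variables (R : realType) (L : topGroupType).

Definition generated_algebra (pi : unitaryRep R L) :
    set (rep_space pi -> rep_space pi) :=
  commutant (commutant (range (rep_op pi))).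
Arguments generated_algebra pi _ : clear implicits.

Definition factor_rep (pi : unitaryRep R L) := factor (generated_algebra pi).

(* The equivalent definition quantifying over all unitary representations, instead
   of the factor representations, gives a hypothesis that is formally stronger. *)
Definition type_I_group := forall pi : unitaryRep R L,
  factor_rep pi -> type_I_algebra (generated_algebra pi).

End RepTypes.

Record cstarAlgebra (R : realType) := CstarAlgebra {
  cspace :> completeNormedModType R[i];
  cmul : cspace -> cspace -> cspace;
  cadj : cspace -> cspace;
  cmulA : associative cmul;
  cmul_linearl : forall a x y z,
    cmul (a *: x + y) z = a *: cmul x z + cmul y z;
  cmul_linearr : forall a x y z,
    cmul z (a *: x + y) = a *: cmul z x + cmul z y;
  cnormM : forall x y, `|cmul x y| <= `|x| * `|y|;
  cadjK : involutive cadj;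
  cadj_antilinear : forall a x y,
    cadj (a *: x + y) = (a^*%C) *: cadj x + cadj y;
  cadjM : forall x y, cadj (cmul x y) = cmul (cadj y) (cadj x);
  cstar_identity : forall x, `|cmul (cadj x) x| = `|x| ^+ 2
}.

Section Primitive.
Variables (R : realType) (A : cstarAlgebra R).

Definition star_rep (H : hilbertSpace R) (rho : A -> H -> H) :=
  [/\ (forall a, bounded_operator (rho a)),
      (forall c a b v, rho (c *: a + b) v = c *: rho a v + rho b v),
      (forall a b v, rho (cmul a b) v = rho a (rho b v))
    & (forall a v w, hdot (rho (cadj a) v) w = hdot v (rho a w))].

Definition star_ker (H : hilbertSpace R) (rho : A -> H -> H) : set A :=
  [set a | forall v, rho a v = 0].

(* The last condition excludes the zero representation on a line. *)
Definition primitive_ideal : set (set A) := [set P |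
  exists (H : hilbertSpace R) (rho : A -> H -> H),
    [/\ star_rep rho, irreducible_operators (range rho),
        P = star_ker rho & P <> [set: A]]].

(* The hull-kernel topology on the set [primitive_ideal] : [S] is closed if and
   only if it contains every primitive ideal containing the intersection of the
   members of [S]. *)
Definition prim_closed (S : set (set A)) :=
  S `<=` primitive_ideal /\
  forall P, primitive_ideal P -> \bigcap_(Q in S) Q `<=` P -> S P.

Definition prim_open (S : set (set A)) :=
  S `<=` primitive_ideal /\ prim_closed (primitive_ideal `\` S).

End Primitive.

Definition Cc (R : realType) (L : topologicalType) : set (L -> R[i]) :=
  [set f | continuous f /\ compact (closure [set x | f x != 0])].

(* Left Haar measure, as a positive left-invariant functional on [Cc]; the values
   outside [Cc] are irrelevant. *)
Record haarIntegral (R : realType) (L : topGroupType) := HaarIntegral {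
  haar :> (L -> R[i]) -> R[i];
  haar_linear : forall a f g, Cc f -> Cc g ->
    haar (fun x => a * f x + g x) = a * haar f + haar g;
  haar_ge0 : forall f, Cc f -> (forall x, 0 <= f x) -> 0 <= haar f;
  haar_left : forall f y, Cc f -> haar (fun x => f (y * x)%g) = haar f;
  haar_neq0 : exists2 f, Cc f & haar f != 0
}.

Section Convolution.
Variables (R : realType) (L : topGroupType) (mu : haarIntegral R L).
Implicit Types f g : L -> R[i].

(* The modular function: mu(E x) = (modular x) mu(E). *)
Definition modular (x : L) : R[i] := xget 1 [set d | 0 < d /\
  forall f, Cc f -> mu (fun y => f (y * x)%g) = d^-1 * mu f].

Definition convolution f g : L -> R[i] :=
  fun x => mu (fun y => f y * g (y^-1 * x)%g).

Definition involution f : L -> R[i] :=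
  fun x => modular (x^-1)%g * (f (x^-1)%g)^*%C.

(* [integrate pi f v] is the weak integral of [f x *: pi x v] *)
Definition integrate (pi : unitaryRep R L) f (v : rep_space pi) : rep_space pi :=
  xget 0 [set u | forall w, hdot u w = mu (fun x => f x * hdot (pi x v) w)].

Definition cstar_norm f : R :=
  sup [set r | exists pi : unitaryRep R L, r = opnorm (@integrate pi f)].

(* C*(L) as the completion of the convolution *-algebra [Cc] in the norm
   [cstar_norm]; this determines it up to isomorphism over [Cc]. *)
Record groupCstar := GroupCstar {
  gcstar :> cstarAlgebra R;
  gc_emb : (L -> R[i]) -> gcstar;
  gc_emb_linear : forall a f g, Cc f -> Cc g ->
    gc_emb (fun x => a * f x + g x) = a *: gc_emb f + gc_emb g;
  gc_emb_conv : forall f g, Cc f -> Cc g ->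
    gc_emb (convolution f g) = cmul (gc_emb f) (gc_emb g);
  gc_emb_invol : forall f, Cc f -> gc_emb (involution f) = cadj (gc_emb f);
  gc_emb_norm : forall f, Cc f -> `|gc_emb f| = (cstar_norm f)%:C%C;
  gc_emb_dense : dense (gc_emb @` @Cc R L)
}.

End Convolution.

Section Dual.
Variables (R : realType) (L : topGroupType) (mu : haarIntegral R L).
Variable A : groupCstar mu.

(* The unique *-representation of C*(L) whose composite with [gc_emb] is
   [integrate pi]; the default value of [xget] is never reached. *)
Definition integrated_form (pi : unitaryRep R L) :
    A -> rep_space pi -> rep_space pi :=
  xget (fun _ _ => 0) [set rho | star_rep rho /\
    forall f, Cc f -> rho (gc_emb A f) = integrate mu f].
Arguments integrated_form pi _ _ : clear implicits.

Definition cker (pi : unitaryRep R L) : set A :=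
  star_ker (integrated_form pi).
Arguments cker pi _ : clear implicits.

End Dual.
Arguments cker {R L mu} A pi _.

(* The elements of the dual are the equivalence classes themselves. Predicates on
   [irrep] and [dual] are not written with [set], whose universe is too small. *)
Definition dual (R : realType) (L : topGroupType) : Type :=
  {c : irrep R L -> Prop | exists s : irrep R L, c = unitary_equiv s}.

Section DualSpace.
Variables (R : realType) (L : topGroupType).

Definition dual_class (s : irrep R L) : dual R L :=
  exist _ (unitary_equiv s : irrep R L -> Prop) (ex_intro _ s erefl).

Definition dual_repr (c : dual R L) : irrep R L := projT1 (cid (proj2_sig c)).

Variables (mu : haarIntegral R L) (A : groupCstar mu).

Definition dual_ker (c : dual R L) : set A := cker A (dual_repr c).
Arguments dual_ker c _ : clear implicits.

(* The initial topology for the canonical map [dual_ker] to the primitive ideals. *)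
Definition dual_open (X : dual R L -> Prop) :=
  exists2 U, prim_open U & forall c, X c <-> U (dual_ker c).

Definition dual_locally_closed (X : dual R L -> Prop) :=
  exists F U, [/\ dual_open (fun c => ~ F c), dual_open U &
    forall c, X c <-> F c /\ U c].

End DualSpace.
Arguments dual_ker {R L mu} A c _.

Section Action.
Variables (R : realType) (G : topGroupType) (N : normalSubgroup G).
Local Notation T := (nsubType N).

Definition restriction (pi : unitaryRep R G) : unitaryRep R T :=
  pullback (nsub_val1 N) (@nsub_valM _ N) (@nsub_val_continuous _ N) pi.

Variable g : G.

Let conj1 : nsub_conj g (1%g : T) = 1%g.
Proof. by apply: nsub_val_inj; rewrite nsub_conjE nsub_val1 mulg1 mulVg. Qed.

Let conjM (x y : T) : nsub_conj g (x * y)%g = (nsub_conj g x * nsub_conj g y)%g.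
Proof.
by apply: nsub_val_inj; rewrite nsub_valM !nsub_conjE nsub_valM !mulgA mulgK.
Qed.

Let conj_cts : continuous (nsub_conj g : T -> T).
Proof.
apply: nsub_continuous => x.
have -> : (@nsub_val G N) \o (@nsub_conj G N g) =
    fun x => (g^-1 * nsub_val x * g)%g.
  by apply/funext => y /=; exact: nsub_conjE.
have cst_cts (a : G) : continuous (fun _ : T => a) by exact: cst_continuous.
have mul_cts (u v : T -> G) : continuous u -> continuous v ->
    continuous (fun z => (u z * v z)%g).
  move=> cu cv z; apply: (@continuous_comp _ _ _ (fun z => (u z, v z))
    (fun z : G * G => (z.1 * z.2)%g)); last exact: mulg_continuous.
  exact: (cvg_pair (cu z) (cv z)).
apply: (mul_cts (fun z => g^-1 * nsub_val z)%g (fun=> g)) => //.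
by apply: (mul_cts (fun=> g^-1%g)) => //; exact: nsub_val_continuous.
Qed.

Definition conj_rep (s : unitaryRep R T) : unitaryRep R T :=
  pullback conj1 conjM conj_cts s.

Let conj_irrepP (s : irrep R T) : irreducible_operators (range (rep_op (conj_rep s))).
Proof.
have [nz irr] := irrepP s; split=> // V cV sV; apply: irr => // _ x [n _ <-] Vx.
have Ng : nsub_set N (g * nsub_val n * g^-1)%g.
  by apply: nsubJ; exact: nsub_valP.
have -> : n = nsub_conj g (nsub_mk Ng).
  by apply: nsub_val_inj; rewrite nsub_conjE /= !mulgA mulVg mul1g mulgVK.
by apply: (sV (conj_rep s (nsub_mk Ng))) => //; exists (nsub_mk Ng).
Qed.

(* [(g . s) n = s (g^-1 n g)], by [nsub_conjE] *)
Definition conj_irrep (s : irrep R T) : irrep R T := Irrep (conj_irrepP s).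

Definition dual_act (c : dual R T) : dual R T :=
  dual_class (conj_irrep (dual_repr c)).

End Action.

Definition dual_orbit (R : realType) (G : topGroupType) (N : normalSubgroup G)
    (c : dual R (nsubType N)) : dual R (nsubType N) -> Prop :=
  fun d => exists g, d = dual_act g c.

(* Main.v *)
(* Let [E] be the C*-algebra of operators generated by [pi(N)] and the operators
   [pi(g) a pi(g)^-1] with [a] in the image of [C*(N)]. For nonzero [b] in [E], the
   vectors orthogonal to all the [pi(g) b H] form a subspace whose projection is
   central in the factor [pi(G)'']; hence it is zero, and for nonzero [d] in [E] some
   product of [d] with a conjugate of [b] is nonzero. Running through a dense
   sequence [(c_n)] of the image of [C*(N)], this and some functional calculus yield
   elements [a_n] of [E], [|a_n| <= 1], with [a_0, ..., a_n] fixing a common unit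
   vector for every [n], such that a representation of [E] that is small on all the
   conjugates of [c_n] kills [a_n]. The states of [E] equal to [1] at every [a_n] form
   a nonempty closed face, and an extreme point of it (Krein-Milman) gives, by GNS, an
   irreducible representation [rho] of [E] with [rho(a_n) <> 0] for every [n].
   The representation [sigma = rho o pi] of [N] is irreducible, because [rho] of a
   conjugate of [C*(N)] is an integrated form of a conjugate of [sigma], and the kernel
   of [pi | N] is the intersection of the kernels of the conjugates of [sigma].
   Conversely, two orbits with the same intersection of kernels have the same closure,
   and if one is locally closed it is open in this closure, so that it meets the
   other. *)
From HB Require Import structures.
From mathcomp Require Import all_boot all_order all_algebra.
From mathcomp Require Import all_classical all_reals all_analysis.
From mathcomp Require Import complex ring lra.
Require Import Defs.

Set Implicit Arguments.
Unset Strict Implicit.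
Unset Printing Implicit Defensive.

Import Order.TTheory GRing.Theory Num.Theory.
Import numFieldNormedType.Exports.

Local Open Scope classical_set_scope.
Local Open Scope ring_scope.

Local Notation Re := complex.Re.
Local Notation Im := complex.Im.

(** * Norms and limits *)

(** The obstacle behind the overview is continuity. The algebra [E] has to contain the operators
    pi(n): they supply its unit, through it the compactness of its state space, and the operators of
    sigma. But its norm sees N as a discrete group, and an irreducible representation of [E] may
    restrict to a discontinuous representation of N. The elements b of [E] for which n |-> pi(n) b
    is continuous in norm form a nonzero two-sided ideal. All the a_n are chosen in this ideal, and
    an irreducible representation that does not annihilate it is strongly continuous on N. On the
    ideal, integrals over N become norm limits of Riemann sums with values in [E], so that rho can
    be applied to them; this is how rho of a conjugate of C*(N) is recognized as an integrated form.
    Accordingly the Haar integral is handled through Riemann sums whose nodes and weights do not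
    depend on the integrand, which also replaces Fubini's theorem for convolutions. The functional
    calculus reduces to one square root, obtained by iteration. *)

Section RealNorm.
Variable R : realType.
Implicit Types (V : normedZmodType R[i]) (z w : R[i]).

(** Norms of [R[i]]-modules are complex numbers; this real version lets the estimates run through
    [lra] and the order lemmas of [R]. *)
Definition rn V (v : V) : R := Re `|v|.

Lemma rnE V (v : V) : `|v| = (rn v)%:C%C.
Proof. by rewrite /rn RRe_real. Qed.

Lemma rn_ge0 V (v : V) : 0 <= rn v.
Proof. by rewrite -lecR -rnE; exact: normr_ge0. Qed.

Lemma rn_triangle V (v w : V) : rn (v + w) <= rn v + rn w.
Proof. by rewrite -lecR rmorphD /= -!rnE ler_normD. Qed.

Lemma rnN V (v : V) : rn (- v) = rn v.
Proof. by rewrite /rn normrN. Qed.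

Lemma rn0 V : rn (0 : V) = 0.
Proof. by rewrite /rn normr0. Qed.

Lemma rn_eq0 V (v : V) : rn v = 0 -> v = 0.
Proof. by move=> h; apply/eqP; rewrite -normr_eq0 rnE h. Qed.

Lemma rn_distC V (v w : V) : rn (v - w) = rn (w - v).
Proof. by rewrite -rnN opprB. Qed.

Lemma rn_tri3 V (u v w : V) : rn (u - w) <= rn (u - v) + rn (v - w).
Proof. by have := rn_triangle (u - v) (v - w); rewrite addrA subrK. Qed.

Lemma rn_lt3 V (u v w : V) (a b c : R) :
  rn (u - v) < a -> rn (v - w) < b -> a + b <= c -> rn (u - w) < c.
Proof. by have := rn_tri3 u v w; lra. Qed.

Lemma rn_lt3' V (u v w : V) (a b c : R) :
  rn (v - u) < a -> rn (v - w) < b -> a + b <= c -> rn (u - w) < c.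
Proof. by rewrite rn_distC; exact: rn_lt3. Qed.

Lemma rn_le3 V (u v w : V) (a b c : R) :
  rn (u - v) <= a -> rn (v - w) <= b -> a + b <= c -> rn (u - w) <= c.
Proof. by have := rn_tri3 u v w; lra. Qed.

Lemma half_add (a b e : R) : a < e / 2 -> b < e / 2 -> a + b <= e.
Proof. lra. Qed.

Lemma rn_eps V (v : V) : (forall e : R, 0 < e -> rn v <= e) -> v = 0.
Proof.
move=> h; apply: rn_eq0; apply/eqP; rewrite eq_le rn_ge0 andbT.
by apply/ler_addgt0Pr => e e0; rewrite add0r h.
Qed.

Lemma rn_sum V (I : Type) (s : seq I) (P : pred I) (F : I -> V) :
  rn (\sum_(i <- s | P i) F i) <= \sum_(i <- s | P i) rn (F i).
Proof.
elim/big_rec2: _ => [|i y x _ h]; first by rewrite rn0.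
by apply: le_trans (rn_triangle _ _) _; rewrite lerD2l.
Qed.

Lemma rnM z w : rn (z * w) = rn z * rn w.
Proof. by apply: complexI; rewrite rmorphM /= -!rnE normrM. Qed.

Lemma rn1 : rn (1 : R[i]) = 1.
Proof. by rewrite /rn normr1. Qed.

Lemma rn_real (r : R) : rn r%:C%C = `|r|.
Proof. by rewrite /rn normc_def /= expr0n /= addr0 sqrtr_sqr. Qed.

Lemma rn_sqr z : rn z ^+ 2 = Re z ^+ 2 + Im z ^+ 2.
Proof. by apply: complexI; rewrite rmorphXn /= -rnE -add_Re2_Im2. Qed.

Lemma Re_le_rn z : Re z <= rn z.
Proof.
apply: (le_trans (ler_norm _)).
by rewrite -ler_sqr ?nnegrE ?rn_ge0 // real_normK ?num_real // rn_sqr lerDl sqr_ge0.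
Qed.

Lemma rn_conj z : rn z^*%C = rn z.
Proof. by rewrite /rn normcJ. Qed.

Lemma rn_ReIm z : rn z <= `|Re z| + `|Im z|.
Proof.
rewrite -ler_sqr ?nnegrE ?rn_ge0 ?addr_ge0 // rn_sqr sqrrD.
rewrite !real_normK ?num_real //.
by rewrite -addrA [_ *+ 2 + _]addrC addrA lerDl mulrn_wge0 // mulr_ge0.
Qed.

Lemma rnV z : rn z^-1 = (rn z)^-1.
Proof.
have [->|z0] := eqVneq z 0; first by rewrite invr0 rn0 invr0.
have h : rn z != 0 by apply: contra_neq z0 => /rn_eq0.
by apply: (mulIf h); rewrite -rnM !mulVf // rn1.
Qed.

(** Rotating a number onto the positive axis reduces bounds on moduli to bounds on real parts. *)
Lemma unit_phase z : exists u, rn u = 1 /\ u * z = (rn z)%:C%C.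
Proof.
have [->|z0] := eqVneq z 0; first by exists 1; rewrite rn1 mulr0 rn0.
have h : rn z != 0 by apply: contra_neq z0 => /rn_eq0.
exists ((rn z)%:C%C * z^-1); rewrite rnM rnV rn_real ger0_norm ?rn_ge0 //.
by rewrite mulfV // mulfVK.
Qed.

Lemma mulcJ_rn z : z * z^*%C = (rn z ^+ 2)%:C%C.
Proof. by rewrite -sqr_normc rnE rmorphXn. Qed.

Lemma rnZ (V : normedModType R[i]) z (v : V) : rn (z *: v) = rn z * rn v.
Proof. by apply: complexI; rewrite rmorphM /= -!rnE normrZ. Qed.

End RealNorm.

(** * Sequential limits in complex normed spaces *)

Section SequenceLimits.
Variable R : realType.

Definition scauchy (V : normedZmodType R[i]) (u : nat -> V) :=
  forall e : R, 0 < e -> exists n0, forall m n,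
    (n0 <= m)%N -> (n0 <= n)%N -> rn (u m - u n) < e.

Definition sconv (V : normedZmodType R[i]) (u : nat -> V) (l : V) :=
  forall e : R, 0 < e -> exists n0, forall n, (n0 <= n)%N -> rn (u n - l) < e.

Lemma nbhs_rnP (V : normedModType R[i]) (x : V) (A : set V) :
  nbhs x A <-> exists2 e : R, 0 < e & forall y, rn (y - x) < e -> A y.
Proof.
split.
  move=> /nbhs_ballP [e /= e0 h]; exists (Re e).
    by move: e0; rewrite ltcE => /andP[].
  have eE : e = (Re e)%:C%C by rewrite RRe_real // gtr0_real.
  move=> y yx; apply: h; rewrite -ball_normE /= rnE rn_distC eE ltcR.
  exact: yx.
move=> [e e0 h]; apply/nbhs_ballP; exists e%:C%C; first by rewrite /= ltcR.
by move=> y; rewrite -ball_normE /= rnE ltcR rn_distC => yx; exact: h.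
Qed.


Lemma scomplete (V : completeNormedModType R[i]) (u : nat -> V) :
  scauchy u -> exists l, sconv u l.
Proof.
move=> cu.
have : cauchy (u @ \oo).
  apply/cauchyP => e e0.
  have e0' : 0 < Re e by move: e0; rewrite ltcE => /andP[].
  have eE : e = (Re e)%:C%C by rewrite RRe_real // gtr0_real.
  have [n0 hn] := cu _ e0'.
  exists (u n0); exists n0 => // n /= n0n.
  by rewrite -ball_normE /= rnE eE ltcR hn.
move=> /cauchy_cvg /cvg_ex [l ul]; exists l => e e0.
have /ul [n0 _ hn] : nbhs l [set y | rn (y - l) < e].
  by apply/nbhs_rnP; exists e.
by exists n0.
Qed.

Lemma closed_sconv (V : normedModType R[i]) (A : set V) (u : nat -> V) (l : V) :
  closed A -> (forall n, A (u n)) -> sconv u l -> A l.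
Proof.
move=> cA Au ul; apply: cA => B /nbhs_rnP[e e0 h]; have [n0 hn] := ul _ e0.
by exists (u n0); split=> //; apply: h; exact: hn.
Qed.

Lemma closed_rnP (V : normedModType R[i]) (A : set V) :
  (forall x, (forall e : R, 0 < e -> exists2 y, A y & rn (y - x) < e) -> A x) ->
  closed A.
Proof.
move=> h x clx; apply: h => e e0.
have [|y [Ay xy]] := clx [set y | rn (y - x) < e]; last by exists y.
by apply/nbhs_rnP; exists e.
Qed.

Lemma sconv_unique (V : normedZmodType R[i]) (u : nat -> V) (l l' : V) :
  sconv u l -> sconv u l' -> l = l'.
Proof.
move=> ul ul'; apply/eqP; rewrite -subr_eq0; apply/eqP/rn_eps => e e0.
have e2 : 0 < e / 2 by rewrite divr_gt0.
have [n0 h0] := ul _ e2; have [n1 h1] := ul' _ e2.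
have := h0 (maxn n0 n1) (leq_maxl _ _); have := h1 (maxn n0 n1) (leq_maxr _ _).
have := rn_tri3 l (u (maxn n0 n1)) l'; rewrite (rn_distC l (u _)).
lra.
Qed.

Lemma inv_lt_eps (e : R) : 0 < e -> exists n0 : nat, forall n, (n0 <= n)%N ->
  n.+1%:R^-1 < e.
Proof.
move=> e0; have /archi_boundP : 0 <= e^-1 by rewrite invr_ge0 ltW.
move=> h; exists (Num.bound e^-1) => n hn.
rewrite -[e]invrK ltf_pV2 ?posrE ?invr_gt0 ?ltr0n //.
by apply: lt_le_trans h _; rewrite ler_nat ltnW.
Qed.

Lemma approx_sconv (V : normedZmodType R[i]) (A : V -> Prop) (x : V) :
  (forall e : R, 0 < e -> exists2 y, A y & rn (y - x) < e) ->
  exists2 u, (forall n, A (u n)) & sconv u x.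
Proof.
move=> h.
have /choice[u hu] : forall n : nat, exists y, A y /\ rn (y - x) < n.+1%:R^-1.
  by move=> n; have [|y Ay hy] := h n.+1%:R^-1; [rewrite invr_gt0 | exists y].
exists u; first by move=> n; case: (hu n).
move=> e /inv_lt_eps[n0 h0]; exists n0 => n /h0; apply: lt_trans.
by case: (hu n).
Qed.

Lemma sconv_scauchy (V : normedZmodType R[i]) (u : nat -> V) (l : V) :
  sconv u l -> scauchy u.
Proof.
move=> ul e e0; have e2 : 0 < e / 2 by rewrite divr_gt0.
have [n0 h0] := ul _ e2; exists n0 => m n /h0 hm /h0 hn.
have := rn_tri3 (u m) l (u n); rewrite (rn_distC l (u n)).
lra.
Qed.

(** A Cauchy filter contains a ball of radius 1/(n+1) for every n; the centres form a Cauchy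
    sequence, whose limit is the limit of the filter. This turns sequential completeness into the
    filter form demanded by [completeNormedModType]. *)
Lemma seq_complete_cvg (V : normedModType R[i]) :
  (forall u : nat -> V, scauchy u -> exists l, sconv u l) ->
  forall F : set_system V, ProperFilter F -> cauchy F -> cvg F.
Proof.
move=> cV F PF /cauchyP cF.
have /choice[u hu] : forall n : nat, exists y, F (ball y (n.+1%:R^-1%:C)%C).
  by move=> n; apply: cF; rewrite ltcR invr_gt0.
have hF n : F [set x | rn (x - u n) < n.+1%:R^-1].
  apply: filterS (hu n) => x; rewrite -ball_normE /= rnE ltcR.
  by rewrite rn_distC.
have [|l ul] := cV u.
  move=> e e0; have e2 : 0 < e / 2 by rewrite divr_gt0.
  have [n0 h0] := inv_lt_eps e2; exists n0 => m n /h0 hm /h0 hn.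
  have [x [xm xn]] := filter_ex (filterI (hF m) (hF n)).
  exact: (rn_lt3' xm xn (half_add hm hn)).
apply/cvg_ex; exists l => A /nbhs_rnP[e e0 h].
have e2 : 0 < e / 2 by rewrite divr_gt0.
have [n0 h0] := inv_lt_eps e2; have [n1 h1] := ul _ e2.
apply: filterS (hF (maxn n0 n1)) => x /= hx; apply: h.
apply: (rn_lt3 hx (h1 _ (leq_maxr n0 n1))).
by rewrite [leRHS]splitr lerD2r ltW // h0 // leq_maxl.
Qed.

Lemma linear_bound (V W : normedModType R[i]) (T : V -> W) :
  linear T -> continuous T -> exists2 c : R, 0 <= c & forall v, rn (T v) <= c * rn v.
Proof.
move=> lT cT.
have T0 : T 0 = 0.
  by have := lT (-1) 0 0; rewrite scaler0 addr0 scaleN1r addNr.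
have TZ a v : T (a *: v) = a *: T v.
  by have := lT a v 0; rewrite T0 !addr0.
have : nbhs 0 [set v | rn (T v) < 1].
  apply: (cT 0 [set w | rn w < 1]); apply/nbhs_rnP; exists 1 => // y.
  by rewrite T0 subr0.
move=> /nbhs_rnP[e e0 he]; exists (2 / e); first by rewrite divr_ge0 // ltW.
move=> v; have [->|v0] := eqVneq v 0; first by rewrite T0 !rn0 mulr0.
have nv : 0 < rn v.
  by rewrite lt_neqAle rn_ge0 andbT eq_sym; apply: contra_neq v0 => /rn_eq0.
(* Here [v] is rescaled to norm [e / 2], inside the ball on which [T] is less than 1. *)
have := he ((e / 2 / rn v)%:C%C *: v).
rewrite /= subr0 TZ !rnZ !rn_real ger0_norm ?divr_ge0 ?(ltW e0) ?(ltW nv) //.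
rewrite divfK ?gt_eqF // => /(_ ltac:(lra)).
rewrite -ltr_pdivlMl ?divr_gt0 // mulr1 => /ltW /le_trans; apply.
by rewrite invf_div invf_div mulrC.
Qed.

Lemma bound_continuous (V W : normedModType R[i]) (T : V -> W) (c : R) :
  linear T -> (forall v, rn (T v) <= c * rn v) -> continuous T.
Proof.
move=> lT hT x A /nbhs_rnP[e e0 h].
have c1 : 0 < `|c| + 1 by rewrite ltr_pwDr.
apply/nbhs_rnP; exists (e / (`|c| + 1)); first by rewrite divr_gt0.
move=> y; rewrite ltr_pdivlMr // => hy; apply: h.
have -> : T y - T x = T (y - x).
  by rewrite [T y - _]addrC [y - x]addrC; have := lT (-1) x y; rewrite !scaleN1r => ->.
apply: le_lt_trans (hT _) _; apply: le_lt_trans hy.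
rewrite mulrC ler_wpM2l ?rn_ge0 //.
by apply: (le_trans (ler_norm _)); rewrite lerDl.
Qed.

End SequenceLimits.

(** * Hilbert spaces *)

Section ComplexParts.
Variable R : rcfType.

Lemma ReJ (z : R[i]) : Re z^*%C = Re z.
Proof. by case: z. Qed.

Lemma ReM_real (r : R) (z : R[i]) : Re (r%:C%C * z) = r * Re z.
Proof. by case: z => a b /=; rewrite mul0r subr0. Qed.

Lemma ReD (z w : R[i]) : Re (z + w) = Re z + Re w.
Proof. by case: z w => a b [c d]. Qed.

Lemma ReN (z : R[i]) : Re (- z) = - Re z.
Proof. by case: z. Qed.

Lemma ReB (z w : R[i]) : Re (z - w) = Re z - Re w.
Proof. by rewrite ReD ReN. Qed.

Lemma conjcM (z w : R[i]) : (z * w)^*%C = z^*%C * w^*%C.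
Proof. by rewrite rmorphM. Qed.

Lemma conjcD (z w : R[i]) : (z + w)^*%C = z^*%C + w^*%C.
Proof. by rewrite rmorphD. Qed.

Lemma conjcN (z : R[i]) : (- z)^*%C = - z^*%C.
Proof. by rewrite rmorphN. Qed.

End ComplexParts.

Section HilbertSpaces.
Variables (R : realType).
Implicit Types (H : hilbertSpace R).

(** The maximum of the quadratic is d^2/m, attained at r = d/m. All inequalities of Cauchy-Schwarz
    type below come from here. *)
Lemma quadratic_bound (d m e : R) : 0 <= m ->
  (forall r : R, 2 * r * d - r ^+ 2 * m <= e) -> d ^+ 2 <= e * m.
Proof.
move=> m0 h; have e0 : 0 <= e by have := h 0; rewrite mulr0 !mul0r expr0n /= mul0r subr0.
move: m0; rewrite le_eqVlt => /orP[/eqP m0|m0]; last first.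
  rewrite -ler_pdivrMr //; apply: le_trans (h (d / m)).
  by rewrite le_eqVlt; apply/orP; left; apply/eqP; field; rewrite gt_eqF.
have [->|d0] := eqVneq d 0; first by rewrite expr0n -m0 mulr0.
(* For m = 0 this value of r would give 2 (e + 1) <= e. *)
have := h ((e + 1) / d); rewrite -m0 mulr0 subr0 mulrA divfK //.
lra.
Qed.

(** * Semi-inner products, possibly degenerate *)

Section SemiInnerProduct.
Variables (V : lmodType R[i]) (s : V -> V -> R[i]).
Hypotheses (s_lin : forall a x y z, s (a *: x + y) z = a * s x z + s y z)
  (sC : forall x y, s y x = (s x y)^*%C) (s_ge0 : forall x, 0 <= s x x).

Definition seminorm (x : V) : R := Num.sqrt (Re (s x x)).
Local Notation q := seminorm.

Let s0l z : s 0 z = 0.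
Proof. by have := s_lin (-1) 0 0 z; rewrite scaler0 addr0 mulN1r addNr. Qed.

Lemma sipDl x y z : s (x + y) z = s x z + s y z.
Proof. by have := s_lin 1 x y z; rewrite scale1r mul1r. Qed.

Lemma sipZl a x z : s (a *: x) z = a * s x z.
Proof. by have := s_lin a x 0 z; rewrite s0l !addr0. Qed.

Lemma sipDr x y z : s z (x + y) = s z x + s z y.
Proof. by rewrite sC sipDl conjcD -!sC. Qed.

Lemma sipZr a x z : s z (a *: x) = a^*%C * s z x.
Proof. by rewrite sC sipZl conjcM -sC. Qed.

Lemma seminorm_ge0 x : 0 <= q x.
Proof. exact: sqrtr_ge0. Qed.

Lemma Re_sip_ge0 x : 0 <= Re (s x x).
Proof. by have := s_ge0 x; rewrite lecE => /andP[]. Qed.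

Lemma seminorm_sq x : q x ^+ 2 = Re (s x x).
Proof. by rewrite sqr_sqrtr // Re_sip_ge0. Qed.

Lemma sipxx x : s x x = (q x ^+ 2)%:C%C.
Proof. by rewrite seminorm_sq RRe_real // ger0_real. Qed.

Lemma seminormZ a x : q (a *: x) = rn a * q x.
Proof.
apply/eqP; rewrite -(@eqrXn2 _ 2) ?mulr_ge0 ?seminorm_ge0 ?rn_ge0 //.
by rewrite exprMn !seminorm_sq sipZl sipZr mulrA mulcJ_rn ReM_real.
Qed.

Lemma seminormD_sq x y :
  q (x + y) ^+ 2 = q x ^+ 2 + 2 * Re (s x y) + q y ^+ 2.
Proof.
rewrite !seminorm_sq sipDl !sipDr !ReD (sC x y) ReJ.
ring.
Qed.

(** Nonnegativity of the form at u - r v for all real r bounds the real part; a phase then reaches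
    the modulus. *)
Lemma semi_cauchy_schwarz x y : rn (s x y) <= q x * q y.
Proof.
have Re_bound u v : Re (s u v) ^+ 2 <= q u ^+ 2 * q v ^+ 2.
  apply: quadratic_bound; first exact: sqr_ge0.
  move=> r; have := sqr_ge0 (q (u + (- r)%:C%C *: v)).
  rewrite seminormD_sq sipZr conjc_real ReM_real seminormZ rn_real normrN exprMn.
  by rewrite real_normK ?num_real //; lra.
have [c [c1 hc]] := unit_phase (s x y).
have := Re_bound (c *: x) y; rewrite sipZl hc seminormZ c1 mul1r /= -exprMn.
by rewrite ler_sqr // nnegrE ?mulr_ge0 ?rn_ge0 ?seminorm_ge0.
Qed.

End SemiInnerProduct.

Lemma hdotDl H (x y z : H) : hdot (x + y) z = hdot x z + hdot y z.
Proof. by have := hdot_linear 1 x y z; rewrite scale1r mul1r. Qed.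

Lemma hdot0l H (z : H) : hdot 0 z = 0.
Proof. by apply: (addrI (hdot 0 z)); rewrite -hdotDl !addr0. Qed.

Lemma hdotZl H a (x z : H) : hdot (a *: x) z = a * hdot x z.
Proof. by have := hdot_linear a x 0 z; rewrite hdot0l !addr0. Qed.

Lemma hdotNl H (x z : H) : hdot (- x) z = - hdot x z.
Proof. by rewrite -scaleN1r hdotZl mulN1r. Qed.

Lemma hdotBl H (x y z : H) : hdot (x - y) z = hdot x z - hdot y z.
Proof. by rewrite hdotDl hdotNl. Qed.

Lemma hdotDr H (x y z : H) : hdot z (x + y) = hdot z x + hdot z y.
Proof. by rewrite hdotC hdotDl conjcD -!hdotC. Qed.

Lemma hdot0r H (z : H) : hdot z 0 = 0.
Proof. by rewrite hdotC hdot0l conjc0. Qed.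

Lemma hdotZr H a (x z : H) : hdot z (a *: x) = a^*%C * hdot z x.
Proof. by rewrite hdotC hdotZl conjcM -hdotC. Qed.

Lemma hdotNr H (x z : H) : hdot z (- x) = - hdot z x.
Proof. by rewrite hdotC hdotNl conjcN -hdotC. Qed.

Lemma hdotBr H (x y z : H) : hdot z (x - y) = hdot z x - hdot z y.
Proof. by rewrite hdotDr hdotNr. Qed.

Lemma hdotxx H (x : H) : hdot x x = (rn x ^+ 2)%:C%C.
Proof. by rewrite -hdot_norm rnE rmorphXn. Qed.

Lemma rn_sqE H (x : H) : rn x ^+ 2 = Re (hdot x x).
Proof. by rewrite hdotxx. Qed.

Lemma Re_hdotC H (x y : H) : Re (hdot x y) = Re (hdot y x).
Proof. by rewrite hdotC ReJ. Qed.

Lemma rnD_sq H (x y : H) :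
  rn (x + y) ^+ 2 = rn x ^+ 2 + 2 * Re (hdot x y) + rn y ^+ 2.
Proof.
rewrite !rn_sqE hdotDl !hdotDr !ReD (Re_hdotC y x).
ring.
Qed.

Lemma rnB_sq H (x y : H) :
  rn (x - y) ^+ 2 = rn x ^+ 2 - 2 * Re (hdot x y) + rn y ^+ 2.
Proof. by rewrite rnD_sq hdotNr rnN ReN mulrN. Qed.

Lemma hdot_eq0 H (x : H) : hdot x x = 0 -> x = 0.
Proof.
rewrite hdotxx => /complexI/eqP; rewrite sqrf_eq0 => /eqP.
exact: rn_eq0.
Qed.

Lemma hdot_inj H (x y : H) : (forall z, hdot x z = hdot y z) -> x = y.
Proof.
move=> h; apply/eqP; rewrite -subr_eq0; apply/eqP/hdot_eq0.
by rewrite hdotBl h subrr.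
Qed.

Lemma cauchy_schwarz H (x y : H) : rn (hdot x y) <= rn x * rn y.
Proof.
have := @semi_cauchy_schwarz H (@hdot R H) (@hdot_linear R H) (@hdotC R H) _ x y.
rewrite /seminorm !hdotxx /= !sqrtr_sqr !ger0_norm ?rn_ge0 //; apply.
by move=> z; rewrite hdotxx lecR sqr_ge0.
Qed.

Lemma parallelogram H (x y : H) :
  rn (x + y) ^+ 2 + rn (x - y) ^+ 2 = 2 * rn x ^+ 2 + 2 * rn y ^+ 2.
Proof. by rewrite rnD_sq rnB_sq; ring. Qed.

(** * The Riesz theorem on a closed subspace *)

Section Riesz.
Variables (H : hilbertSpace R) (V : set H) (l : H -> R[i]) (c : R).
Hypotheses (cV : closed_subspace V)
  (l_anti : forall a x y, V x -> V y -> l (a *: x + y) = a^*%C * l x + l y)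
  (l_bound : forall x, V x -> rn (l x) <= c * rn x).

Let V0 : V 0. Proof. by case: cV. Qed.
Let VL a x y : V x -> V y -> V (a *: x + y).
Proof. by case: cV => _ h _; exact: h. Qed.
Let VZ a x : V x -> V (a *: x).
Proof. by move=> Vx; rewrite -[_ *: _]addr0; exact: VL. Qed.
Let l0 : l 0 = 0.
Proof.
by have := l_anti (-1) V0 V0; rewrite scaler0 addr0 conjcN conjc1 mulN1r addNr.
Qed.
Let lD x y : V x -> V y -> l (x + y) = l x + l y.
Proof.
by move=> Vx Vy; have := l_anti 1 Vx Vy; rewrite scale1r conjc1 mul1r.
Qed.
Let lZ a x : V x -> l (a *: x) = a^*%C * l x.
Proof. by move=> Vx; rewrite -[_ *: _]addr0 l_anti // l0 addr0. Qed.

(** If [l] is represented by u in [V], then [J x] is |u|^2 - |x - u|^2, so the representing vector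
    is found as the maximizer of [J]. *)
Let J x : R := 2 * Re (l x) - rn x ^+ 2.
Let JV := [set J x | x in V].

Let JV_ub : ubound JV (c ^+ 2).
Proof.
move=> _ [x Vx <-]; rewrite /J.
have := le_trans (Re_le_rn (l x)) (l_bound Vx).
by have := sqr_ge0 (c - rn x); rewrite sqrrB; lra.
Qed.

Let JV_sup : has_sup JV.
Proof. by split; [exists (J 0), 0 | exists (c ^+ 2)]. Qed.

Let s := sup JV.

Let J_le x : V x -> J x <= s.
Proof. by move=> Vx; apply: sup_upper_bound => //; exists x. Qed.

(** By the parallelogram law, evaluating [J] at the midpoint makes every maximizing sequence
    Cauchy. *)
Let J_mid x y : V x -> V y -> rn (x - y) ^+ 2 <= 4 * s - 2 * J x - 2 * J y.
Proof.
move=> Vx Vy.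
have Vxy : V (x + y) by have := VL 1 Vx Vy; rewrite scale1r.
have := J_le (VZ (2^-1)%:C%C Vxy).
rewrite /J lZ // lD // conjc_real ReM_real ReD.
rewrite rnZ rn_real ger0_norm ?invr_ge0 // exprMn.
have := parallelogram x y.
lra.
Qed.

(** Moving a near maximizer x to x + r y gains at most e, for every real r; this is a quadratic
    inequality in r. *)
Let J_near (e : R) x y : V x -> V y -> s - J x <= e ->
  (Re (l y - hdot x y)) ^+ 2 <= e * rn y ^+ 2.
Proof.
move=> Vx Vy se; apply: quadratic_bound; first exact: sqr_ge0.
move=> r; have Vrx := VL r%:C%C Vy Vx.
have := J_le Vrx; rewrite /J l_anti // conjc_real ReD ReM_real.
rewrite [_ *: y + x]addrC rnD_sq hdotZr conjc_real ReM_real rnZ rn_real.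
rewrite exprMn real_normK ?num_real // ReB.
move: se; rewrite /J; lra.
Qed.

Lemma riesz_subspace : exists2 u, V u & forall w, V w -> hdot u w = l w.
Proof.
have /choice[u hu] : forall n : nat, exists x, V x /\ s - J x < n.+1%:R^-1.
  move=> n; have [|_ [x Vx <-] hx] := @sup_adherent _ JV n.+1%:R^-1 _ JV_sup.
    by rewrite invr_gt0.
  by exists x; split => //; rewrite ltrBlDl -ltrBlDr.
have cu : scauchy u.
  (* [J_mid] bounds the squared distance by four times the defect from the supremum. *)
  move=> e e0; have e4 : 0 < e ^+ 2 / 4 by rewrite divr_gt0 ?exprn_gt0.
  have [n0 h0] := inv_lt_eps e4; exists n0 => m n /h0 hm /h0 hn.
  rewrite -ltr_sqr ?nnegrE ?rn_ge0 ?(ltW e0) //.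
  apply: le_lt_trans (J_mid (hu m).1 (hu n).1) _.
  have := lt_trans (hu m).2 hm; have := lt_trans (hu n).2 hn; lra.
have [x ux] := scomplete cu.
have Vx : V x by case: cV => _ _ /closed_sconv; apply; [move=> n; exact: (hu n).1|].
have ReE w : V w -> Re (l w - hdot x w) = 0.
  move=> Vw; apply/eqP; rewrite -normr_eq0 eq_le normr_ge0 andbT.
  apply/ler_addgt0Pr => e e0; rewrite add0r.
  have w1 : 0 < rn w + 1 by rewrite ltr_wpDl ?rn_ge0.
  have e1 : 0 < e / 2 / (rn w + 1) by rewrite !divr_gt0.
  have e2 : 0 < (e / 2 / (rn w + 1)) ^+ 2 by rewrite exprn_gt0.
  have [n0 h0] := inv_lt_eps e2; have [n1 h1] := ux _ e1.
  pose n := maxn n0 n1.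
  have hn0 : s - J (u n) <= (e / 2 / (rn w + 1)) ^+ 2.
    by apply: ltW; apply: lt_trans (hu n).2 (h0 _ (leq_maxl _ _)).
  have := J_near (hu n).1 Vw hn0; rewrite -exprMn => hJ.
  have ew : e / 2 / (rn w + 1) * rn w <= e / 2.
    by rewrite -mulrA ler_piMr ?divr_ge0 ?(ltW e0) // mulrC ler_pdivrMr // mul1r lerDl.
  have h2 : `|Re (l w - hdot (u n) w)| <= e / 2.
    apply: (le_trans _ ew); rewrite -ler_sqr ?nnegrE // ?(mulr_ge0 (ltW e1) (rn_ge0 _)) //.
    by rewrite real_normK ?num_real.
  have h3 : `|Re (hdot (u n - x) w)| <= e / 2.
    apply: (le_trans _ ew); apply: (@le_trans _ _ (rn (u n - x) * rn w)).
      apply: le_trans (cauchy_schwarz _ _).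
      by rewrite -ler_sqr ?nnegrE ?rn_ge0 // real_normK ?num_real // rn_sqr lerDl sqr_ge0.
    by rewrite ler_wpM2r ?rn_ge0 // ltW // h1 // leq_maxr.
  rewrite (_ : Re _ = Re (l w - hdot (u n) w) + Re (hdot (u n - x) w)); last first.
    by rewrite hdotBl !ReB addrA subrK.
  by apply: le_trans (ler_normD _ _) _; rewrite [leRHS]splitr lerD.
exists x => // w Vw.
(* The real part at [w] and at i w determines the complex number. *)
have := ReE _ Vw; have := ReE _ (VZ 'i%C Vw).
rewrite lZ // hdotZr -mulrBr; move: (hdot x w) (l w) => [a b] [a' b'] /=.
by move=> h1 h2; congr Complex; lra.
Qed.

End Riesz.

Section HilbertOperators.
Variable H : hilbertSpace R.
Implicit Types (T P : H -> H) (V : set H).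

Lemma riesz (l : H -> R[i]) (c : R) :
  (forall a x y, l (a *: x + y) = a^*%C * l x + l y) ->
  (forall x, rn (l x) <= c * rn x) -> exists u, forall w, hdot u w = l w.
Proof.
move=> la lb; have cT : closed_subspace [set: H] by split=> //; exact: closedT.
have [u _ hu] := riesz_subspace cT (fun a x y _ _ => la a x y) (fun x _ => lb x).
by exists u => w; exact: hu.
Qed.

Lemma hdot_bound T (c : R) : 0 <= c ->
  (forall x y, rn (hdot (T x) y) <= c * rn x * rn y) ->
  forall x, rn (T x) <= c * rn x.
Proof.
move=> c0 h x; have := h x (T x); rewrite hdotxx rn_real ger0_norm ?sqr_ge0 //.
rewrite expr2; have [->|n0] := eqVneq (rn (T x)) 0.
  by rewrite mulr_ge0 ?rn_ge0.
by rewrite ler_pM2r // lt_neqAle eq_sym n0 rn_ge0.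
Qed.

Lemma bounded_operatorP T :
  bounded_operator T <->
  linear T /\ exists2 c : R, 0 <= c & forall v, rn (T v) <= c * rn v.
Proof.
split=> [[lT cT]|[lT [c c0 h]]]; first by split=> //; exact: linear_bound.
by split=> //; exact: bound_continuous h.
Qed.

Lemma linear_op0 T : linear T -> T 0 = 0.
Proof. by move=> lT; have := lT (-1) 0 0; rewrite scaler0 addr0 scaleN1r addNr. Qed.

Lemma linear_opP T : linear T -> (forall x y, T (x + y) = T x + T y) *
  (forall a x, T (a *: x) = a *: T x) * (forall x, T (- x) = - T x) *
  (forall x y, T (x - y) = T x - T y).
Proof.
move=> lT; have T0 := linear_op0 lT.
have TD x y : T (x + y) = T x + T y by have := lT 1 x y; rewrite !scale1r.
have TZ a x : T (a *: x) = a *: T x by have := lT a x 0; rewrite T0 !addr0.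
have TN x : T (- x) = - T x by rewrite -scaleN1r TZ scaleN1r.
by do !split => //; move=> x y; rewrite TD TN.
Qed.

Lemma adjoint_exists T : bounded_operator T ->
  exists T', bounded_operator T' /\ forall x y, hdot (T x) y = hdot x (T' y).
Proof.
move=> /bounded_operatorP[lT [c c0 hT]]; have lP := linear_opP lT.
have /choice[T' hT'] : forall y, exists u, forall w, hdot u w = hdot y (T w).
  move=> y; apply: (@riesz _ (rn y * c)).
    by move=> a x z; rewrite lP lP hdotDr hdotZr.
  move=> x; apply: le_trans (cauchy_schwarz _ _) _.
  by rewrite -mulrA ler_wpM2l ?rn_ge0.
exists T'; split; last by move=> x y; rewrite hdotC -hT' -hdotC.
apply/bounded_operatorP; split.
  by move=> a x y; apply: hdot_inj => z; rewrite hdotDl hdotZl !hT' hdotDl hdotZl.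
exists c => //; apply: hdot_bound => // x y; rewrite hT'.
apply: le_trans (cauchy_schwarz _ _) _.
by rewrite [leRHS]mulrAC [leRHS]mulrC ler_wpM2l ?rn_ge0.
Qed.

(** [P x] is the Riesz vector in [V] of the restriction of [hdot x] to [V]. *)
Lemma projection_exists V : closed_subspace V ->
  exists P, [/\ projection P, (forall x, V (P x)) & (forall x, V x -> P x = x)].
Proof.
move=> cV; have [V0 VL _] := cV.
have /choice[P hP] : forall x, exists u, V u /\ forall w, V w -> hdot u w = hdot x w.
  move=> x; have xa a y z : V y -> V z ->
      hdot x (a *: y + z) = a^*%C * hdot x y + hdot x z.
    by move=> _ _; rewrite hdotDr hdotZr.
  have [u Vu hu] := riesz_subspace cV xa (fun y _ => cauchy_schwarz x y).
  by exists u.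
have VP x : V (P x) by case: (hP x).
have PE x w : V w -> hdot (P x) w = hdot x w by case: (hP x) => _; exact.
have VB x y : V x -> V y -> V (x - y).
  by move=> Vx Vy; rewrite addrC -scaleN1r; exact: VL.
have uniq x y : V x -> V y -> (forall w, V w -> hdot x w = hdot y w) -> x = y.
  move=> Vx Vy h; apply/eqP; rewrite -subr_eq0; apply/eqP/hdot_eq0.
  by rewrite hdotBl h ?subrr //; exact: VB.
have PV x : V x -> P x = x by move=> Vx; apply: uniq => // w Vw; rewrite PE.
exists P; split=> //; split.
- apply/bounded_operatorP; split.
    move=> a x y; apply: uniq => //; first exact: VL.
    by move=> w Vw; rewrite hdotDl hdotZl !PE // hdotDl hdotZl.
  exists 1 => // x; rewrite mul1r.
  have := cauchy_schwarz x (P x); rewrite -PE // hdotxx rn_real ger0_norm ?sqr_ge0 //.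
  rewrite expr2; have [->|n0] := eqVneq (rn (P x)) 0; first by rewrite rn_ge0.
  by rewrite ler_pM2r // lt_neqAle eq_sym n0 rn_ge0.
- by apply/funext => x /=; exact: PV.
- move=> x y; have -> : hdot (P x) y = hdot (P x) (P y).
    by rewrite (hdotC y (P x)) -(PE y (P x)) // -(hdotC (P y)).
  by rewrite PE.
Qed.

End HilbertOperators.
End HilbertSpaces.

(** * Completeness of the complex numbers and limits of operations *)

Section ComplexLimits.
Variable R : realType.
Implicit Types (z w : nat -> R[i]).

Lemma real_scauchy (u : nat -> R) :
  (forall e, 0 < e -> exists n0, forall m n, (n0 <= m)%N -> (n0 <= n)%N ->
    `|u m - u n| < e) ->
  exists l, forall e, 0 < e -> exists n0, forall n, (n0 <= n)%N -> `|u n - l| < e.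
Proof.
move=> cu; have : cauchy (u @ \oo).
  apply/cauchyP => e e0; have [n0 hn] := cu _ e0.
  exists (u n0); exists n0 => // n /= n0n.
  by rewrite /ball /= hn.
move=> /cauchy_cvg /cvg_ex [l ul]; exists l => e e0.
have /ul [n0 _ hn] : nbhs l (ball l e) by exact: nbhsx_ballx.
by exists n0 => n /hn; rewrite /ball /= distrC.
Qed.

Lemma complex_scomplete z : scauchy z -> exists l, sconv z l.
Proof.
move=> cz.
have hRe (a : R[i]) : `|Re a| <= rn a.
  by rewrite -ler_sqr ?nnegrE ?rn_ge0 // real_normK ?num_real // rn_sqr lerDl sqr_ge0.
have hIm (a : R[i]) : `|Im a| <= rn a.
  by rewrite -ler_sqr ?nnegrE ?rn_ge0 // real_normK ?num_real // rn_sqr lerDr sqr_ge0.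
have ImB (a b : R[i]) : Im (a - b) = Im a - Im b by case: a b => ? ? [].
have [|a ha] := @real_scauchy (fun n => Re (z n)).
  move=> e /cz[n0 h0]; exists n0 => m n hm hn; rewrite -ReB.
  by apply: le_lt_trans (hRe _) _; exact: h0.
have [|b hb] := @real_scauchy (fun n => Im (z n)).
  move=> e /cz[n0 h0]; exists n0 => m n hm hn; rewrite -ImB.
  by apply: le_lt_trans (hIm _) _; exact: h0.
exists (Complex a b) => e e0; have e2 : 0 < e / 2 by rewrite divr_gt0.
have [n0 h0] := ha _ e2; have [n1 h1] := hb _ e2; exists (maxn n0 n1) => n.
rewrite geq_max => /andP[/h0 h0' /h1 h1'].
apply: le_lt_trans (rn_ReIm _) _; rewrite ReB ImB /=.
by rewrite [ltRHS]splitr ltrD.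
Qed.

Lemma sconvD (V : normedZmodType R[i]) (u v : nat -> V) a b :
  sconv u a -> sconv v b -> sconv (fun n => u n + v n) (a + b).
Proof.
move=> ua vb e e0; have e2 : 0 < e / 2 by rewrite divr_gt0.
have [n0 h0] := ua _ e2; have [n1 h1] := vb _ e2; exists (maxn n0 n1) => n.
rewrite geq_max => /andP[/h0 h0' /h1 h1'].
rewrite opprD addrACA; apply: le_lt_trans (rn_triangle _ _) _.
by rewrite [ltRHS]splitr ltrD.
Qed.

Lemma sconv_lip (V W : normedZmodType R[i]) (f : V -> W) (c : R) (u : nat -> V) a :
  (forall n, rn (f (u n) - f a) <= c * rn (u n - a)) -> sconv u a ->
  sconv (fun n => f (u n)) (f a).
Proof.
move=> hf ua e e0; have c1 : 0 < `|c| + 1 by rewrite ltr_pwDr.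
have [|n0 h0] := ua (e / (`|c| + 1)); first by rewrite divr_gt0.
exists n0 => n /h0; rewrite ltr_pdivlMr // => h; apply: le_lt_trans h.
apply: le_trans (hf n) _; rewrite mulrC ler_wpM2l ?rn_ge0 //.
by apply: (le_trans (ler_norm _)); rewrite lerDl.
Qed.

Lemma sconvM z (c l : R[i]) : sconv z l -> sconv (fun n => c * z n) (c * l).
Proof. by apply: (@sconv_lip _ _ ( *%R c) (rn c)) => n; rewrite -mulrBr rnM. Qed.

Lemma sconv_conj z l : sconv z l -> sconv (fun n => (z n)^*%C) l^*%C.
Proof.
apply: (@sconv_lip _ _ (@conjc R) 1) => n.
by rewrite -rmorphB /= rn_conj mul1r.
Qed.

Lemma sconv_le (V : normedZmodType R[i]) (u : nat -> V) (l l' : V) (c : R) n1 :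
  sconv u l -> (forall n, (n1 <= n)%N -> rn (u n - l') <= c) -> rn (l - l') <= c.
Proof.
move=> ul h; apply/ler_addgt0Pr => e e0; have [n0 h0] := ul _ e0.
have h2 := h _ (leq_maxr n0 n1); have h3 := h0 _ (leq_maxl n0 n1).
rewrite rn_distC in h3.
by apply: (rn_le3 (ltW h3) h2); rewrite addrC.
Qed.

End ComplexLimits.

(* The completion is realized as the space of bounded antilinear functionals,
   which is complete as a dual space; [a] is identified with [s a]. *)
Section Completion.
Variables (R : realType) (V : lmodType R[i]) (s : V -> V -> R[i]).
Hypotheses (s_lin : forall a x y z, s (a *: x + y) z = a * s x z + s y z)
  (sC : forall x y, s y x = (s x y)^*%C) (s_ge0 : forall x, 0 <= s x x).
Local Notation q := (seminorm s).

Let q_ge0 := seminorm_ge0 s.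
Let qZ := seminormZ s_lin sC s_ge0.
Let qD_sq := seminormD_sq s_lin sC s_ge0.
Let sCS := semi_cauchy_schwarz s_lin sC s_ge0.
Let sDr := sipDr s_lin sC.
Let sZr := sipZr s_lin sC.

Definition bounded_antilinear (F : V -> R[i]) :=
  (forall a x y, F (a *: x + y) = a^*%C * F x + F y) /\
  exists2 c : R, 0 <= c & forall x, rn (F x) <= c * q x.

Definition completion_pred : {pred V -> R[i]} := fun F => `[< bounded_antilinear F >].

Lemma completion_closed : subsemimod_closed completion_pred.
Proof.
split; first split.
- apply/asboolP; split=> [a x y|]; first by rewrite mulr0 addr0.
  by exists 0 => // x; rewrite rn0 mul0r.
- move=> F G /asboolP[Fa [c c0 hF]] /asboolP[Ga [d d0 hG]]; apply/asboolP.
  have E z : (F + G) z = F z + G z by [].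
  split=> [a x y|]; first by rewrite !E Fa Ga mulrDr addrACA.
  exists (c + d); first by rewrite addr_ge0.
  by move=> x; apply: le_trans (rn_triangle _ _) _; rewrite mulrDl lerD.
- move=> a F /asboolP[Fa [c c0 hF]]; apply/asboolP.
  have E z : (a *: F) z = a * F z by [].
  split=> [b x y|]; first by rewrite !E Fa mulrDr mulrCA.
  exists (rn a * c); first by rewrite mulr_ge0 ?rn_ge0.
  by move=> x; rewrite rnM -mulrA ler_wpM2l ?rn_ge0.
Qed.

Definition completion : Type := {F : V -> R[i] | completion_pred F}.

HB.instance Definition _ := SubChoice.on completion.
HB.instance Definition _ := GRing.SubChoice_isSubLmodule.Build R[i] (V -> R[i])
  completion_pred completion completion_closed.

Definition cev (F : completion) : V -> R[i] := val F.

Definition mk_completion F (hF : bounded_antilinear F) : completion :=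
  exist _ F (asboolT hF).

Lemma cevD F G x : cev (F + G) x = cev F x + cev G x. Proof. by []. Qed.
Lemma cevZ a F x : cev (a *: F) x = a * cev F x. Proof. by []. Qed.
Lemma cevB F G x : cev (F - G) x = cev F x - cev G x. Proof. by []. Qed.
Lemma cev_inj F G : (forall x, cev F x = cev G x) -> F = G.
Proof. by move=> h; apply/val_inj/funext. Qed.

Lemma cevP F : bounded_antilinear (cev F).
Proof. by have := valP F => /asboolP. Qed.

(** The dual norm, as a least bound; a supremum of quotients would have to exclude the vectors with
    [q x = 0]. *)
Definition cnorm (F : completion) : R :=
  inf [set c | 0 <= c /\ forall x, rn (cev F x) <= c * q x].

Let cset_neq0 F : [set c : R | 0 <= c /\ forall x, rn (cev F x) <= c * q x] !=set0.
Proof. by have [_ [c c0 h]] := cevP F; exists c. Qed.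

Let cset_lb F : has_lbound [set c : R | 0 <= c /\ forall x, rn (cev F x) <= c * q x].
Proof. by exists 0 => c []. Qed.

Lemma cnorm_ge0 F : 0 <= cnorm F.
Proof. by apply: lb_le_inf => // c []. Qed.

Lemma cnorm_le F c : 0 <= c -> (forall x, rn (cev F x) <= c * q x) -> cnorm F <= c.
Proof. by move=> c0 h; apply: ge_inf. Qed.

Lemma cnorm_bound F x : rn (cev F x) <= cnorm F * q x.
Proof.
have [q0|q0] := eqVneq (q x) 0.
  by have [_ [c c0 h]] := cevP F; have := h x; rewrite q0 !mulr0.
have q1 : 0 < q x by rewrite lt_neqAle eq_sym q0 q_ge0.
rewrite -ler_pdivrMr //; apply: lb_le_inf => // c [c0 h].
by rewrite ler_pdivrMr.
Qed.

Definition cnormC (F : completion) : R[i] := (cnorm F)%:C%C.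

Let cnormC_triangle x y : cnormC (x + y) <= cnormC x + cnormC y.
Proof.
rewrite /cnormC -rmorphD lecR /=; apply: cnorm_le; first by rewrite addr_ge0 ?cnorm_ge0.
move=> z; apply: le_trans (rn_triangle _ _) _.
by rewrite mulrDl lerD ?cnorm_bound.
Qed.

Let cnormZ_le a x : cnorm (a *: x) <= rn a * cnorm x.
Proof.
apply: cnorm_le; first by rewrite mulr_ge0 ?rn_ge0 ?cnorm_ge0.
by move=> z; rewrite cevZ rnM -mulrA ler_wpM2l ?rn_ge0 ?cnorm_bound.
Qed.

Let cnormCZ (l : R[i]) x : cnormC (l *: x) = `|l| * cnormC x.
Proof.
rewrite /cnormC rnE -rmorphM /=; congr real_complex_def.
apply/eqP; rewrite eq_le cnormZ_le /=.
have [->|l0] := eqVneq l 0; first by rewrite rn0 mul0r cnorm_ge0.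
have rl : 0 < rn l.
  by rewrite lt_neqAle rn_ge0 andbT eq_sym; apply: contra_neq l0 => /rn_eq0.
rewrite -ler_pdivlMl // -rnV.
by apply: le_trans (cnormZ_le _ _); rewrite scalerA mulVf // scale1r.
Qed.

Let cnormC_eq0 x : cnormC x = 0 -> x = 0.
Proof.
move=> /complexI x0; apply: cev_inj => z; apply: rn_eq0; apply/eqP.
by rewrite eq_le rn_ge0 andbT; have := cnorm_bound x z; rewrite x0 mul0r.
Qed.

HB.instance Definition _ :=
  Lmodule_isNormed.Build R[i] completion cnormC_triangle cnormCZ cnormC_eq0.

Lemma rn_cnorm (F : completion) : rn F = cnorm F.
Proof. by []. Qed.

Lemma cev_bound (F : completion) x : rn (cev F x) <= rn F * q x.
Proof. exact: cnorm_bound. Qed.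

Let cauchy_sconv (u : nat -> completion) : scauchy u -> exists l, sconv u l.
Proof.
move=> cu.
have /choice[F hF] : forall x, exists z, sconv (fun n => cev (u n) x) z.
  move=> x; apply: complex_scomplete => e e0.
  have q1 : 0 < q x + 1 by rewrite ltr_wpDl ?q_ge0.
  have [|n0 h0] := cu (e / (q x + 1)); first by rewrite divr_gt0.
  exists n0 => m n hm hn; rewrite -cevB; apply: le_lt_trans (cev_bound _ _) _.
  have := h0 _ _ hm hn; rewrite ltr_pdivlMr // => h; apply: le_lt_trans h.
  by rewrite ler_wpM2l ?rn_ge0 // lerDl.
have hbound e : 0 < e -> exists n0, forall n, (n0 <= n)%N ->
    forall x, rn (F x - cev (u n) x) <= e * q x.
  move=> /cu[n0 h0]; exists n0 => n hn x.
  apply: (sconv_le (hF x) (n1 := n0)) => m hm; rewrite -cevB.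
  apply: le_trans (cev_bound _ _) _.
  by rewrite ler_wpM2r ?q_ge0 // ltW // h0.
have bF : bounded_antilinear F.
  split=> [a x y|].
    apply: (sconv_unique (hF _)).
    have E n : cev (u n) (a *: x + y) = a^*%C * cev (u n) x + cev (u n) y.
      by have [h _] := cevP (u n).
    rewrite (funext E); exact: sconvD (sconvM _ (hF x)) (hF y).
  have [n0 h0] := hbound 1 ltr01; exists (1 + rn (u n0)).
    by rewrite addr_ge0 ?rn_ge0.
  move=> x; rewrite mulrDl -[F x](subrK (cev (u n0) x)).
  apply: le_trans (rn_triangle _ _) _; rewrite lerD ?cev_bound //.
  exact: h0.
exists (mk_completion bF) => e e0; have e2 : 0 < e / 2 by rewrite divr_gt0.
have [n0 h0] := hbound _ e2; exists n0 => n hn.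
apply: (@le_lt_trans _ _ (e / 2)); last by rewrite ltr_pdivrMr // ltr_pMr // ltr1n.
rewrite rn_cnorm; apply: cnorm_le; first exact: ltW.
by move=> x; rewrite cevB rn_distC; exact: h0.
Qed.

HB.instance Definition _ :=
  Uniform_isComplete.Build completion (seq_complete_cvg cauchy_sconv).

Let emb_bounded a : bounded_antilinear (s a).
Proof.
split=> [b x y|]; first by rewrite sDr sZr.
by exists (q a) => // x; exact: sCS.
Qed.

Definition cemb (a : V) : completion := mk_completion (emb_bounded a).

Lemma cev_emb a b : cev (cemb a) b = s a b. Proof. by []. Qed.

Lemma cemb_linear : linear cemb.
Proof. by move=> a x y; apply: cev_inj => z; rewrite cevD cevZ !cev_emb s_lin. Qed.

Lemma rn_cemb a : rn (cemb a) = q a.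
Proof.
apply/eqP; rewrite eq_le; apply/andP; split.
  by rewrite rn_cnorm; apply: cnorm_le => // x; exact: sCS.
have [->|q0] := eqVneq (q a) 0; first exact: rn_ge0.
have := cev_bound (cemb a) a; rewrite cev_emb sipxx // rn_real ger0_norm ?sqr_ge0 //.
by rewrite expr2 ler_pM2r // lt_neqAle eq_sym q0 q_ge0.
Qed.

Let cembB a b : cemb a - cemb b = cemb (a - b).
Proof.
by rewrite [in RHS]addrC -scaleN1r cemb_linear scaleN1r addrC.
Qed.

(** The variational argument of the Riesz theorem without passage to the limit: a near maximizer a
    of 2 Re F(x) - q(x)^2 represents F up to a small error in the dual norm. *)
Lemma cemb_dense (F : completion) (e : R) : 0 < e -> exists a, rn (F - cemb a) < e.
Proof.
move=> e0; have [Fa _] := cevP F.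
have F0 : cev F 0 = 0.
  by have := Fa (-1) 0 0; rewrite scaler0 addr0 conjcN conjc1 mulN1r addNr.
have FD x y : cev F (x + y) = cev F x + cev F y.
  by have := Fa 1 x y; rewrite scale1r conjc1 mul1r.
have FZ a x : cev F (a *: x) = a^*%C * cev F x.
  by have := Fa a x 0; rewrite F0 !addr0.
pose J x : R := 2 * Re (cev F x) - q x ^+ 2.
have JV_sup : has_sup (range J).
  split; first by exists (J 0), 0.
  exists (rn F ^+ 2) => _ [x _ <-]; rewrite /J.
  have := le_trans (Re_le_rn (cev F x)) (cev_bound F x).
  by have := sqr_ge0 (rn F - q x); rewrite sqrrB; lra.
have [|_ [a _ <-] ha] := @sup_adherent _ (range J) ((e / 2) ^+ 2) _ JV_sup.
  by rewrite exprn_gt0 // divr_gt0.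
exists a; apply: (@le_lt_trans _ _ (e / 2)); last first.
  by rewrite ltr_pdivrMr // ltr_pMr // ltr1n.
have e2 : 0 <= e / 2 by rewrite divr_ge0 ?ltW.
have key x : Re (cev (F - cemb a) x) ^+ 2 <= (e / 2) ^+ 2 * q x ^+ 2.
  apply: quadratic_bound; first exact: sqr_ge0.
  move=> r; have : J (a + r%:C%C *: x) <= sup (range J).
    by apply: sup_upper_bound => //; exists (a + r%:C%C *: x).
  rewrite /J FD FZ conjc_real ReD ReM_real qD_sq sZr conjc_real ReM_real qZ rn_real.
  rewrite exprMn real_normK ?num_real // cevB cev_emb ReB.
  by move: ha; rewrite /J; lra.
rewrite rn_cnorm; apply: cnorm_le => // x.
have [c [c1 hc]] := unit_phase (cev (F - cemb a) x).
have := key ((c^*)%C *: x).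
have -> : cev (F - cemb a) ((c^*)%C *: x) = c * cev (F - cemb a) x.
  by rewrite !cevB FZ !cev_emb sZr conjcK mulrBr.
rewrite hc qZ rn_conj c1 mul1r /= -exprMn.
by rewrite ler_sqr // nnegrE ?rn_ge0 // mulr_ge0 // q_ge0.
Qed.

(** The inner product with a limit of [cemb a_n] has to be the limit of the conjugates of G(a_n).
    The inequality for all a pins down this limit independently of the sequence. *)
Let dot_ex (F G : completion) : exists z : R[i],
  forall a, rn (z - (cev G a)^*%C) <= rn G * rn (F - cemb a).
Proof.
have [u ua uF] := approx_sconv (x := F) (A := range cemb) (fun e e0 =>
  let: ex_intro a ha := cemb_dense F e0 in
  ex_intro2 _ _ (cemb a) (ex_intro2 _ _ a I erefl)
    (eq_ind_r (fun t => t < e) ha (rn_distC (cemb a) F))).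
have /choice[a haa] : forall n, exists a, cemb a = u n.
  by move=> n; have [a _ <-] := ua n; exists a.
have lip b c : rn ((cev G b)^*%C - (cev G c)^*%C) <= rn G * rn (cemb b - cemb c).
  rewrite -rmorphB /= rn_conj cembB rn_cemb.
  have [Ga _] := cevP G.
  have -> : cev G b - cev G c = cev G (b - c).
    by rewrite [b - c]addrC -scaleN1r Ga conjcN conjc1 mulN1r addrC.
  exact: cev_bound.
have [|z hz] := @complex_scomplete R (fun n => (cev G (a n))^*%C).
  move=> e e0; have G1 : 0 < rn G + 1 by rewrite ltr_wpDl ?rn_ge0.
  have [|n0 h0] := sconv_scauchy uF (e := e / (rn G + 1)); first by rewrite divr_gt0.
  exists n0 => m n hm hn; apply: le_lt_trans (lip _ _) _; rewrite !haa.
  have := h0 _ _ hm hn; rewrite ltr_pdivlMr // => h; apply: le_lt_trans h.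
  by rewrite mulrC ler_wpM2l ?rn_ge0 // lerDl.
exists z => b; apply/ler_addgt0Pr => e e0.
have G1 : 0 < rn G + 1 by rewrite ltr_wpDl ?rn_ge0.
have [|n0 h0] := uF (e / (rn G + 1)); first by rewrite divr_gt0.
apply: (sconv_le hz (n1 := n0)) => n hn; apply: le_trans (lip _ _) _.
rewrite haa; have := h0 _ hn; rewrite ltr_pdivlMr // => h.
apply: (@le_trans _ _ (rn G * (rn (F - cemb b) + rn (u n - F)))).
  by rewrite ler_wpM2l ?rn_ge0 // [leRHS]addrC; exact: rn_tri3.
rewrite mulrDr lerD2l; apply: le_trans (ltW h).
by rewrite mulrC ler_wpM2l ?rn_ge0 // lerDl.
Qed.

Definition cdot (F G : completion) : R[i] := projT1 (cid (dot_ex F G)).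

Lemma cdotP F G a : rn (cdot F G - (cev G a)^*%C) <= rn G * rn (F - cemb a).
Proof. exact: projT2 (cid (dot_ex F G)) a. Qed.

Lemma cdot_embl a G : cdot (cemb a) G = (cev G a)^*%C.
Proof.
apply/eqP; rewrite -subr_eq0; apply/eqP/rn_eps => e e0.
by apply: le_trans (cdotP _ _ a) _; rewrite subrr rn0 mulr0 ltW.
Qed.

Lemma cemb_sconv (F : completion) : exists a, sconv (fun n => cemb (a n)) F.
Proof.
have /choice[a ha] : forall n : nat, exists a, rn (F - cemb a) < n.+1%:R^-1.
  by move=> n; apply: cemb_dense; rewrite invr_gt0.
exists a => e /inv_lt_eps[n0 h0]; exists n0 => n /h0; apply: lt_trans.
by rewrite rn_distC.
Qed.

Lemma cdot_sconv F G a : sconv (fun n => cemb (a n)) F ->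
  sconv (fun n => (cev G (a n))^*%C) (cdot F G).
Proof.
move=> aF e e0; have G1 : 0 < rn G + 1 by rewrite ltr_wpDl ?rn_ge0.
have [|n0 h0] := aF (e / (rn G + 1)); first by rewrite divr_gt0.
exists n0 => n /h0; rewrite ltr_pdivlMr // => h; apply: le_lt_trans h.
rewrite rn_distC; apply: le_trans (cdotP _ _ _) _; rewrite rn_distC mulrC.
by rewrite ler_wpM2l ?rn_ge0 // lerDl.
Qed.

Lemma cdot_linear a F F' G : cdot (a *: F + F') G = a * cdot F G + cdot F' G.
Proof.
have [u uF] := cemb_sconv F; have [v vF] := cemb_sconv F'; have [Ga _] := cevP G.
apply: (sconv_unique (u := fun n => (cev G (a *: u n + v n))^*%C)).
  apply: cdot_sconv.
  have -> : (fun n => cemb (a *: u n + v n)) = (fun n => a *: cemb (u n) + cemb (v n)).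
    by apply/funext => n; rewrite cemb_linear.
  apply: sconvD => //; apply: (@sconv_lip _ _ _ ( *:%R a) (rn a)) => // n.
  by rewrite -scalerBr rnZ.
have -> : (fun n => (cev G (a *: u n + v n))^*%C) =
    (fun n => a * (cev G (u n))^*%C + (cev G (v n))^*%C).
  by apply/funext => n; rewrite Ga conjcD conjcM conjcK.
by apply: sconvD; [apply: sconvM|]; exact: cdot_sconv.
Qed.

Lemma cdot_bound F G : rn (cdot F G) <= rn F * rn G.
Proof.
have j0 : cemb 0 = 0 by have := cembB 0 0; rewrite subrr subr0 => <-.
have [Ga _] := cevP G.
have G0 : cev G 0 = 0.
  by have := Ga (-1) 0 0; rewrite scaler0 addr0 conjcN conjc1 mulN1r addNr.
by have := cdotP F G 0; rewrite G0 conjc0 j0 !subr0 mulrC.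
Qed.

Let cdotBl F F' G : cdot (F - F') G = cdot F G - cdot F' G.
Proof.
by rewrite [F - F']addrC -scaleN1r cdot_linear mulN1r addrC.
Qed.

Let cdotBr F G G' : cdot F (G - G') = cdot F G - cdot F G'.
Proof.
have [u uF] := cemb_sconv F.
apply: (sconv_unique (cdot_sconv (G - G') uF)).
have -> : (fun n => (cev (G - G') (u n))^*%C) =
    (fun n => (cev G (u n))^*%C + (-1) * (cev G' (u n))^*%C).
  by apply/funext => n; rewrite cevB conjcD conjcN mulN1r.
rewrite (_ : _ - _ = cdot F G + (-1) * cdot F G'); last by rewrite mulN1r.
apply: sconvD; first exact: cdot_sconv.
by apply: sconvM; exact: cdot_sconv.
Qed.

Lemma cdot_embr F b : cdot F (cemb b) = cev F b.
Proof.
have [u uF] := cemb_sconv F; apply: (sconv_unique (cdot_sconv (cemb b) uF)).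
have -> : (fun n => (cev (cemb b) (u n))^*%C) = (fun n => cev (cemb (u n)) b).
  by apply/funext => n; rewrite !cev_emb -sC.
apply: (@sconv_lip _ _ _ (fun G => cev G b) (q b)) => // n.
by rewrite -cevB mulrC cev_bound.
Qed.

Lemma cdotC F G : cdot G F = (cdot F G)^*%C.
Proof.
have [v vG] := cemb_sconv G.
apply: (sconv_unique (cdot_sconv F vG)); apply: sconv_conj.
have -> : (fun n => cev F (v n)) = (fun n => cdot F (cemb (v n))).
  by apply/funext => n; rewrite cdot_embr.
apply: (@sconv_lip _ _ _ (cdot F) (rn F)) => // n.
by rewrite -cdotBr cdot_bound.
Qed.

Lemma cdot_norm F : `|F| ^+ 2 = cdot F F.
Proof.
apply/esym/eqP; rewrite -subr_eq0; apply/eqP/rn_eps => e e0.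
have F1 : 0 < 2 * (2 * rn F + 1) by rewrite mulr_gt0 // ltr_wpDl ?mulr_ge0 ?rn_ge0.
(* For x within d <= 1 of F, the form and the squared norm each change by at most d (2 |F| + 1)
   between F and x; two such errors add up to at most e. *)
pose d := Num.min 1 (e / (2 * (2 * rn F + 1))).
have d0 : 0 < d by rewrite lt_min ltr01 divr_gt0.
have [a ha] := cemb_dense F d0; set x := cemb a in ha.
have d1 : d <= 1 by rewrite ge_min lexx.
have hx : rn x <= rn F + d.
  have := rn_tri3 x F 0; rewrite !subr0 rn_distC => /le_trans; apply.
  by rewrite addrC lerD2l ltW.
have hx' : rn F <= rn x + d.
  have := rn_tri3 F x 0; rewrite !subr0 => /le_trans; apply.
  by rewrite addrC lerD2l ltW.
have xx : cdot x x = `|x| ^+ 2.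
  by rewrite /x cdot_embl cev_emb -sC rnE rn_cemb -rmorphXn sipxx.
have h1 : rn (cdot F F - cdot x x) <= d * (2 * rn F + 1).
  have -> : cdot F F - cdot x x = cdot (F - x) F + cdot x (F - x).
    by rewrite cdotBl cdotBr addrA subrK.
  apply: le_trans (rn_triangle _ _) _.
  have := cdot_bound (F - x) F; have := cdot_bound x (F - x).
  have : rn (F - x) * rn F <= d * rn F by rewrite ler_wpM2r ?rn_ge0 // ltW.
  have : rn x * rn (F - x) <= (rn F + 1) * d.
    by rewrite ler_pM ?rn_ge0 ?(ltW ha) //; apply: le_trans hx _; rewrite lerD2l.
  lra.
have h2 : rn (cdot x x - `|F| ^+ 2) <= d * (2 * rn F + 1).
  rewrite xx !rnE -!rmorphXn -rmorphB /= rn_real subr_sqr normrM ler_pM //.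
    by rewrite ler_norml; apply/andP; split; lra.
  by rewrite ger0_norm ?addr_ge0 ?rn_ge0 //; lra.
apply: (rn_le3 h1 h2); rewrite -mulr2n -mulr_natl.
have : d <= e / (2 * (2 * rn F + 1)) by rewrite ge_min lexx orbT.
rewrite ler_pdivlMr //; lra.
Qed.

Definition completion_hilbert : hilbertSpace R :=
  HilbertSpace cdot_linear cdotC cdot_norm.

Lemma hilbert_completion : exists (K : hilbertSpace R) (j : V -> K),
  [/\ linear j, forall a b, hdot (j a) (j b) = s a b &
      forall (x : K) (e : R), 0 < e -> exists a, rn (x - j a) < e].
Proof.
exists completion_hilbert, cemb; split; first exact: cemb_linear.
- by move=> a b; rewrite /= cdot_embl cev_emb -sC.
- exact: cemb_dense.
Qed.

End Completion.

(** * The Haar integral and unitary representations *)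

Section ContinuousFunctions.
Variables (R : realType) (T : topologicalType).
Implicit Types (f g k : T -> R[i]).

Lemma continuous_rnP (V : normedModType R[i]) (f : T -> V) :
  continuous f <-> forall x (e : R), 0 < e -> \forall y \near x, rn (f y - f x) < e.
Proof.
split=> [cf x e e0|h x A /nbhs_rnP[e e0 hA]].
  by apply: (cf x [set v | rn (v - f x) < e]); apply/nbhs_rnP; exists e.
by apply: filterS (h x _ e0) => y; exact: hA.
Qed.

Lemma continuous_realP (h : T -> R) :
  continuous h <-> continuous (fun x => (h x)%:C%C : R[i]).
Proof.
split=> [ch|/continuous_rnP ch].
  apply/continuous_rnP => x e e0.
  have hb : nbhs x (h @^-1` ball (h x) e) by apply: (ch x); exact: nbhsx_ballx.
  apply: filterS hb => y; rewrite /ball /= => hy.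
  by rewrite -rmorphB rn_real /= distrC.
move=> x A /nbhs_ballP[e /= e0 hA]; apply: filterS (ch x e e0) => y.
rewrite -rmorphB rn_real /= distrC => hy; exact: hA.
Qed.

Lemma continuous_nbhs_gt (h : T -> R) x a : continuous h -> a < h x ->
  nbhs x [set y | a < h y].
Proof.
move=> ch ax; have hb : nbhs x (h @^-1` ball (h x) (h x - a)).
  by apply: (ch x); apply: nbhsx_ballx; rewrite subr_gt0.
by apply: filterS hb => y; rewrite /ball /= => /ltr_distlDr; lra.
Qed.

Lemma continuous_lip (V W : normedModType R[i]) (f : T -> V) (g : T -> W) (c : R) :
  continuous f -> (forall x y, rn (g y - g x) <= c * rn (f y - f x)) -> continuous g.
Proof.
move=> /continuous_rnP cf h; apply/continuous_rnP => x e e0.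
have c1 : 0 < `|c| + 1 by rewrite ltr_pwDr.
have e1 : 0 < e / (`|c| + 1) by rewrite divr_gt0.
apply: filterS (cf x _ e1) => y; rewrite ltr_pdivlMr // => hy.
apply: le_lt_trans (h _ _) _; apply: le_lt_trans hy.
rewrite mulrC ler_wpM2l ?rn_ge0 //.
by apply: (le_trans (ler_norm _)); rewrite lerDl.
Qed.

Lemma continuous_addc f g :
  continuous f -> continuous g -> continuous (fun x => f x + g x).
Proof.
move=> /continuous_rnP cf /continuous_rnP cg; apply/continuous_rnP => x e e0.
have e2 : 0 < e / 2 by rewrite divr_gt0.
apply: filterS2 (cf x _ e2) (cg x _ e2) => y hf hg.
rewrite opprD addrACA; apply: le_lt_trans (rn_triangle _ _) _.
by rewrite [ltRHS]splitr ltrD.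
Qed.

Lemma continuous_mulc f g : continuous f -> continuous g ->
  continuous (fun x => f x * g x).
Proof.
move=> /continuous_rnP cf /continuous_rnP cg; apply/continuous_rnP => x e e0.
have fx : 0 < rn (f x) + 1 by rewrite ltr_wpDl ?rn_ge0.
have gx : 0 < rn (g x) + 1 by rewrite ltr_wpDl ?rn_ge0.
have e1 : 0 < Num.min 1 (e / 2 / (rn (f x) + 1)) by rewrite lt_min ltr01 !divr_gt0.
have e2 : 0 < e / 2 / (rn (g x) + 1) by rewrite !divr_gt0.
apply: filterS2 (cf x _ e2) (cg x _ e1) => y hf.
rewrite lt_min => /andP[hg1 hg2].
have -> : f y * g y - f x * g x = (f y - f x) * g y + f x * (g y - g x).
  by rewrite mulrBl mulrBr addrA subrK.
apply: le_lt_trans (rn_triangle _ _) _; rewrite [ltRHS]splitr !rnM.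
have gy : rn (g y) <= rn (g x) + 1.
  rewrite -[g y](subrK (g x)); apply: le_trans (rn_triangle _ _) _.
  by rewrite addrC lerD2l ltW.
apply: ler_ltD.
  apply: (@le_trans _ _ (e / 2 / (rn (g x) + 1) * (rn (g x) + 1))).
    by apply: ler_pM; rewrite ?rn_ge0 // ltW.
  by rewrite divfK // gt_eqF.
rewrite mulrC; apply: (@le_lt_trans _ _ (rn (g y - g x) * (rn (f x) + 1))).
  by rewrite ler_wpM2l ?rn_ge0 // lerDl.
by rewrite -ltr_pdivlMr.
Qed.

Lemma continuous_scalec (a : R[i]) f :
  continuous f -> continuous (fun x => a * f x).
Proof.
by move=> cf; apply: (continuous_lip (c := rn a) cf) => x y; rewrite -mulrBr rnM.
Qed.

Lemma continuous_rn (V : normedModType R[i]) (f : T -> V) :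
  continuous f -> continuous (fun x => (rn (f x))%:C%C : R[i]).
Proof.
move=> cf; apply: (continuous_lip (c := 1) cf) => x y.
rewrite -rmorphB rn_real /= mul1r.
have h1 := rn_triangle (f y - f x) (f x); rewrite subrK in h1.
have h2 := rn_triangle (f x - f y) (f y); rewrite subrK rn_distC in h2.
by rewrite ler_norml; apply/andP; split; lra.
Qed.

Lemma continuous_sumc (I : Type) (s : seq I) (f : I -> T -> R[i]) :
  (forall i, continuous (f i)) -> continuous (fun x => \sum_(i <- s) f i x).
Proof.
move=> cf; elim: s => [|i s ih].
  rewrite (_ : (fun _ => _) = fun=> 0); first exact: cst_continuous.
  by apply/funext => x; rewrite big_nil.
rewrite (_ : (fun _ => _) = fun x => f i x + \sum_(j <- s) f j x).
  exact: (continuous_addc (cf i) ih).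
by apply/funext => x; rewrite big_cons.
Qed.

Lemma CcW f : Cc f -> continuous f. Proof. by case. Qed.

Lemma Cc_compact f : Cc f -> compact (closure [set x | f x != 0]). Proof. by case. Qed.

Lemma Cc_support f x : ~ closure [set x | f x != 0] x -> f x = 0.
Proof.
move=> h; apply/eqP; apply: contra_notT h => fx.
exact: subset_closure.
Qed.

Lemma Cc_sub (K : set T) f : compact K -> closed K -> continuous f ->
  (forall x, f x != 0 -> K x) -> Cc f.
Proof.
move=> cK clK cf h; split=> //; apply: (subclosed_compact _ cK).
  exact: closed_closure.
by rewrite [X in _ `<=` X](closure_id K).1 //; apply: closureS.
Qed.

Lemma Cc_dom f g : Cc f -> continuous g -> (forall x, f x = 0 -> g x = 0) -> Cc g.
Proof.
move=> [cf kf] cg h; apply: (Cc_sub kf) => //; first exact: closed_closure.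
move=> x gx; apply: subset_closure => /=; apply: contra_neq gx; exact: h.
Qed.

Lemma Cc_add f g : Cc f -> Cc g -> Cc (fun x => f x + g x).
Proof.
move=> [cf kf] [cg kg]; apply: (@Cc_sub (closure [set x | f x != 0] `|` closure [set x | g x != 0])).
- exact: compactU.
- by apply: closedU; exact: closed_closure.
- exact: (continuous_addc cf cg).
move=> x; have [-> |fx _] := eqVneq (f x) 0; last by left; exact: subset_closure.
by rewrite add0r => gx; right; exact: subset_closure.
Qed.

Lemma Cc_mulr f k : Cc f -> continuous k -> Cc (fun x => f x * k x).
Proof.
move=> ccf ck; apply: (Cc_dom ccf); first exact: (continuous_mulc (CcW ccf) ck).
by move=> x ->; rewrite mul0r.
Qed.

Lemma Cc_scale f a : Cc f -> Cc (fun x => a * f x).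
Proof.
move=> ccf; apply: (Cc_dom ccf); first exact: (continuous_scalec (CcW ccf)).
by move=> x ->; rewrite mulr0.
Qed.

Lemma Cc_lin a f g : Cc f -> Cc g -> Cc (fun x => a * f x + g x).
Proof. by move=> ccf ccg; exact: (Cc_add (Cc_scale a ccf) ccg). Qed.

Lemma Cc_sub2 f g : Cc f -> Cc g -> Cc (fun x => f x - g x).
Proof.
move=> ccf ccg; rewrite (_ : (fun _ => _) = fun x => f x + (-1) * g x).
  exact: (Cc_add ccf (Cc_scale (-1) ccg)).
by apply/funext => x; rewrite mulN1r.
Qed.

Lemma Cc_rn f : Cc f -> Cc (fun x => (rn (f x))%:C%C : R[i]).
Proof.
move=> ccf; apply: (Cc_dom ccf); first exact: (continuous_rn (CcW ccf)).
by move=> x ->; rewrite rn0.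
Qed.

Lemma Cc0 f : Cc f -> Cc (fun _ : T => 0 : R[i]).
Proof. by move=> ccf; apply: (Cc_dom ccf) => //; exact: cst_continuous. Qed.

Lemma Cc_sum f0 (I : Type) (s : seq I) (f : I -> T -> R[i]) : Cc f0 ->
  (forall i, Cc (f i)) -> Cc (fun x => \sum_(i <- s) f i x).
Proof.
move=> ccf0 cf; elim: s => [|i s ih].
  rewrite (_ : (fun _ => _) = fun=> 0); first exact: Cc0 ccf0.
  by apply/funext => x; rewrite big_nil.
rewrite (_ : (fun _ => _) = fun x => f i x + \sum_(j <- s) f j x).
  exact: (Cc_add (cf i) ih).
by apply/funext => x; rewrite big_cons.
Qed.

(** The near-covering form of compactness, for the filter of finite sequences that eventually
    contain any prescribed points. *)
Lemma compact_finite_cover (K : set T) (W : T -> set T) : compact K ->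
  (forall z, K z -> nbhs z (W z)) ->
  exists s : seq T, (forall z, z \in s -> K z) /\
    forall x, K x -> exists2 z, z \in s & W z x.
Proof.
move=> /compact_near_coveringP cK hW.
pose F : set_system (seq T) := filter_from [set: seq T] (fun s0 : seq T => [set s : seq T | {subset s0 <= s}]).
have FF : Filter F.
  apply: filter_from_filter; first by exists [::].
  move=> s1 s2 _ _; exists (s1 ++ s2) => // s /= h; split=> z zs; apply: h.
    by rewrite mem_cat zs.
  by rewrite mem_cat zs orbT.
have [|s0 _ hs0] := cK _ F (fun s x => exists2 z, z \in s & K z /\ W z x) FF.
  move=> x Kx; exists (W x, [set s : seq T | x \in s]).
    by split; [exact: hW | exists [:: x] => // s /=; apply; rewrite inE].
  by move=> [y s] [/= Wxy xs]; exists x.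
have := hs0 s0 (fun _ h => h) => {}hs0.
exists [seq z <- s0 | `[< K z >]]; split=> [z|x /hs0 /= [z zs [Kz Wzx]]].
  by rewrite mem_filter => /andP[/asboolP].
by exists z => //; rewrite mem_filter zs andbT; apply/asboolP.
Qed.

End ContinuousFunctions.

(** * Elementary properties of the Haar integral *)

Section Haar.
Variables (R : realType) (L : topGroupType) (mu : haarIntegral R L).
Hypothesis hL : hausdorff_space L.
Implicit Types (f g k : L -> R[i]).

Lemma continuous_mull (a : L) : continuous (fun x : L => (a * x)%g).
Proof.
move=> x; apply: (@continuous_comp _ _ _ (fun z => (a, z)) (fun z : L * L => (z.1 * z.2)%g)).
  by apply: cvg_pair; [exact: cvg_cst | exact: cvg_id].
exact: mulg_continuous.
Qed.

Lemma continuous_mulr (a : L) : continuous (fun x : L => (x * a)%g).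
Proof.
move=> x; apply: (@continuous_comp _ _ _ (fun z => (z, a)) (fun z : L * L => (z.1 * z.2)%g)).
  by apply: cvg_pair; [exact: cvg_id | exact: cvg_cst].
exact: mulg_continuous.
Qed.

Lemma continuous_shift (V : topologicalType) (f : L -> V) a :
  continuous f -> continuous (fun x => f (a * x)%g).
Proof. by move=> cf x; apply: (continuous_comp (@continuous_mull a x)); exact: cf. Qed.

Lemma nbhs_mull (a x : L) (A : set L) : nbhs (a * x)%g A ->
  nbhs x [set y | A (a * y)%g].
Proof. exact: (continuous_mull (a := a)). Qed.

Lemma Cc_shift f a : Cc f -> Cc (fun x => f (a * x)%g).
Proof.
move=> ccf; pose K := closure [set x | f x != 0].
have cK' : compact ((fun x => (a^-1 * x)%g) @` K).
  apply: continuous_compact; last exact: Cc_compact.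
  by apply: continuous_subspaceT; exact: continuous_mull.
apply: (Cc_sub cK') => //; first exact: compact_closed.
  by apply: continuous_shift; exact: CcW.
move=> x fx; exists (a * x)%g; first exact: subset_closure.
by rewrite mulKg.
Qed.

Lemma eq_mu f g : (forall x, f x = g x) -> mu f = mu g.
Proof. by move=> /funext ->. Qed.

Lemma muD f g : Cc f -> Cc g -> mu (fun x => f x + g x) = mu f + mu g.
Proof.
move=> ccf ccg; have := haar_linear mu 1 ccf ccg; rewrite mul1r => <-.
by apply: eq_mu => x; rewrite mul1r.
Qed.

Lemma mu0 : mu (fun=> 0) = 0.
Proof.
have [f ccf _] := haar_neq0 mu; have c0 := Cc0 ccf.
have h : mu (fun=> 0) = mu (fun=> 0) + mu (fun=> 0).
  by rewrite -(muD c0 c0); apply: eq_mu => x; rewrite addr0.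
by apply: (addrI (mu (fun=> 0))); rewrite -h addr0.
Qed.

Lemma muZ a f : Cc f -> mu (fun x => a * f x) = a * mu f.
Proof.
move=> ccf; have := haar_linear mu a ccf (Cc0 ccf).
rewrite mu0 addr0 => <-; apply: eq_mu => x; exact: esym (addr0 _).
Qed.

Lemma muB f g : Cc f -> Cc g -> mu (fun x => f x - g x) = mu f - mu g.
Proof.
move=> ccf ccg; rewrite -mulN1r -muZ // -muD //; last exact: Cc_scale.
by apply: eq_mu => x; rewrite mulN1r.
Qed.

Lemma mu_sum (I : Type) (s : seq I) (f : I -> L -> R[i]) :
  (forall i, Cc (f i)) ->
  mu (fun x => \sum_(i <- s) f i x) = \sum_(i <- s) mu (f i).
Proof.
move=> ccf; elim: s => [|i s ih].
  by rewrite big_nil; apply: etrans mu0; apply: eq_mu => x; rewrite big_nil.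
rewrite big_cons -ih -muD //; last exact: Cc_sum (ccf i) ccf.
by apply: eq_mu => x; rewrite big_cons.
Qed.

Lemma mu_shift f a : Cc f -> mu (fun x => f (a * x)%g) = mu f.
Proof. exact: haar_left. Qed.

Let real_of_ge0 (z : R[i]) : 0 <= z -> z = (Re z)%:C%C.
Proof. by move=> z0; rewrite RRe_real // ger0_real. Qed.

(** A real function is the difference of the nonnegative functions |h| + h and |h|. *)
Lemma mu_real (h : L -> R) : Cc (fun x => (h x)%:C%C : R[i]) ->
  mu (fun x => (h x)%:C%C) = (Re (mu (fun x => (h x)%:C%C)))%:C%C.
Proof.
move=> cch; have ccr := Cc_rn cch.
have h1 : 0 <= mu (fun x => (rn (h x)%:C%C)%:C%C + (h x)%:C%C).
  apply: haar_ge0; first exact: Cc_add.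
  by move=> x; rewrite rn_real -rmorphD lecR /= -lerBlDr sub0r ler_normr lexx orbT.
have h2 : 0 <= mu (fun x => (rn (h x)%:C%C)%:C%C).
  by apply: haar_ge0 => // x; rewrite lecR rn_ge0.
have -> : mu (fun x => (h x)%:C%C) = mu (fun x => (rn (h x)%:C%C)%:C%C + (h x)%:C%C)
    - mu (fun x => (rn (h x)%:C%C)%:C%C).
  by rewrite muD // [X in X - _]addrC addrK.
by rewrite (real_of_ge0 h1) (real_of_ge0 h2) -rmorphB.
Qed.

(** The L^1-norm. *)
Definition mun f : R := Re (mu (fun x => (rn (f x))%:C%C)).

Lemma mu_mono (h k : L -> R) : Cc (fun x => (h x)%:C%C : R[i]) ->
  Cc (fun x => (k x)%:C%C : R[i]) -> (forall x, h x <= k x) ->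
  Re (mu (fun x => (h x)%:C%C)) <= Re (mu (fun x => (k x)%:C%C)).
Proof.
move=> cch cck hk; have := haar_ge0 mu (Cc_sub2 cck cch).
rewrite muB // lecE => /(_ _)/andP[]; last by rewrite ReB subr_ge0.
by move=> x; rewrite -rmorphB lecR /= subr_ge0.
Qed.

Lemma mun_ge0 f : Cc f -> 0 <= mun f.
Proof.
move=> ccf; have : 0 <= mu (fun x => (rn (f x))%:C%C).
  by apply: haar_ge0; [exact: Cc_rn | move=> x; rewrite lecR rn_ge0].
by rewrite lecE => /andP[].
Qed.

(** After multiplication by a phase the integral is its own modulus, hence the integral of a real
    part, which is dominated by |f|. *)
Lemma mu_bound f : Cc f -> rn (mu f) <= mun f.
Proof.
move=> ccf; have [c [c1 hc]] := unit_phase (mu f).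
have ccg := Cc_scale c ccf.
have cRe : Cc (fun x => (Re (c * f x))%:C%C : R[i]).
  apply: (Cc_dom ccg); last by move=> x ->.
  apply: (continuous_lip (c := 1) (CcW ccg)) => x y.
  rewrite -rmorphB rn_real /= mul1r -ReB.
  by rewrite -ler_sqr ?nnegrE ?rn_ge0 // real_normK ?num_real // rn_sqr lerDl sqr_ge0.
have cIm : Cc (fun x => (Im (c * f x))%:C%C : R[i]).
  apply: (Cc_dom ccg); last by move=> x ->.
  apply: (continuous_lip (c := 1) (CcW ccg)) => x y.
  have ImB (a b : R[i]) : Im a - Im b = Im (a - b) by case: a b => ? ? [].
  rewrite -rmorphB rn_real /= mul1r ImB.
  by rewrite -ler_sqr ?nnegrE ?rn_ge0 // real_normK ?num_real // rn_sqr lerDr sqr_ge0.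
have E : (rn (mu f))%:C%C = mu (fun x => (Re (c * f x))%:C%C)
    + 'i%C * mu (fun x => (Im (c * f x))%:C%C).
  rewrite -hc -muZ // -muZ // -muD //; last exact: Cc_scale.
  by apply: eq_mu => x; exact: complexE.
have -> : rn (mu f) = Re (mu (fun x => (Re (c * f x))%:C%C)).
  move/(congr1 (@complex.Re R)): E; rewrite /= => ->.
  rewrite ReD (mu_real cIm).
  by move: (Re (mu (fun x => (Im (c * f x))%:C%C))) => r /=; rewrite mul0r mul1r subr0 addr0.
apply: mu_mono => //; first exact: Cc_rn.
by move=> x; apply: le_trans (Re_le_rn _) _; rewrite rnM c1 mul1r.
Qed.

Lemma mun_dom f (c : R) g : Cc f -> Cc g -> (forall x, rn (f x) <= c * rn (g x)) ->
  mun f <= c * mun g.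
Proof.
move=> ccf ccg h; rewrite /mun -ReM_real -muZ; last exact: Cc_rn.
have E : (fun x => c%:C%C * (rn (g x))%:C%C : R[i]) = (fun x => (c * rn (g x))%:C%C).
  by apply/funext => x; rewrite rmorphM.
rewrite E; apply: mu_mono => //; first exact: Cc_rn.
by rewrite -E; apply: Cc_scale; exact: Cc_rn.
Qed.

(** The nonzero functional [mu] provides some f in [Cc] that is nonzero at a point; a translate of
    its support is a neighbourhood of x. *)
Lemma compact_nbhs (x : L) : exists2 K : set L, nbhs x K & compact K /\ closed K.
Proof.
have [f ccf muf] := haar_neq0 mu.
have [x0 fx0] : exists x0, f x0 != 0.
  apply: contra_neqP muf => /forallNP h; rewrite -[RHS]mu0; congr (haar mu _).
  by apply/funext => y; apply/eqP; have /negP := h y; rewrite negbK.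
pose f' y := f (x0 * x^-1 * y)%g.
have ccf' : Cc f' by exact: Cc_shift.
exists (closure [set y | f' y != 0]); last first.
  by split; [exact: Cc_compact | exact: closed_closure].
apply: filterS (@subset_closure _ _) _.
have f'x : 0 < rn (f' x).
  rewrite /f' mulgVK lt_neqAle rn_ge0 andbT eq_sym.
  by apply: contra_neq fx0 => /rn_eq0.
have /continuous_rnP/(_ x _ f'x) := CcW ccf'; apply: filterS => y hy /=.
by apply: contraTneq hy => ->; rewrite sub0r rnN ltxx.
Qed.

Lemma haar_locally_compact : locally_compact [set: L].
Proof.
move=> x _; have [K nbK [cK clK]] := compact_nbhs x.
by exists K; first by rewrite /within /=; apply: filterS nbK.
Qed.

(** A Urysohn function separating x from the complement of an open W inside [U] and a compact K,
    subtracted from 1; the compact support comes from K. *)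
Lemma bump (x : L) (U : set L) : nbhs x U ->
  exists h : L -> R, [/\ Cc (fun y => (h y)%:C%C : R[i]), h x = 1,
    (forall y, 0 <= h y <= 1) & (forall y, h y != 0 -> U y)].
Proof.
move=> Ux; have [K nbK [cK clK]] := compact_nbhs x.
have [W [oW Wx WUK]] : exists W, [/\ open W, W x & W `<=` U `&` K].
  have : nbhs x (U `&` K) by exact: filterI.
  by rewrite nbhsE => -[W [oW Wx] hW]; exists W.
have us : uniform_separator [set x] (~` W).
  apply: (@locally_compact_completely_regular L R haar_locally_compact hL).
    by rewrite closedC.
  by [].
pose u : L -> R := Urysohn [set x] (~` W).
have ur y : 0 <= u y <= 1.
  by have : range u (u y) by []; move=> /Urysohn_range; rewrite /= in_itv.
have u0 : u x = 0 by apply: (Urysohn_sub0 us); exists x.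
have u1 y : ~ W y -> u y = 1 by move=> Wy; apply: (Urysohn_sub1 us); exists y.
have hW y : 1 - u y != 0 -> W y.
  by apply: contra_neqP => /u1 ->; rewrite subrr.
exists (fun y => 1 - u y); split.
- apply: (Cc_sub cK clK).
    apply/continuous_realP => y; apply: cvgB; first exact: cvg_cst.
    exact: Urysohn_continuous.
  move=> y hy; apply: (WUK y _).2; apply: hW.
  by apply: contra_neq hy => ->.
- by rewrite u0 subr0.
- by move=> y; have := ur y; move=> /andP[? ?]; apply/andP; split; lra.
- by move=> y /hW /WUK[].
Qed.

End Haar.

(** * Riemann sums and strict positivity of the integral *)

Section RiemannSums.
Variables (R : realType) (L : topGroupType) (mu : haarIntegral R L).
Hypothesis hL : hausdorff_space L.
Implicit Types (f g k : L -> R[i]).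

Lemma continuous_realD (h k : L -> R) : continuous h -> continuous k ->
  continuous (fun x => h x + k x).
Proof. by move=> ch ck x; apply: cvgD; [exact: ch | exact: ck]. Qed.

Lemma continuous_real_sum (I : Type) (s : seq I) (h : I -> L -> R) :
  (forall i, continuous (h i)) -> continuous (fun x => \sum_(i <- s) h i x).
Proof.
move=> ch; elim: s => [|i s ih].
  rewrite (_ : (fun _ => _) = fun=> 0); first exact: cst_continuous.
  by apply/funext => x; rewrite big_nil.
rewrite (_ : (fun _ => _) = fun x => h i x + \sum_(j <- s) h j x).
  exact: (continuous_realD (ch i) ih).
by apply/funext => x; rewrite big_cons.
Qed.

Lemma partition_of_unity (K : set L) (W : L -> set L) : compact K ->
  (forall z, nbhs z (W z)) ->
  exists (s : seq L) (h : L -> L -> R), [/\ (forall z, z \in s -> K z),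
    (forall z, continuous (h z)), (forall z x, 0 <= h z x),
    (forall z x, h z x != 0 -> W z x) &
    (forall x, K x -> \sum_(z <- s) h z x = 1)].
Proof.
move=> cK hW.
have /choice[b hb] : forall z, exists h : L -> R,
    [/\ Cc (fun y => (h y)%:C%C : R[i]), h z = 1,
    (forall y, 0 <= h y <= 1) & (forall y, h y != 0 -> W z y)].
  by move=> z; exact: (bump mu hL (hW z)).
have bc z : continuous (b z) by apply/continuous_realP; case: (hb z) => /CcW.
have b0 z x : 0 <= b z x by case: (hb z) => _ _ /(_ x)/andP[].
have [|s [sK hs]] := @compact_finite_cover L K (fun z => [set x | 2^-1 < b z x]) cK.
  move=> z _; have [_ bz _ _] := hb z.
  by apply: continuous_nbhs_gt => //; rewrite bz; lra.
pose S x := \sum_(z <- s) b z x.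
have S0 x : 0 <= S x by apply: sumr_ge0.
have SK x : K x -> 2^-1 <= S x.
  move=> /hs[z zs hz]; apply: le_trans (ltW hz) _.
  by rewrite /S (big_rem z) //= lerDl; apply: sumr_ge0.
(* Equal to [S] on [K], where [S] is at least 1/2, and bounded away from 0 everywhere, so that the
   quotients stay continuous off [K]. *)
pose m x := Num.max (S x) 2^-1.
have m0 x : 0 < m x by rewrite lt_max invr_gt0 ltr0n orbT.
have cm : continuous m.
  move=> x; apply: (@continuous_max _ _ S (fun=> 2^-1)).
    exact: continuous_real_sum.
  exact: cvg_cst.
have sumE x : \sum_(z <- s) b z x / m x = S x / m x by rewrite -mulr_suml.
exists s, (fun z x => b z x / m x); split=> //.
- move=> z x; apply: cvgM; first exact: bc.
  by apply: cvgV; [rewrite gt_eqF | exact: cm].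
- by move=> z x; rewrite divr_ge0 // ltW.
- move=> z x h; have [_ _ _] := hb z; apply.
  by apply: contra_neq h => ->; rewrite mul0r.
- move=> x /SK h; rewrite sumE /m; move/max_idPl: (h) => ->.
  by rewrite divff // gt_eqF //; apply: lt_le_trans h; rewrite invr_gt0.
Qed.

(** The weights are the integrals of f against a partition of unity subordinate to [W]. They depend
    on f and [W] alone, so that one sum serves all integrands k with the given oscillation, in
    particular all matrix coefficients at once. *)
Lemma riemann f (W : L -> set L) : Cc f -> (forall z, nbhs z (W z)) ->
  exists s : seq (R[i] * L),
    (forall p, p \in s -> closure [set x | f x != 0] p.2) /\
    forall k (e : R), 0 <= e -> continuous k ->
      (forall z x, W z x -> rn (k x - k z) <= e) ->
      rn (mu (fun x => f x * k x) - \sum_(p <- s) p.1 * k p.2) <= e * mun mu f.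
Proof.
move=> ccf hW.
have [s [h [sK ch h0 hsW hsK]]] := partition_of_unity (Cc_compact ccf) hW.
have chC z : continuous (fun x => (h z x)%:C%C : R[i]) by apply/continuous_realP.
have ccfh z : Cc (fun x => f x * (h z x)%:C%C) by exact: (Cc_mulr ccf (chC z)).
exists [seq (mu (fun x => f x * (h z x)%:C%C), z) | z <- s]; split.
  by move=> p /mapP[z zs ->] /=; exact: sK.
move=> k e e0 ck hk; rewrite big_map /=.
have ccS : Cc (fun x => \sum_(z <- s) k z * (f x * (h z x)%:C%C)).
  exact: (Cc_sum s ccf (fun z => Cc_scale (k z) (ccfh z))).
have ccfk : Cc (fun x => f x * k x) by exact: (Cc_mulr ccf ck).
have -> : \sum_(z <- s) mu (fun x => f x * (h z x)%:C%C) * k z =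
    mu (fun x => \sum_(z <- s) k z * (f x * (h z x)%:C%C)).
  rewrite (mu_sum mu s (fun z => Cc_scale (k z) (ccfh z))).
  by apply: eq_bigr => z _; rewrite (muZ mu (k z) (ccfh z)) mulrC.
rewrite -(muB mu ccfk ccS); apply: le_trans (mu_bound mu (Cc_sub2 ccfk ccS)) _.
apply: (mun_dom mu (Cc_sub2 ccfk ccS) ccf) => x.
have [fx|fx] := eqVneq (f x) 0.
  rewrite fx mul0r rn0 mulr0 big1 ?subrr ?rn0 // => z _.
  by rewrite mul0r mulr0.
have Kx : closure [set x | f x != 0] x by exact: subset_closure.
have E : f x * k x - \sum_(z <- s) k z * (f x * (h z x)%:C%C) =
    \sum_(z <- s) f x * ((h z x)%:C%C * (k x - k z)).
  rewrite -mulr_sumr.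
  under [in RHS]eq_bigr do rewrite mulrBr.
  rewrite sumrB mulrBr -mulr_suml -rmorph_sum /= hsK // mul1r; congr (_ - _).
  rewrite mulr_sumr; apply: eq_bigr => z _.
  by rewrite mulrCA [k z * _]mulrC.
rewrite E; apply: le_trans (rn_sum _ _ _) _.
apply: (@le_trans _ _ (\sum_(z <- s) rn (f x) * (h z x * e))).
  apply: ler_sum => z _; rewrite !rnM rn_real ger0_norm //.
  have [->|hz] := eqVneq (h z x) 0; first by rewrite !mul0r !mulr0.
  by rewrite ler_wpM2l ?rn_ge0 // ler_wpM2l //; apply: hk; exact: hsW.
by rewrite -mulr_sumr -mulr_suml hsK // mul1r mulrC.
Qed.

Lemma compact_majorant (K : set L) : compact K ->
  exists chi : L -> R[i], [/\ Cc chi, (forall x, 0 <= chi x) & forall x, K x -> 1 <= rn (chi x)].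
Proof.
move=> cK; have [f0 ccf0 _] := haar_neq0 mu.
have /choice[b hb] : forall z, exists h : L -> R,
    [/\ Cc (fun y => (h y)%:C%C : R[i]), h z = 1,
    (forall y, 0 <= h y <= 1) & (forall y, h y != 0 -> setT y)].
  by move=> z; apply: (bump mu hL); exact: filterT.
have bc z : continuous (b z) by apply/continuous_realP; case: (hb z) => /CcW.
have b0 z x : 0 <= b z x by case: (hb z) => _ _ /(_ x)/andP[].
have [|s [sK hs]] := @compact_finite_cover L K (fun z => [set x | 2^-1 < b z x]) cK.
  move=> z _; have [_ bz _ _] := hb z.
  by apply: continuous_nbhs_gt => //; rewrite bz; lra.
have ccS : Cc (fun x => \sum_(z <- s) (b z x)%:C%C : R[i]).
  by apply: (Cc_sum s ccf0) => z; case: (hb z).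
(* At each point of [K] some bump exceeds 1/2, whence the factor 2. *)
exists (fun x => 2 * \sum_(z <- s) (b z x)%:C%C); split.
- exact: (Cc_scale 2 ccS).
- move=> x; rewrite mulr_ge0 // -rmorph_sum lecR /=; exact: sumr_ge0.
- move=> x /hs[z zs /= hz]; rewrite rnM -rmorph_sum /= rn_real ger0_norm ?sumr_ge0 //.
  have -> : rn (2 : R[i]) = 2.
    by rewrite (_ : (2 : R[i]) = (2 : R)%:C%C) ?rn_real ?ger0_norm // rmorphMn.
  rewrite -ler_pdivrMl // mulr1; apply: le_trans (ltW hz) _.
  by rewrite (big_rem z) //= lerDl; apply: sumr_ge0.
Qed.

(** Finitely many translates of k dominate any given f in [Cc] up to constants; if k had integral 0,
    left invariance would give every f integral 0. *)
Lemma haar_gt0 (k : L -> R) (x0 : L) : Cc (fun x => (k x)%:C%C : R[i]) ->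
  (forall x, 0 <= k x) -> 0 < k x0 -> 0 < Re (mu (fun x => (k x)%:C%C)).
Proof.
move=> cck k0 kx0; have [f ccf muf] := haar_neq0 mu.
have mk0 : 0 <= Re (mu (fun x => (k x)%:C%C)).
  have := haar_ge0 mu cck; rewrite lecE => /(_ _)/andP[] // x.
  by rewrite lecR.
rewrite lt_neqAle eq_sym mk0 andbT; apply: contra_neq muf => mk.
have ck : continuous k by apply/continuous_realP; exact: CcW cck.
pose W z : set L := [set x | rn (f x - f z) < 1 /\ k x0 / 2 < k (x0 * z^-1 * x)%g].
have [|s [sK hs]] := @compact_finite_cover L _ W (Cc_compact ccf).
  move=> z _; apply: filterI; first exact: ((continuous_rnP f).1 (CcW ccf)).
  have ckz : continuous (fun x => k (x0 * z^-1 * x)%g) by exact: continuous_shift.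
  by apply: (continuous_nbhs_gt ckz); rewrite mulgVK; lra.
(* On [W z] the modulus of f is below |f z| + 1, and the translate of k is above k(x0)/2. *)
pose c z : R := (rn (f z) + 1) * (2 / k x0).
have c0 z : 0 <= c z by rewrite mulr_ge0 ?addr_ge0 ?rn_ge0 // divr_ge0 // ltW.
have ccg z : Cc (fun x => (c z)%:C%C * (k (x0 * z^-1 * x)%g)%:C%C : R[i]).
  by apply: Cc_scale; exact: (Cc_shift hL (x0 * z^-1)%g cck).
have ccS := Cc_sum s ccf ccg.
have fS x : rn (f x) <= 1 * rn (\sum_(z <- s) ((c z)%:C%C * (k (x0 * z^-1 * x)%g)%:C%C : R[i])).
  rewrite mul1r; under eq_bigr do rewrite -rmorphM.
  rewrite -rmorph_sum rn_real ger0_norm; last first.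
    by apply: sumr_ge0 => z _; rewrite mulr_ge0.
  have [->|fx] := eqVneq (f x) 0.
    by rewrite rn0; apply: sumr_ge0 => z _; rewrite mulr_ge0.
  have [z zs [h1 h2]] : exists2 z, z \in s & W z x.
    by apply: hs; exact: subset_closure.
  rewrite (big_rem z) //= -[leLHS]addr0; apply: lerD; last first.
    by apply: sumr_ge0 => y _; rewrite mulr_ge0.
  apply: (@le_trans _ _ (rn (f z) + 1)).
    rewrite -[f x](subrK (f z)); apply: le_trans (rn_triangle _ _) _.
    by rewrite addrC lerD2l ltW.
  rewrite /c -mulrA ler_peMr ?addr_ge0 ?rn_ge0 //.
  by rewrite mulrAC ler_pdivlMr // mul1r -ler_pdivrMl // mulrC ltW.
have hmun := mun_dom mu ccf ccS fS.
have munS : mun mu (fun x => \sum_(z <- s) ((c z)%:C%C * (k (x0 * z^-1 * x)%g)%:C%C : R[i])) = 0.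
  rewrite /mun (_ : (fun x => _) = fun x => \sum_(z <- s) ((c z)%:C%C * (k (x0 * z^-1 * x)%g)%:C%C : R[i])); last first.
    apply/funext => x; under eq_bigr do rewrite -rmorphM.
    rewrite -rmorph_sum rn_real ger0_norm //.
    by apply: sumr_ge0 => z _; rewrite mulr_ge0.
  rewrite (mu_sum mu s ccg) big1 // => z _.
  rewrite (muZ mu _ (Cc_shift hL (x0 * z^-1)%g cck)).
  by rewrite (mu_shift mu (x0 * z^-1)%g cck) mu_real // mk mulr0.
apply: rn_eq0; apply/eqP; rewrite eq_le rn_ge0 andbT.
by apply: le_trans (mu_bound mu ccf) _; rewrite munS mulr0 in hmun.
Qed.

(** For y in a compact neighbourhood C of 1, both values vanish when x is outside C K and K, with K
    the support of f; on this compact set, continuity in both variables and the near-covering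
    property give uniformity. *)
Lemma Cc_uniform f (e : R) : Cc f -> 0 < e ->
  exists2 U : set L, nbhs 1%g U & forall y, U y -> forall x,
    rn (f (y^-1 * x)%g - f x) <= e.
Proof.
move=> ccf e0; have cf := CcW ccf.
have [C nbC [cC clC]] := compact_nbhs mu hL (1%g : L).
pose K := closure [set x | f x != 0].
have cCK : compact ((fun z : L * L => (z.1 * z.2)%g) @` (C `*` K)).
  apply: continuous_compact; last exact: (compact_setX cC (Cc_compact ccf)).
  by apply: continuous_subspaceT; exact: mulg_continuous.
have /compact_near_coveringP cov := compactU cCK (Cc_compact ccf).
have c1 : continuous (fun z : L * L => f (z.1^-1 * z.2)%g).
    move=> z; apply: (@continuous_comp _ _ _ (fun z : L * L => (z.1^-1 * z.2)%g) f);
      last exact: cf.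
    apply: (@continuous_comp _ _ _ (fun z : L * L => (z.1^-1%g, z.2)) (fun z : L * L => (z.1 * z.2)%g));
      last exact: mulg_continuous.
    apply: cvg_pair; last exact: cvg_snd.
    by apply: (continuous_comp (@cvg_fst _ _ _ _ _)); exact: invg_continuous.
have c2 : continuous (fun z : L * L => f z.2).
  by move=> z; apply: (continuous_comp (@cvg_snd _ _ _ _ _)); exact: cf.
have cD := continuous_addc c1 (continuous_scalec (a := -1) c2).
have hV : \forall y \near (1%g : L), [set (z.1 * z.2)%g | z in C `*` K] `|` K `<=`
    (fun x => rn (f (y^-1 * x)%g - f x) < e).
  apply: cov => x _.
  have /continuous_rnP/(_ (1%g, x) e e0) := cD; rewrite /=.
  rewrite invg1 mul1g mulN1r subrr => -[[A B] [/= nA nB] AB].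
  exists (B, A) => // -[x' y] [/= Bx Ay].
  by have := AB (y, x') (conj Ay Bx); rewrite /= subr0 mulN1r.
exists (C `&` [set y | [set (z.1 * z.2)%g | z in C `*` K] `|` K `<=`
    (fun x => rn (f (y^-1 * x)%g - f x) < e)]); first exact: filterI.
move=> y [Cy /= hy] x; have [Kx|Kx] := pselect (([set (z.1 * z.2)%g | z in C `*` K] `|` K) x).
  exact: ltW (hy _ Kx).
have fx : f x = 0 by apply: Cc_support => h; apply: Kx; right.
have fyx : f (y^-1 * x)%g = 0.
  apply: Cc_support => h; apply: Kx; left; exists (y, (y^-1 * x)%g) => //=.
  by rewrite mulVKg.
by rewrite fx fyx subrr rn0 ltW.
Qed.

End RiemannSums.

(** * Integrals of unitary representations *)

Section Integration.
Variables (R : realType) (L : topGroupType) (mu : haarIntegral R L).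
Hypothesis hL : hausdorff_space L.
Implicit Types (f g k : L -> R[i]) (pi : unitaryRep R L).

Lemma compact_mul (A B : set L) : compact A -> compact B ->
  compact [set (z.1 * z.2)%g | z in A `*` B].
Proof.
move=> cA cB; apply: continuous_compact; last exact: compact_setX.
by apply: continuous_subspaceT; exact: mulg_continuous.
Qed.

(** Continuity of translation in L^1: the uniform estimate of [Cc_uniform], multiplied by a function
    that majorizes the common compact support. *)
Lemma mun_translation f (e : R) : Cc f -> 0 < e ->
  \forall y \near (1%g : L), mun mu (fun x => f (y^-1 * x)%g - f x) <= e.
Proof.
move=> ccf e0; have [C nbC [cC clC]] := compact_nbhs mu hL (1%g : L).
pose K := closure [set x | f x != 0].
have cCK := compactU (compact_mul cC (Cc_compact ccf)) (Cc_compact ccf).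
have [chi [ccchi chi0 chi1]] := compact_majorant mu hL cCK.
have m0 := mun_ge0 mu ccchi; have m1 : 0 < mun mu chi + 1 by rewrite ltr_wpDl.
have [|U nbU hU] := Cc_uniform mu hL (e := e / (mun mu chi + 1)) ccf.
  by rewrite divr_gt0.
apply: filterS2 nbU nbC => y Uy Cy.
have ccd := Cc_sub2 (Cc_shift hL y^-1%g ccf) ccf.
have e1 : 0 <= e / (mun mu chi + 1) by rewrite divr_ge0 // ltW.
apply: (@le_trans _ _ (e / (mun mu chi + 1) * mun mu chi)).
  apply: (mun_dom mu ccd ccchi) => x.
  have [Kx|Kx] := pselect (([set (z.1 * z.2)%g | z in C `*` K] `|` K) x).
    by apply: le_trans (hU _ Uy _) _; rewrite ler_peMr // chi1.
  have fx : f x = 0 by apply: Cc_support => h; apply: Kx; right.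
  have fyx : f (y^-1 * x)%g = 0.
    apply: Cc_support => h; apply: Kx; left; exists (y, (y^-1 * x)%g) => //=.
    by rewrite mulVKg.
  by rewrite fx fyx subrr rn0 mulr_ge0 ?rn_ge0.
by rewrite mulrAC ler_pdivrMr // ler_wpM2l ?(ltW e0) // lerDl.
Qed.

Lemma rn_rep pi x v : rn (pi x v) = rn v.
Proof.
apply/eqP; rewrite -(@eqrXn2 _ 2) ?rn_ge0 //.
by rewrite !rn_sqE rep_unitary.
Qed.

Lemma rep_adj pi x v w : hdot (pi x v) w = hdot v (pi x^-1%g w).
Proof. by rewrite -[RHS](rep_unitary x) -repM mulgV rep1. Qed.

Lemma continuous_matrix_coef pi v w : continuous (fun x => hdot (pi x v) w).
Proof.
apply: (continuous_lip (c := rn w) (f := fun x => pi x v)).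
  exact: rep_continuous.
by move=> x y; rewrite -hdotBl mulrC; exact: cauchy_schwarz.
Qed.

Lemma Cc_coef pi f v w : Cc f -> Cc (fun x => f x * hdot (pi x v) w).
Proof. by move=> ccf; exact: (Cc_mulr ccf (@continuous_matrix_coef pi v w)). Qed.

Lemma mun_coef pi f v w : Cc f ->
  mun mu (fun x => f x * hdot (pi x v) w) <= mun mu f * (rn v * rn w).
Proof.
move=> ccf; rewrite mulrC; apply: (mun_dom mu (Cc_coef v w ccf) ccf) => x.
rewrite rnM mulrC ler_wpM2r ?rn_ge0 //; apply: le_trans (cauchy_schwarz _ _) _.
by rewrite rn_rep.
Qed.

(** The Riesz theorem supplies the weak integral, so [xget] does not take its default. *)
Lemma integrateP pi f v w : Cc f ->
  hdot (integrate mu f v) w = mu (fun x => f x * hdot (pi x v) w).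
Proof.
move=> ccf.
have [||u hu] := @riesz R (rep_space pi) (fun w => mu (fun x => f x * hdot (pi x v) w))
    (mun mu f * rn v).
- move=> a y z; rewrite -(muZ mu a^*%C (Cc_coef v y ccf)).
  rewrite -(muD mu (Cc_scale _ (Cc_coef v y ccf)) (Cc_coef v z ccf)).
  by apply: eq_mu => x; rewrite hdotDr hdotZr mulrDr mulrCA.
- move=> y; apply: le_trans (mu_bound mu (Cc_coef v y ccf)) _.
  by rewrite -mulrA; exact: mun_coef.
have : exists u : rep_space pi, forall w, hdot u w = mu (fun x => f x * hdot (pi x v) w).
  by exists u.
by move=> /(xgetPex (0 : rep_space pi)); exact.
Qed.

Lemma integrate_unique pi f (v u : rep_space pi) : Cc f ->
  (forall w, hdot u w = mu (fun x => f x * hdot (pi x v) w)) -> integrate mu f v = u.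
Proof. by move=> ccf h; apply: hdot_inj => w; rewrite h integrateP. Qed.

Lemma integrate_bound pi f (v : rep_space pi) : Cc f ->
  rn (integrate mu f v) <= mun mu f * rn v.
Proof.
move=> ccf; apply: (@hdot_bound _ _ (@integrate R L mu pi f)); first exact: mun_ge0.
move=> x y; rewrite integrateP //; apply: le_trans (mu_bound mu (Cc_coef x y ccf)) _.
by rewrite -mulrA; exact: mun_coef.
Qed.

Lemma integrate_linear pi f : Cc f -> linear (@integrate R L mu pi f).
Proof.
move=> ccf a u v; apply: integrate_unique => // w.
rewrite hdotDl hdotZl !integrateP // -(muZ mu a (Cc_coef u w ccf)).
rewrite -(muD mu (Cc_scale _ (Cc_coef u w ccf)) (Cc_coef v w ccf)).
by apply: eq_mu => x; rewrite rep_linear hdotDl hdotZl mulrDr mulrCA.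
Qed.

Lemma integrate_bounded pi f : Cc f -> bounded_operator (@integrate R L mu pi f).
Proof.
move=> ccf; apply/bounded_operatorP; split; first exact: integrate_linear.
by exists (mun mu f); [exact: mun_ge0 | move=> v; exact: integrate_bound].
Qed.

Lemma integrateD pi a f g (v : rep_space pi) : Cc f -> Cc g ->
  integrate mu (fun x => a * f x + g x) v = a *: integrate mu f v + integrate mu g v.
Proof.
move=> ccf ccg; apply: integrate_unique; first exact: Cc_lin.
move=> w; rewrite hdotDl hdotZl !integrateP // -(muZ mu a (Cc_coef v w ccf)).
rewrite -(muD mu (Cc_scale _ (Cc_coef v w ccf)) (Cc_coef v w ccg)).
by apply: eq_mu => x; rewrite mulrDl mulrA.
Qed.

Lemma integrateB pi f g (v : rep_space pi) : Cc f -> Cc g ->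
  integrate mu (fun x => f x - g x) v = integrate mu f v - integrate mu g v.
Proof.
move=> ccf ccg; rewrite [RHS]addrC -scaleN1r -integrateD //; congr (integrate mu _ _).
by apply/funext => x; rewrite mulN1r addrC.
Qed.

Lemma integrate_shift pi f y (v : rep_space pi) : Cc f ->
  integrate mu (fun x => f (y^-1 * x)%g) v = pi y (integrate mu f v).
Proof.
move=> ccf; apply: integrate_unique; first exact: Cc_shift.
move=> w; rewrite rep_adj integrateP //.
rewrite -(mu_shift mu y^-1%g (Cc_coef v _ ccf)); apply: eq_mu => x.
by rewrite -rep_adj -repM mulVKg.
Qed.

(** A bump concentrated where pi(x) v is close to v, divided by its integral, which is positive by
    [haar_gt0]. *)
Lemma approximate_unit pi (e : R) (v : rep_space pi) : 0 < e ->
  exists f, [/\ Cc f, mun mu f <= 1 & rn (integrate mu f v - v) <= e].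
Proof.
move=> e0.
pose V := [set x | rn (pi x v - v) < e].
have nbV : nbhs (1%g : L) V.
  have /continuous_rnP/(_ 1%g e e0) := @rep_continuous _ _ pi v.
  by rewrite rep1.
have [h [cch h1 h0 hV]] := bump mu hL nbV.
have h0' x : 0 <= h x by case/andP: (h0 x).
have m0 : 0 < Re (mu (fun x => (h x)%:C%C)).
  by apply: (@haar_gt0 R L mu hL h 1%g cch h0'); rewrite h1.
pose m := Re (mu (fun x => (h x)%:C%C)).
pose f x : R[i] := (m^-1)%:C%C * (h x)%:C%C.
have ccf : Cc f by exact: (Cc_scale _ cch).
have muf : mu f = 1.
  rewrite (muZ mu _ cch) (mu_real mu cch) -rmorphM /= mulVf ?rmorph1 //.
  by rewrite gt_eqF.
have munf : mun mu f = 1.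
  rewrite /mun (_ : (fun x => _) = f) ?muf //; apply/funext => x.
  rewrite /f -rmorphM rn_real ger0_norm // mulr_ge0 // invr_ge0 ltW //.
exists f; split=> //; first by rewrite munf.
apply: (@le_trans _ _ (e * 1)); last by rewrite mulr1.
have bd w : rn (hdot (integrate mu f v - v) w) <= e * rn w.
  have -> : hdot (integrate mu f v - v) w = mu (fun x => f x * hdot (pi x v) w)
      - mu (fun x => hdot v w * f x).
    by rewrite hdotBl integrateP // (muZ mu _ ccf) muf mulr1.
  have c2 := Cc_scale (hdot v w) ccf.
  rewrite -(muB mu (Cc_coef v w ccf) c2).
  have c3 := Cc_sub2 (Cc_coef v w ccf) c2.
  apply: le_trans (mu_bound mu c3) _.
  rewrite -[leRHS]mulr1 -munf; apply: (mun_dom mu c3 ccf) => x.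
  rewrite [hdot v w * _]mulrC -mulrBr -hdotBl rnM mulrC.
  have [hx|hx] := eqVneq (h x) 0; first by rewrite /f hx mulr0 rn0 !mulr0.
  rewrite ler_wpM2r ?rn_ge0 //; apply: le_trans (cauchy_schwarz _ _) _.
  by rewrite ler_wpM2r ?rn_ge0 // ltW //; apply: hV.
have := bd (integrate mu f v - v); rewrite hdotxx rn_real ger0_norm ?sqr_ge0 // mulr1.
rewrite expr2; have [->|n0] := eqVneq (rn (integrate mu f v - v)) 0.
  by move=> _; exact: ltW.
by rewrite ler_pM2r // lt_neqAle eq_sym n0 rn_ge0.
Qed.

Section Convolution.
Variables (f g : L -> R[i]).
Hypotheses (ccf : Cc f) (ccg : Cc g).
Let K := [set (z.1 * z.2)%g | z in
  closure [set x | f x != 0] `*` closure [set x | g x != 0]].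

Let continuous_ginv x : continuous (fun y => g (y^-1 * x)%g).
Proof.
move=> y; apply: (@continuous_comp _ _ _ (fun y => (y^-1 * x)%g) g); last exact: CcW ccg _.
apply: (@continuous_comp _ _ _ (fun y => y^-1%g) (fun y => (y * x)%g)).
  exact: invg_continuous.
exact: continuous_mulr.
Qed.

Let conv_support x : ~ K x -> convolution mu f g x = 0.
Proof.
move=> Kx; rewrite /convolution -[RHS](mu0 mu); apply: eq_mu => y.
have [->|fy] := eqVneq (f y) 0; first by rewrite mul0r.
rewrite (_ : g _ = 0) ?mulr0 //; apply: Cc_support => h; apply: Kx.
exists (y, (y^-1 * x)%g); last by rewrite /= mulVKg.
by split=> //=; exact: subset_closure.
Qed.

Let nbhs_lcoset (U : set L) z : nbhs (1%g : L) U -> nbhs z [set y | U (z^-1 * y)%g].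
Proof. by move=> nbU; apply: nbhs_mull; rewrite mulVg. Qed.

(** A Riemann sum turns the convolution into a finite combination of left translates of g, uniformly
    in x; the same nodes and weights also approximate integrals against f. [integrate_conv] compares
    the two. *)
Let conv_approx (U : set L) (e : R) : 0 <= e -> nbhs (1%g : L) U ->
  (forall y, U y -> forall x, rn (g (y^-1 * x)%g - g x) <= e) ->
  exists s : seq (R[i] * L), [/\
    (forall p, p \in s -> closure [set x | f x != 0] p.2),
    (forall x, rn (convolution mu f g x - \sum_(p <- s) p.1 * g (p.2^-1 * x)%g)
      <= e * mun mu f) &
    forall k (d : R), 0 <= d -> continuous k ->
      (forall z x, U (z^-1 * x)%g -> rn (k x - k z) <= d) ->
      rn (mu (fun x => f x * k x) - \sum_(p <- s) p.1 * k p.2) <= d * mun mu f].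
Proof.
move=> e0 nbU hU.
have [s [sK hs]] := riemann mu hL ccf (fun z => nbhs_lcoset z nbU).
exists s; split=> // x.
apply: (hs (fun y => g (y^-1 * x)%g)) => // z y /= Uzy.
have := hU _ Uzy (z^-1 * x)%g.
by rewrite invgM invgK mulgA mulgK.
Qed.

(** Continuity holds because the convolution is a uniform limit of combinations of left translates
    of g. *)
Lemma Cc_convolution : Cc (convolution mu f g).
Proof.
have cK : compact K by apply: compact_mul; exact: Cc_compact.
apply: (Cc_sub cK); first exact: compact_closed.
  apply/continuous_rnP => x e e0.
  have m1 : 0 < mun mu f + 1 by rewrite ltr_wpDl ?mun_ge0.
  have e4 : 0 < e / 4 by rewrite divr_gt0.
  have d0 : 0 < e / 4 / (mun mu f + 1) by rewrite divr_gt0.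
  have [U nbU hU] := Cc_uniform mu hL ccg d0.
  have [s [_ hs _]] := conv_approx (ltW d0) nbU hU.
  have dm : e / 4 / (mun mu f + 1) * mun mu f <= e / 4.
    by rewrite mulrAC ler_pdivrMr // ler_wpM2l ?lerDl // ltW.
  have cS : continuous (fun x => \sum_(p <- s) p.1 * g (p.2^-1 * x)%g).
    apply: continuous_sumc => p.
    exact: (continuous_scalec (a := p.1) (CcW (Cc_shift hL p.2^-1%g ccg))).
  have := (continuous_rnP _).1 cS x _ e4; apply: filterS => y hy.
  have h1 := le_trans (hs x) dm; have h2 := le_trans (hs y) dm.
  rewrite rn_distC in h1.
  have h3 := rn_le3 h2 (ltW hy) (lexx _).
  by apply: le_lt_trans (rn_le3 h3 h1 (lexx _)) _; lra.
by move=> x; apply: contra_neqP; exact: conv_support.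
Qed.

(** In place of Fubini's theorem: for a combination of left translates of g the identity is
    [integrate_shift], and both sides are close to their values for one such combination. *)
Lemma integrate_conv (pi : unitaryRep R L) (v : rep_space pi) :
  integrate mu (convolution mu f g) v = integrate mu f (integrate mu g v).
Proof.
have ccfg := Cc_convolution.
apply: integrate_unique => // w; rewrite integrateP //.
set u := integrate mu g v.
have cK : compact K by apply: compact_mul; exact: Cc_compact.
have [chi [ccchi chi0 chi1]] := compact_majorant mu hL cK.
apply/eqP; rewrite -subr_eq0; apply/eqP/rn_eps => e e0.
(* The two error constants, plus 1 to make the divisor positive; the function [chi] converts the
   uniform error on [K] into an L^1 error. *)
pose M := mun mu f * (rn w + mun mu chi * (rn v * rn w)) + 1.
have M0 : 0 < M.
  by rewrite ltr_wpDl // mulr_ge0 ?mun_ge0 // addr_ge0 ?rn_ge0 // !mulr_ge0 ?mun_ge0 ?rn_ge0.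
have d0 : 0 < e / M by rewrite divr_gt0.
have [U nbU hU] := Cc_uniform mu hL ccg d0.
pose U' := U `&` [set y | rn (pi y u - u) < e / M].
have nbU' : nbhs (1%g : L) U'.
  apply: filterI => //.
  have /continuous_rnP/(_ 1%g _ d0) := @rep_continuous _ _ pi u.
  by rewrite rep1.
have [s [sK hs1 hs2]] := conv_approx (ltW d0) nbU' (fun y Uy => hU y Uy.1).
have h1 : rn (mu (fun x => f x * hdot (pi x u) w) -
    \sum_(p <- s) p.1 * hdot (pi p.2 u) w) <= e / M * rn w * mun mu f.
  apply: hs2; first by rewrite mulr_ge0 ?rn_ge0 // ltW.
    exact: continuous_matrix_coef.
  move=> z x [_ /= hzx]; rewrite -hdotBl; apply: le_trans (cauchy_schwarz _ _) _.
  rewrite ler_wpM2r ?rn_ge0 //.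
  have -> : pi x u - pi z u = pi z (pi (z^-1 * x)%g u - u).
    by have [_ ->] := linear_opP (@rep_linear _ _ pi z); rewrite -repM mulVKg.
  by rewrite rn_rep ltW.
pose S x := \sum_(p <- s) p.1 * g (p.2^-1 * x)%g.
have ccg' p : Cc (fun x => p.1 * g (p.2^-1 * x)%g).
  exact: (Cc_scale _ (Cc_shift hL p.2^-1%g ccg)).
have ccS : Cc S by exact: (Cc_sum s ccf ccg').
have ccD := Cc_sub2 ccfg ccS.
have h2 : rn (mu (fun x => convolution mu f g x * hdot (pi x v) w) -
    \sum_(p <- s) p.1 * hdot (pi p.2 u) w) <=
    e / M * mun mu f * mun mu chi * (rn v * rn w).
  have -> : \sum_(p <- s) p.1 * hdot (pi p.2 u) w = mu (fun x => S x * hdot (pi x v) w).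
    rewrite (eq_mu mu (g := fun x => \sum_(p <- s) p.1 * (g (p.2^-1 * x)%g * hdot (pi x v) w))).
      rewrite (mu_sum mu s (fun p => Cc_scale p.1 (Cc_coef v w (Cc_shift hL p.2^-1%g ccg)))).
      apply: eq_bigr => p _.
      rewrite (muZ mu _ (Cc_coef v w (Cc_shift hL p.2^-1%g ccg))).
      by rewrite -integrateP ?integrate_shift //; exact: Cc_shift.
    by move=> x; rewrite /S mulr_suml; apply: eq_bigr => p _; rewrite mulrA.
  rewrite -(muB mu (Cc_coef v w ccfg) (Cc_coef v w ccS)).
  rewrite (eq_mu mu (g := fun x => (convolution mu f g x - S x) * hdot (pi x v) w)); last first.
    by move=> x; rewrite mulrBl.
  apply: le_trans (mu_bound mu (Cc_coef v w ccD)) _.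
  apply: le_trans (mun_coef v w ccD) _; rewrite ler_wpM2r ?mulr_ge0 ?rn_ge0 //.
  apply: (mun_dom mu ccD ccchi) => x.
  have [Kx|Kx] := pselect (K x).
    apply: le_trans (hs1 x) _; rewrite ler_peMr ?chi1 //.
    by rewrite mulr_ge0 ?mun_ge0 // ltW.
  rewrite conv_support // (_ : S x = 0); last first.
    rewrite /S big1_seq // => p /andP[_ ps]; rewrite (_ : g _ = 0) ?mulr0 //.
    apply: Cc_support => h; apply: Kx; exists (p.2, (p.2^-1 * x)%g); last by rewrite /= mulVKg.
    by split=> //=; exact: sK.
  by rewrite subrr rn0; exact: mulr_ge0 (mulr_ge0 (ltW d0) (mun_ge0 mu ccf)) (rn_ge0 _).
rewrite rn_distC in h2.
apply: (rn_le3 h1 h2).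
rewrite (_ : _ + _ = e / M * (M - 1)); last by rewrite /M; ring.
by rewrite mulrAC ler_pdivrMr // ler_wpM2l ?(ltW e0) // gerBl.
Qed.

End Convolution.
End Integration.

(** * C*-algebras and their representations *)

Section CstarBasics.
Variables (R : realType) (A : cstarAlgebra R).
Implicit Types (a b x y z : A).

Lemma cmulDl x y z : cmul (x + y) z = cmul x z + cmul y z.
Proof. by have := cmul_linearl 1 x y z; rewrite !scale1r. Qed.

Lemma cmulDr x y z : cmul z (x + y) = cmul z x + cmul z y.
Proof. by have := cmul_linearr 1 x y z; rewrite !scale1r. Qed.

Lemma cmul0l z : cmul 0 z = 0 :> A.
Proof. by apply: (addrI (cmul 0 z)); rewrite -cmulDl !addr0. Qed.

Lemma cmul0r z : cmul z 0 = 0 :> A.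
Proof. by apply: (addrI (cmul z 0)); rewrite -cmulDr !addr0. Qed.

Lemma cmulZl c x z : cmul (c *: x) z = c *: cmul x z.
Proof. by have := cmul_linearl c x 0 z; rewrite cmul0l !addr0. Qed.

Lemma cmulZr c x z : cmul z (c *: x) = c *: cmul z x.
Proof. by have := cmul_linearr c x 0 z; rewrite cmul0r !addr0. Qed.

Lemma cmulBl x y z : cmul (x - y) z = cmul x z - cmul y z.
Proof. by rewrite cmulDl -scaleN1r cmulZl scaleN1r. Qed.

Lemma cmulBr x y z : cmul z (x - y) = cmul z x - cmul z y.
Proof. by rewrite cmulDr -scaleN1r cmulZr scaleN1r. Qed.

Lemma cadjD x y : cadj (x + y) = cadj x + cadj y :> A.
Proof. by have := cadj_antilinear 1 x y; rewrite conjc1 !scale1r. Qed.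

Lemma cadj0 : cadj 0 = 0 :> A.
Proof. by apply: (addrI (cadj 0)); rewrite -cadjD !addr0. Qed.

Lemma cadjZ c x : cadj (c *: x) = c^*%C *: cadj x :> A.
Proof. by have := cadj_antilinear c x 0; rewrite cadj0 !addr0. Qed.

Lemma cadjB x y : cadj (x - y) = cadj x - cadj y :> A.
Proof. by rewrite cadjD -scaleN1r cadjZ conjcN conjc1 scaleN1r. Qed.

Lemma rn_cmul x y : rn (cmul x y) <= rn x * rn y.
Proof. by have := cnormM x y; rewrite !rnE -rmorphM lecR. Qed.

Lemma rn_cstar x : rn (cmul (cadj x) x) = rn x ^+ 2.
Proof. by have := cstar_identity x; rewrite !rnE -rmorphXn => /complexI. Qed.

Lemma rn_cadj x : rn (cadj x) = rn x.
Proof.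
have h z : rn z <= rn (cadj z).
  have [->|z0] := eqVneq z 0; first by rewrite rn0 rn_ge0.
  have rz : 0 < rn z.
    by rewrite lt_neqAle rn_ge0 andbT eq_sym; apply: contra_neq z0 => /rn_eq0.
  by have := rn_cmul (cadj z) z; rewrite rn_cstar expr2 ler_pM2r.
by apply/eqP; rewrite eq_le h -{2}[x]cadjK h.
Qed.

Section SquareRoot.
Variable x : A.
Hypothesis x1 : rn x <= 1.

(** Iterates of y |-> (x + y^2)/2. A fixed point satisfies (1 - y)^2 = 1 - x, an equation that makes
    sense without a unit as y + y = x + y^2. *)
Fixpoint sqrt_seq n : A :=
  if n is m.+1 then (2^-1)%:C%C *: (x + cmul (sqrt_seq m) (sqrt_seq m)) else 0.
Local Notation Y := sqrt_seq.

(* the scalar iteration that dominates [sqrt_seq] *)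
Fixpoint sqrt_bound n : R :=
  if n is m.+1 then 2^-1 * (1 + sqrt_bound m ^+ 2) else 0.
Local Notation r := sqrt_bound.

Let r01 n : 0 <= r n <= 1.
Proof.
elim: n => [|n /andP[h0 h1]] /=; first by rewrite lexx ler01.
have : r n ^+ 2 <= 1 by rewrite expr_le1.
by have := sqr_ge0 (r n); move=> ? ?; apply/andP; split; lra.
Qed.

Let r_step n : r n <= r n.+1.
Proof.
elim: n => [|n ih]; first by have /andP[] := r01 1.
rewrite [r n.+1]/= [leRHS]/= ler_wpM2l ?invr_ge0 // lerD2l.
by rewrite ler_sqr ?nnegrE //; have /andP[] := r01 n; have /andP[] := r01 n.+1.
Qed.

Let r_mono m n : (m <= n)%N -> r m <= r n.
Proof.
elim: n => [|n ih]; first by rewrite leqn0 => /eqP->.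
rewrite leq_eqVlt => /orP[/eqP->//|]; rewrite ltnS => /ih h.
exact: le_trans h (r_step n).
Qed.

Let half_real : rn ((2^-1)%:C%C : R[i]) = 2^-1.
Proof. by rewrite rn_real ger0_norm // invr_ge0. Qed.

Let Y_bound n : rn (Y n) <= r n.
Proof.
elim: n => [|n ih]; first by rewrite /= rn0.
rewrite [Y n.+1]/= [r n.+1]/= rnZ half_real ler_wpM2l ?invr_ge0 //.
apply: le_trans (rn_triangle _ _) _; apply: lerD => //.
by apply: le_trans (rn_cmul _ _) _; rewrite expr2 ler_pM ?rn_ge0.
Qed.

Let sqB y z : cmul y y - cmul z z = cmul y (y - z) + cmul (y - z) z.
Proof. by rewrite cmulBr cmulBl addrA subrK. Qed.

(** Every increment is dominated by that of the scalar iteration, which increases and is bounded by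
    1; so the sequence is Cauchy. *)
Let Y_step n : rn (Y n.+1 - Y n) <= r n.+1 - r n.
Proof.
elim: n => [|n ih].
  have := Y_bound 1; rewrite [Y 0]/= [r 0]/= !subr0; exact.
have -> : Y n.+2 - Y n.+1 = (2^-1)%:C%C *: (cmul (Y n.+1) (Y n.+1) - cmul (Y n) (Y n)).
  by rewrite [Y n.+2]/= [in X in _ - X = _]/= -scalerBr opprD addrACA subrr add0r.
rewrite rnZ half_real sqB.
have -> : r n.+2 - r n.+1 = 2^-1 * (r n.+1 * (r n.+1 - r n) + (r n.+1 - r n) * r n).
  have rS m : r m.+1 = 2^-1 * (1 + r m ^+ 2) by [].
  by rewrite (rS n.+1); have := rS n; lra.
rewrite ler_wpM2l ?invr_ge0 //; apply: le_trans (rn_triangle _ _) _.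
by apply: lerD; apply: le_trans (rn_cmul _ _) _; rewrite ler_pM ?rn_ge0.
Qed.

Let Y_dist m n : (m <= n)%N -> rn (Y n - Y m) <= r n - r m.
Proof.
elim: n => [|n ih]; first by rewrite leqn0 => /eqP->; rewrite !subrr rn0.
rewrite leq_eqVlt => /orP[/eqP->|]; first by rewrite !subrr rn0.
rewrite ltnS => /ih h; apply: (rn_le3 (Y_step n) h).
by rewrite addrA subrK.
Qed.

Let Y_cauchy : scauchy Y.
Proof.
have hs : has_sup (range r).
  by split; [exists (r 0), 0%N | exists 1 => _ [n _ <-]; have /andP[] := r01 n].
move=> e e0; have [_ [n0 _ <-] hn0] := sup_adherent e0 hs.
have r_le n : r n <= sup (range r) by apply: sup_upper_bound => //; exists n.
have key m n : (n0 <= m)%N -> (m <= n)%N -> rn (Y n - Y m) < e.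
  move=> hm mn; apply: le_lt_trans (Y_dist mn) _.
  by have := r_le n; have := r_mono hm; lra.
exists n0 => m n hm hn; have [mn|nm] := leqP m n.
  by rewrite rn_distC; exact: key.
by apply: key => //; exact: ltnW.
Qed.

(** The last clause is an induction principle: y lies in every sequentially closed set that contains
    0 and is stable under the iteration. It transfers self-adjointness, commutation relations and
    membership in ideals from x to y. *)
Lemma cstar_sqrt : exists y : A, [/\ y + y = x + cmul y y, rn y <= 1 &
  forall I : A -> Prop, I 0 ->
    (forall z, I z -> I ((2^-1)%:C%C *: (x + cmul z z))) ->
    (forall u l, (forall n, I (u n)) -> sconv u l -> I l) -> I y].
Proof.
have [y Yy] := scomplete Y_cauchy.
have Y1 n : rn (Y n) <= 1 by apply: le_trans (Y_bound n) _; have /andP[] := r01 n.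
have y1 : rn y <= 1.
  have := sconv_le (l' := 0) (c := 1) (n1 := 0%N) Yy; rewrite subr0; apply=> n _.
  by rewrite subr0.
have YS : sconv (fun n => Y n.+1) y.
  by move=> e /Yy[n0 h0]; exists n0 => n hn; apply: h0; exact: leqW.
have Yy2 : sconv (fun n => Y n.+1) ((2^-1)%:C%C *: (x + cmul y y)).
  apply: (@sconv_lip _ _ _ (fun z => (2^-1)%:C%C *: (x + cmul z z)) 1 Y y) => // n.
  rewrite -scalerBr opprD addrACA subrr add0r rnZ half_real sqB.
  apply: (@le_trans _ _ (2^-1 * (1 * rn (Y n - y) + rn (Y n - y) * 1))); last by lra.
  rewrite ler_wpM2l ?invr_ge0 //; apply: le_trans (rn_triangle _ _) _.
  by apply: lerD; apply: le_trans (rn_cmul _ _) _; rewrite ler_pM ?rn_ge0.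
exists y; split=> //.
  rewrite [in LHS](sconv_unique YS Yy2) -scalerDl -rmorphD /=.
  by rewrite (_ : 2^-1 + 2^-1 = 1 :> R) ?scale1r //; lra.
move=> I I0 IS Iclosed; apply: (Iclosed Y) => //.
by elim=> [|n ih] //=; exact: IS.
Qed.

End SquareRoot.

(** * Representations and their contractivity *)

Section StarRep.
Variables (H : hilbertSpace R) (rho : A -> H -> H).
Hypothesis sr : star_rep rho.

Lemma srL c a b v : rho (c *: a + b) v = c *: rho a v + rho b v.
Proof. by case: sr => _ + _ _; exact. Qed.

Lemma srM a b v : rho (cmul a b) v = rho a (rho b v).
Proof. by case: sr => _ _ + _; exact. Qed.

Lemma srJ a v w : hdot (rho (cadj a) v) w = hdot v (rho a w).
Proof. by case: sr => _ _ _; exact. Qed.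

Lemma sr_bounded a : bounded_operator (rho a).
Proof. by case: sr => + _ _ _; exact. Qed.

Lemma sr_lin a : linear (rho a).
Proof. by case: (sr_bounded a). Qed.

Lemma srD a b v : rho (a + b) v = rho a v + rho b v.
Proof. by have := srL 1 a b v; rewrite !scale1r. Qed.

Lemma sr0 v : rho 0 v = 0.
Proof. by apply: (addrI (rho 0 v)); rewrite -srD !addr0. Qed.

Lemma srZ c a v : rho (c *: a) v = c *: rho a v.
Proof. by have := srL c a 0 v; rewrite sr0 !addr0. Qed.

Lemma srB a b v : rho (a - b) v = rho a v - rho b v.
Proof. by rewrite srD -scaleN1r srZ scaleN1r. Qed.

Lemma srvD a u v : rho a (u + v) = rho a u + rho a v.
Proof. by have [[[-> _] _] _] := linear_opP (sr_lin a). Qed.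

Lemma srvZ a c v : rho a (c *: v) = c *: rho a v.
Proof. by have [[[_ ->] _] _] := linear_opP (sr_lin a). Qed.

Lemma srvB a u v : rho a (u - v) = rho a u - rho a v.
Proof. by have [_ ->] := linear_opP (sr_lin a). Qed.

Lemma srv0 a : rho a 0 = 0.
Proof. exact: linear_op0 (sr_lin a). Qed.

Lemma srJr a v w : hdot (rho a v) w = hdot v (rho (cadj a) w).
Proof. by rewrite -srJ cadjK. Qed.

(* If [|a| <= 1] then [1 - a^* a] is the square of a self-adjoint [1 - y]. *)
Let contractive1 a v : rn a <= 1 -> rn (rho a v) <= rn v.
Proof.
move=> a1; set x := cmul (cadj a) a.
have x1 : rn x <= 1 by rewrite rn_cstar expr_le1 ?rn_ge0.
have [y [yE _ yI]] := cstar_sqrt x1.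
have xJ : cadj x = x by rewrite cadjM cadjK.
have yJ : cadj y = y.
  apply: (yI (fun z => cadj z = z)); first exact: cadj0.
    by move=> z hz; rewrite cadjZ cadjD cadjM hz xJ conjc_real.
  move=> u l hu ul; apply: (sconv_unique _ ul).
  have E : u = (fun n => cadj (u n)) by apply/funext => n; rewrite hu.
  rewrite E; apply: (@sconv_lip _ _ _ (@cadj R A) 1) => // n.
  by rewrite -cadjB rn_cadj mul1r.
rewrite -ler_sqr ?nnegrE ?rn_ge0 //.
have -> : rn (rho a v) ^+ 2 = Re (hdot (rho x v) v).
  by rewrite rn_sqE srM srJ.
have -> : rho x v = rho y v + rho y v - rho y (rho y v).
  by rewrite -srD yE srD srM addrK.
have : 0 <= rn (v - rho y v) ^+ 2 by exact: sqr_ge0.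
rewrite rnB_sq hdotBl hdotDl ReB ReD [rn (rho y v) ^+ 2]rn_sqE.
have <- : hdot (rho y (rho y v)) v = hdot (rho y v) (rho y v) by rewrite srJr yJ.
by rewrite (Re_hdotC v); lra.
Qed.

Lemma sr_contractive a v : rn (rho a v) <= rn a * rn v.
Proof.
have [->|a0] := eqVneq a 0; first by rewrite sr0 !rn0 mul0r.
have ra : 0 < rn a.
  by rewrite lt_neqAle rn_ge0 andbT eq_sym; apply: contra_neq a0 => /rn_eq0.
have E : rn (((rn a)^-1)%:C%C : R[i]) = (rn a)^-1.
  by rewrite rn_real ger0_norm // invr_ge0 ltW.
have := @contractive1 (((rn a)^-1)%:C%C *: a) v; rewrite srZ !rnZ E mulVf ?gt_eqF //.
by move=> /(_ (lexx _)); rewrite ler_pdivrMl.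
Qed.

End StarRep.
End CstarBasics.

(** * Cut-off elements *)

Section BumpElements.
Variables (R : realType) (A : cstarAlgebra R) (H : hilbertSpace R).
Variable op : A -> H -> H.
Hypothesis op_sr : star_rep op.
Hypothesis op_norm : forall a (c : R), 0 <= c ->
  (forall v, rn (op a v) <= c * rn v) -> rn a <= c.

Lemma op_inj a b : (forall v, op a v = op b v) -> a = b.
Proof.
move=> h; apply/eqP; rewrite -subr_eq0; apply/eqP/rn_eq0/eqP.
rewrite eq_le rn_ge0 andbT; apply: op_norm => // v.
by rewrite (srB op_sr) h subrr rn0 mul0r.
Qed.

(** For a self-adjoint contraction D the operator 1 - D^2 lies between 0 and 1. *)
Lemma sq_defect (D : H -> H) v : (forall u w, hdot (D u) w = hdot u (D w)) ->
  (forall u, rn (D u) <= rn u) -> rn (v - D (D v)) <= rn v.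
Proof.
move=> Dsym D1; rewrite -ler_sqr ?nnegrE ?rn_ge0 // rnB_sq -Dsym -rn_sqE.
have h1 : rn (D v) ^+ 2 <= rn v ^+ 2 by rewrite ler_sqr ?nnegrE ?rn_ge0.
have h2 : rn (D (D v)) ^+ 2 <= rn (D v) ^+ 2 by rewrite ler_sqr ?nnegrE ?rn_ge0.
have := sqr_ge0 (rn (D v)); lra.
Qed.

(* For [s = t^* t] these are [p = 2 (s - 1/2)_+] and [a = 1 - (1 - 2 s)_+ ^ 2],
   computed from [1 - y = |1 - 2 s|], the square root of [1 - 4 s (1 - s)]. *)
Lemma bump_elements (t : A) : rn t <= 1 -> exists p a : A,
  [/\ cmul a p = p, rn a <= 1,
    (forall e, cmul e (cmul (cadj t) t) = cmul (cadj t) t -> cmul e p = p) &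
    forall I : A -> Prop, (forall x z, I x -> I (cmul x z)) ->
      (forall c x z, I x -> I z -> I (c *: x + z)) ->
      (forall u l, (forall n, I (u n)) -> sconv u l -> I l) ->
      I (cmul (cadj t) t) -> I p /\ I a] /\
  forall (K : hilbertSpace R) (rho : A -> K -> K), star_rep rho ->
    [/\ (forall d : R, d < 2^-1 -> (forall v, rn (rho t v) ^+ 2 <= d * rn v ^+ 2) ->
          forall v, rho p v = 0),
        ((forall v, rho t v = 0) -> forall v, rho a v = 0) &
        ((forall v, rho p v = 0) -> forall v, rn (rho t v) ^+ 2 <= 2^-1 * rn v ^+ 2)].
Proof.
move=> t1; have [s sdef] : exists s, s = cmul (cadj t) t by eexists.
rewrite -sdef; have sJ : cadj s = s by rewrite sdef cadjM cadjK.
have sE (K : hilbertSpace R) (rho : A -> K -> K) v : star_rep rho ->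
    Re (hdot (rho s v) v) = rn (rho t v) ^+ 2.
  by move=> sr; rewrite sdef (srM sr) (srJ sr) rn_sqE.
have sle v : rn (op s v) ^+ 2 <= rn (op t v) ^+ 2.
  rewrite ler_sqr ?nnegrE ?rn_ge0 // sdef (srM op_sr).
  apply: le_trans (sr_contractive op_sr _ _) _.
  by rewrite rn_cadj ler_piMl ?rn_ge0.
(* [D] is 1 - 2 s, and the element [x] below is 1 - D^2. Expressions with a constant term are formed
   as operators, as [A] is not assumed to have a unit. *)
pose D v := v - 2 *: op s v.
have two : (2 : R[i]) = (2 : R)%:C%C by rewrite rmorphMn.
have Dsq v : rn (D v) ^+ 2 = rn v ^+ 2 - 4 * rn (op t v) ^+ 2 + 4 * rn (op s v) ^+ 2.
  rewrite rnB_sq two hdotZr conjc_real ReM_real Re_hdotC (sE _ _ _ op_sr) rnZ rn_real.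
  by rewrite ger0_norm // exprMn; ring.
have D1 v : rn (D v) <= rn v.
  rewrite -ler_sqr ?nnegrE ?rn_ge0 // Dsq.
  by have := sle v; lra.
have Dsym u w : hdot (D u) w = hdot u (D w).
  by rewrite hdotBl hdotBr hdotZl hdotZr two conjc_real (srJr op_sr) sJ.
pose x := 4 *: s - 4 *: cmul s s.
have xJ : cadj x = x.
  have four : (4 : R[i]) = (4 : R)%:C%C by rewrite rmorphMn.
  by rewrite /x cadjB !cadjZ cadjM sJ four conjc_real.
have x1 : rn x <= 1.
  apply: op_norm => // v; rewrite mul1r; apply: le_trans (sq_defect v Dsym D1).
  rewrite (_ : op x v = v - D (D v)) //; apply: hdot_inj => w.
  rewrite /x /D (srB op_sr) !(srZ op_sr) (srM op_sr) (srvB op_sr) (srvZ op_sr).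
  by rewrite !(hdotBl, hdotZl, hdotDl); ring.
have [y [yE y1 yI]] := cstar_sqrt x1.
have yJ : cadj y = y.
  apply: (yI (fun z => cadj z = z)); first exact: cadj0.
    by move=> z hz; rewrite cadjZ cadjD cadjM hz xJ conjc_real.
  move=> u l hu ul; apply: (sconv_unique _ ul).
  have E : u = (fun n => cadj (u n)) by apply/funext => n; rewrite hu.
  rewrite E; apply: (@sconv_lip _ _ _ (@cadj R A) 1) => // n.
  by rewrite -cadjB rn_cadj mul1r.
have ext e : cmul e s = s -> cmul e y = y.
  move=> es; apply: (yI (fun z => cmul e z = z)); first exact: cmul0r.
    move=> z hz; rewrite cmulZr cmulDr cmulA hz /x cmulBr !cmulZr cmulA es //.
  move=> u l hu ul; apply: (sconv_unique _ ul).
  have E : u = (fun n => cmul e (u n)) by apply/funext => n; rewrite hu.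
  rewrite E; apply: (@sconv_lip _ _ _ (cmul e) (rn e)) => // n.
  by rewrite -cmulBr rn_cmul.
have sy : cmul s y = cmul y s.
  apply: (yI (fun z => cmul s z = cmul z s)); first by rewrite cmul0r cmul0l.
    move=> z hz; have hzz : cmul s (cmul z z) = cmul (cmul z z) s.
      by rewrite cmulA hz -cmulA hz cmulA.
    rewrite cmulZr cmulZl cmulDr cmulDl hzz.
    by congr (_ *: (_ + _)); rewrite /x cmulBr cmulBl !cmulZr !cmulZl cmulA.
  move=> u l hu ul; apply: (@sconv_unique _ _ (fun n => cmul s (u n))).
    by apply: (@sconv_lip _ _ _ (cmul s) (rn s)) => // n; rewrite -cmulBr rn_cmul.
  rewrite (funext hu); apply: (@sconv_lip _ _ _ (fun z => cmul z s) (rn s) u l) => // n.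
  by rewrite -cmulBl mulrC rn_cmul.
have yyE (K : hilbertSpace R) (rho : A -> K -> K) v w : star_rep rho ->
    hdot (rho y (rho y v)) w = 2 * hdot (rho y v) w - 4 * hdot (rho s v) w
      + 4 * hdot (rho s (rho s v)) w.
  move=> sr; have : hdot (rho (y + y) v) w = hdot (rho (x + cmul y y) v) w by rewrite yE.
  rewrite (srD sr y y) (srD sr x) /x (srB sr) !(srZ sr) !(srM sr).
  rewrite !(hdotBl, hdotZl, hdotDl) => h.
  apply: (addrI (4 * hdot (rho s v) w - 4 * hdot (rho s (rho s v)) w)).
  by rewrite -h; ring.
have syE (K : hilbertSpace R) (rho : A -> K -> K) v : star_rep rho ->
    rho s (rho y v) = rho y (rho s v).
  by move=> sr; rewrite -!(srM sr) sy.
(* With 1 - y = |1 - 2 s|, the element p is the negative part of 1 - 2 s and 1 - c is its positive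
   part. Their product vanishes, so c p = p. *)
pose p := s - 2^-1 *: y; pose c := s + 2^-1 *: y.
have cp : cmul c p = p.
  apply: op_inj => v; apply: hdot_inj => w.
  rewrite (srM op_sr) /c /p (srB op_sr) (srD op_sr) !(srZ op_sr) (srvB op_sr) (srvZ op_sr) (srvB op_sr) (srvZ op_sr).
  rewrite (syE _ _ _ op_sr) !(hdotBl, hdotZl, hdotDl) (yyE _ _ _ _ op_sr).
  by field.
exists p, (2 *: c - cmul c c); split; first split.
- by rewrite cmulBl cmulZl -cmulA !cp -{2}[p]scale1r -scalerBl (_ : 2 - 1 = 1 :> R[i]) ?scale1r //; ring.
(* [n] is 1 - c, the average of 1 - y and 1 - 2 s, both of them contractions; and a = 2 c - c^2 is 1
   - n^2. *)
- pose n v := v - op c v.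
  have cJ : cadj c = c.
    have half : (2^-1 : R[i]) = (2^-1 : R)%:C%C by rewrite fmorphV two.
    by rewrite /c cadjD cadjZ sJ yJ half conjc_real.
  have nsym u w : hdot (n u) w = hdot u (n w).
    by rewrite hdotBl hdotBr (srJr op_sr) cJ.
  have n1 v : rn (n v) <= rn v.
    have h : rn (v - op y v) <= rn v.
      apply: le_trans (D1 v); rewrite -ler_sqr ?nnegrE ?rn_ge0 // Dsq rnB_sq.
      have := congr1 (@complex.Re R) (yyE _ _ v v op_sr).
      have four : (4 : R[i]) = (4 : R)%:C%C by rewrite rmorphMn.
      rewrite two four ReD ReB !ReM_real (sE _ _ _ op_sr) (srJr op_sr y (op y v)) yJ hdotxx /=.
      rewrite (srJr op_sr s (op s v)) sJ hdotxx /= (Re_hdotC v); lra.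
    have -> : n v = 2^-1 *: (v - op y v) + 2^-1 *: D v.
      apply: hdot_inj => w; rewrite /n /D /c (srD op_sr) (srZ op_sr).
      by rewrite !(hdotBl, hdotZl, hdotDl); field.
    apply: le_trans (rn_triangle _ _) _; rewrite !rnZ.
    have -> : rn (2^-1 : R[i]) = 2^-1 by rewrite rnV two rn_real ger0_norm.
    by have := D1 v; lra.
  apply: op_norm => // v; rewrite mul1r; apply: le_trans (sq_defect v nsym n1).
  rewrite (_ : op _ v = v - n (n v)) //; apply: hdot_inj => w.
  rewrite /n (srB op_sr) (srZ op_sr) (srM op_sr) (srvB op_sr).
  by rewrite !(hdotBl, hdotZl, hdotDl); ring.
- by move=> e es; rewrite /p cmulBr cmulZr es ext.
- move=> I Ir IL Ic Is.
  have I0 : I 0 by have := IL (-1) s s Is Is; rewrite scaleN1r addNr.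
  have IZ k z : I z -> I (k *: z) by move=> /(IL k _ 0) /(_ I0); rewrite addr0.
  have ID u z : I u -> I z -> I (u + z) by move=> Iu /(IL 1 _ _ Iu); rewrite scale1r.
  have IB u z : I u -> I z -> I (u - z).
    by move=> Iu Iz; apply: ID => //; rewrite -scaleN1r; exact: IZ.
  have Ix : I x by apply: IB; apply: IZ => //; exact: Ir.
  have Iy : I y.
    apply: (yI I) => // z Iz; apply: IZ; apply: ID => //; exact: Ir.
  have Ic' : I c by apply: ID => //; exact: IZ.
  by split; apply: IB => //; [exact: IZ | exact: IZ | exact: Ir].
move=> K rho sr; have yle v : Re (hdot (rho y v) v) <= rn v ^+ 2.
  apply: le_trans (Re_le_rn _) _; apply: le_trans (cauchy_schwarz _ _) _.
  rewrite expr2 ler_wpM2r ?rn_ge0 //; apply: le_trans (sr_contractive sr _ _) _.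
  by rewrite ler_piMl ?rn_ge0.
have halfRe (z : R[i]) : Re (2^-1 * z) = 2^-1 * Re z.
  by rewrite (_ : (2^-1 : R[i]) = (2^-1 : R)%:C%C) ?ReM_real // fmorphV two.
split.
(* As c fixes u = p v, |u|^2 = <s u, u> + <y u, u>/2 <= (d + 1/2) |u|^2, which forces u = 0. *)
- move=> d d2 hd v; set u := rho p v.
  have uE : rho c u = u by rewrite /u -(srM sr) cp.
  have := rn_sqE u; rewrite -[in X in _ = Re (hdot X _)]uE /c (srD sr) (srZ sr).
  rewrite hdotDl hdotZl ReD halfRe (sE _ _ _ sr) => h.
  have hu := hd u; have hy := yle u.
  apply: rn_eq0; apply/eqP; rewrite -sqrf_eq0 eq_le sqr_ge0 andbT.
  rewrite -(@pmulr_rle0 _ (2^-1 - d)) ?subr_gt0 // mulrBl.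
  by move: h hu hy; lra.
(* With s = 0 the equation for y becomes y^2 = 2 y, and |y| <= 1 leaves only y = 0. *)
- move=> t0; have s0 v : rho s v = 0 by rewrite sdef (srM sr) t0 (srv0 sr).
  have y0 v : rho y v = 0.
    have : 2 * rn (rho y v) <= rn (rho y v).
      have E : 2 *: rho y v = rho y (rho y v).
        by apply: hdot_inj => w; rewrite (yyE _ _ _ _ sr) !s0 hdotZl !hdot0l; ring.
      have := congr1 (@rn R K) E; rewrite rnZ two rn_real ger0_norm // => ->.
      apply: le_trans (sr_contractive sr _ _) _.
      by rewrite ler_piMl ?rn_ge0.
    move=> h; apply: rn_eq0; apply/eqP; rewrite eq_le rn_ge0 andbT; lra.
  have c0 v : rho c v = 0 by rewrite /c (srD sr) (srZ sr) s0 y0 scaler0 addr0.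
  by move=> v; rewrite (srB sr) (srZ sr) (srM sr) !c0 scaler0 subr0.
(* If p vanishes then 2 s = y <= 1 in this representation. *)
- move=> p0 v; have := congr1 (fun z => Re (hdot z v)) (p0 v).
  rewrite /p (srB sr) (srZ sr) hdotBl hdotZl hdot0l ReB halfRe (sE _ _ _ sr) /=.
  by have := yle v; lra.
Qed.

End BumpElements.

(** * Pure states *)

Section ExtremePoints.
Variables (R : realType) (I : choiceType).
Local Notation X := (prod_topology (fun _ : I => R)).
Implicit Types (u v w : X) (K F C : set X).

Lemma eval_continuous (t : I) : continuous (fun u : X => u t).
Proof. exact: (@proj_continuous I (fun=> R) t). Qed.

Lemma continuous_closed_eq0 (f : X -> R) : continuous f -> closed [set u | f u = 0].
Proof.
by move=> cf; apply: (@closed_comp _ _ f [set x | x = 0]) => //; exact: closed_eq.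
Qed.

Lemma continuous_closed_ge (f : X -> R) (c : R) : continuous f -> closed [set u | c <= f u].
Proof.
by move=> cf; apply: (@closed_comp _ _ f [set x | c <= x]) => //; exact: closed_ge.
Qed.

Lemma bounded_closed_compact K (b : I -> R) : closed K ->
  (forall u t, K u -> `|u t| <= b t) -> compact K.
Proof.
move=> clK hb.
have cbox : compact [set u : X | forall t, `[- b t, b t]%classic (u t)].
  by apply: (@tychonoff I (fun=> R) (fun t => `[- b t, b t]%classic)) => t; exact: segment_compact.
apply: (subclosed_compact clK cbox) => u Ku t /=.
by rewrite in_itv /= -ler_norml; exact: hb.
Qed.

Definition face K F := F `<=` K /\
  forall u v w (r : R), F u -> K v -> K w -> 0 < r < 1 ->
    (forall t, u t = r * v t + (1 - r) * w t) -> F v /\ F w.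

(** A minimal closed face inside F is a single point, because the points of it that maximize a
    coordinate form a smaller closed face; a one-point face is an extreme point of K. *)
Lemma krein_milman K F : compact K -> closed F -> F !=set0 -> face K F ->
  exists2 u, F u & forall v w (r : R), K v -> K w -> 0 < r < 1 ->
    (forall t, u t = r * v t + (1 - r) * w t) -> v = u.
Proof.
move=> cK clF F0 [FK fF].
have cF : compact F by exact: subclosed_compact clF cK FK.
(* Closed faces are encoded by open sets removed from F, so that minimal faces become maximal
   elements for [Zorn_bigcup]. Compactness keeps the remainder of a chain nonempty. *)
pose P : set (set X) := [set C | [/\ open C, (F `\` C) !=set0 & face K (F `\` C)]].
have [|C [[oC C0 [CK fC]] Cmax]] := @Zorn_bigcup X P.
  move=> Q QP totQ.
  have FQ : (F `\` \bigcup_(C in Q) C) !=set0.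
    have [Q0|Q0] := pselect (exists C, Q C); last first.
      have [u Fu] := F0; exists u; split=> // -[C QC _]; apply: Q0; by exists C.
    apply: contrapT => /set0P/negP; rewrite negbK => /eqP FQ.
    have /choice[W hW] : forall u, exists C, Q C /\ (F u -> C u).
      move=> u; have [Fu|Fu] := pselect (F u); last first.
        by case: Q0 => C QC; exists C.
      have [C QC Cu] : (\bigcup_(C in Q) C) u.
        apply: contrapT => h; suff : (F `\` \bigcup_(C in Q) C) u by rewrite FQ => -[].
        by split.
      by exists C.
    have [z Fz|s [sF hs]] := @compact_finite_cover X F W cF.
      by apply: open_nbhs_nbhs; split; [case: (QP _ (hW z).1) | exact: (hW z).2].
    have [m Qm hm] : exists2 m, Q m & forall z, z \in s -> W z `<=` m.
      elim: s {sF hs} => [|z s [m Qm hm]]; first by case: Q0 => C QC; exists C.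
      have [h|h] := totQ _ _ (hW z).1 Qm.
        by exists m => // y; rewrite inE => /orP[/eqP->//|/hm].
      exists (W z); first exact: (hW z).1.
      by move=> y; rewrite inE => /orP[/eqP->//|/hm hy]; exact: (subset_trans hy h).
    have [_ [u [Fu mu]] _] := QP _ Qm; apply: mu.
    by have [z zs] := hs _ Fu; exact: hm.
  split=> //.
    by apply: bigcup_open => C /QP[].
  split; first by move=> u [/FK].
  move=> u v w r [Fu Cu] Kv Kw r01 E.
  have [Fv Fw] := fF _ _ _ _ Fu Kv Kw r01 E.
  split; split=> // -[C QC Cx]; have [_ _ [_ h]] := QP _ QC;
    have Cu' : ~ C u by move=> ?; apply: Cu; exists C.
    by have [[_ +] _] := h _ _ _ _ (conj Fu Cu') Kv Kw r01 E; apply.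
  by have [_ [_ +]] := h _ _ _ _ (conj Fu Cu') Kv Kw r01 E; apply.
have [u [Fu Cu]] := C0.
have single v : (F `\` C) v -> v = u.
  move=> [Fv Cv]; apply: contrapT => vu.
  have [t tE] : exists t, v t != u t.
    apply: contrapT => h; apply: vu; apply/funext => t.
    by apply/eqP; apply: contrapT => /negP tE; apply: h; exists t.
  have cS : compact (F `\` C).
    by rewrite setDE; apply: compact_closedI => //; exact: open_closedC.
  have ct : {within F `\` C, continuous (fun u : X => u t)}.
    by apply: continuous_subspaceT; exact: eval_continuous.
  have [m /set_mem [Fm Cm] mmax] := compact_EVT_max C0 cS ct.
  (* Also removes the points below the maximum of coordinate t. Since u and v differ there, one of
     them disappears, against the maximality of [C]. *)
  pose C' := C `|` [set w : X | w t < m t].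
  have hC' w : (F `\` C') w -> (F `\` C) w /\ w t = m t.
    move=> [Fw Cw]; have Cw' : ~ C w by move=> ?; apply: Cw; left.
    split=> //; apply/eqP; rewrite eq_le; apply/andP; split.
      by apply: mmax; rewrite inE.
    by rewrite leNgt; apply/negP => ?; apply: Cw; right.
  have hC w : F w -> ~ C w -> w t = m t -> (F `\` C') w.
    by move=> Fw Cw wt; split=> // -[//|/=]; rewrite wt ltxx.
  apply: (Cmax C').
    split; first by move=> w; left.
    have [lt|lt|E] := ltgtP (v t) (u t).
    - move=> h; have : C' v; last by move=> /h.
      by right; apply: lt_le_trans lt _; apply: mmax; rewrite inE.
    - move=> h; have : C' u; last by move=> /h.
      by right; apply: lt_le_trans lt _; apply: mmax; rewrite inE.
    - by rewrite E eqxx in tE.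
  split.
  - apply: openU => //.
    apply: (@open_comp _ _ (fun w : X => w t) [set x | x < m t]); last exact: open_lt.
    by move=> x _; exact: eval_continuous.
  - by exists m; apply: hC.
  - split; first by move=> w [/FK].
    move=> x v' w' r /hC'[[Fx Cx] xt] Kv Kw /[dup] r01 /andP[r0 r1] E.
    have [[Fv' Cv'] [Fw' Cw']] := fC _ _ _ _ (conj Fx Cx) Kv Kw r01 E.
    have v'm : v' t <= m t by apply: mmax; rewrite inE.
    have w'm : w' t <= m t by apply: mmax; rewrite inE.
    have E' := E t; rewrite xt in E'.
    have [e1 e2] : v' t = m t /\ w' t = m t by split; apply/eqP; rewrite eq_le; apply/andP; split=> //; nra.
    by split; exact: hC.
exists u => // v w r Kv Kw r01 E; apply: single.
by have [] := fC _ _ _ _ (conj Fu Cu) Kv Kw r01 E.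
Qed.

End ExtremePoints.

(** * Extension by density *)

Section DenseExtension.
Variable R : realType.

(** The extension is characterized by an inequality against all members of the family: for x = j i
    it gives the value, and otherwise the Lipschitz control. *)
Lemma extend_dense (I : Type) (D : I -> Prop) (V : normedModType R[i])
    (W : completeNormedModType R[i]) (j : I -> V) (T0 : I -> W) (c : R) :
  0 <= c ->
  (forall i k, D i -> D k -> rn (T0 i - T0 k) <= c * rn (j i - j k)) ->
  (forall x (e : R), 0 < e -> exists2 i, D i & rn (x - j i) < e) ->
  exists T : V -> W, forall x i, D i -> rn (T x - T0 i) <= c * rn (x - j i).
Proof.
move=> c0 lip dense; have c1 : 0 < c + 1 by rewrite ltr_wpDl.
suff /choice[T hT] : forall x, exists y, forall i, D i -> rn (y - T0 i) <= c * rn (x - j i).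
  by exists T.
move=> x.
have /choice[i hi] : forall n : nat, exists i, D i /\ rn (x - j i) < n.+1%:R^-1.
  by move=> n; have [|i Di hi] := dense x n.+1%:R^-1; [rewrite invr_gt0|exists i].
have jx : sconv (fun n => j (i n)) x.
  move=> e /inv_lt_eps[n0 h0]; exists n0 => n /h0; apply: lt_trans.
  by rewrite rn_distC; case: (hi n).
have scale e z : rn z < e / (c + 1) -> c * rn (z : V) < e.
  rewrite ltr_pdivlMr // => h; apply: le_lt_trans h.
  by rewrite mulrC ler_wpM2l ?rn_ge0 // lerDl.
have [|y hy] := @scomplete R W (fun n => T0 (i n)).
  move=> e e0; have [|n0 h0] := sconv_scauchy jx (e := e / (c + 1)).
    by rewrite divr_gt0.
  exists n0 => m n hm hn.
  apply: le_lt_trans (lip _ _ (hi m).1 (hi n).1) _.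
  by apply: scale; exact: h0.
exists y => k Dk; apply/ler_addgt0Pr => e e0.
have [|n0 h0] := jx (e / (c + 1)); first by rewrite divr_gt0.
apply: (sconv_le hy (n1 := n0)) => n hn.
apply: le_trans (lip _ _ (hi n).1 Dk) _.
apply: (@le_trans _ _ (c * (rn (x - j k) + rn (j (i n) - x)))).
  by rewrite ler_wpM2l // [leRHS]addrC; exact: rn_tri3.
by rewrite mulrDr lerD2l ltW //; apply: scale; exact: h0.
Qed.

Lemma lipschitz_eq (I : Type) (D : I -> Prop) (V W : normedModType R[i])
    (j : I -> V) (S T : V -> W) (c : R) :
  (forall x y, rn (S x - S y) <= c * rn (x - y)) ->
  (forall x y, rn (T x - T y) <= c * rn (x - y)) ->
  (forall x (e : R), 0 < e -> exists2 i, D i & rn (x - j i) < e) ->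
  (forall i, D i -> S (j i) = T (j i)) -> forall x, S x = T x.
Proof.
move=> lS lT dense ST x; apply/eqP; rewrite -subr_eq0; apply/eqP/rn_eps => e e0.
have c1 : 0 < 2 * `|c| + 1 by rewrite ltr_wpDl ?mulr_ge0.
have [|i Di hi] := dense x (e / (2 * `|c| + 1)); first by rewrite divr_gt0.
have h1 := lS x (j i); have h2 := lT (j i) x; rewrite -ST // in h2.
apply: (rn_le3 h1 h2); rewrite (rn_distC (j i)) -mulrDl.
apply: (@le_trans _ _ ((2 * `|c| + 1) * rn (x - j i))).
  by rewrite ler_wpM2r ?rn_ge0 //; have := ler_norm c; lra.
by rewrite mulrC -ler_pdivlMr // ltW.
Qed.

End DenseExtension.

(** * States and the GNS construction *)

Section States.
Variables (R : realType) (A : cstarAlgebra R) (one : A).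
Hypotheses (cmul1l : forall a, cmul one a = a) (cmul1r : forall a, cmul a one = a).
Implicit Types (a b : A).

Let oneJ : cadj one = one.
Proof. by rewrite -[LHS]cmul1r -{2}[one]cadjK -cadjM cmul1r cadjK. Qed.

(* States are represented by their real parts. *)
Record state (u : A -> R) : Prop := State {
  stateD : forall a b, u (a + b) = u a + u b;
  stateZ : forall (r : R) a, u (r%:C%C *: a) = r * u a;
  stateJ : forall a, u (cadj a) = u a;
  state_ge0 : forall a, 0 <= u (cmul (cadj a) a);
  state1 : u one = 1
}.

Section OneState.
Variable u : A -> R.
Hypothesis su : state u.

Lemma stateN a : u (- a) = - u a.
Proof. by have := stateZ su (-1) a; rewrite rmorphN1 scaleN1r mulN1r. Qed.

Lemma stateB a b : u (a - b) = u a - u b.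
Proof. by rewrite (stateD su) stateN. Qed.

(** Nonnegativity of the state at the square of a - r 1, for all real r. *)
Lemma state_sqr a : u a ^+ 2 <= u (cmul (cadj a) a).
Proof.
rewrite -[leRHS]mulr1; apply: quadratic_bound; first exact: ler01.
move=> r; have := state_ge0 su (a - r%:C%C *: one).
rewrite cadjB cadjZ conjc_real oneJ !cmulBl !cmulBr !cmulZl !cmulZr !cmul1l !cmul1r.
rewrite !stateB !(stateZ su) (stateJ su) (state1 su); lra.
Qed.

(* If [1 - y] is the square root of [1 - b^* b], then
   [c^* c - (b c)^* (b c) = (c - y c)^* (c - y c)]. *)
Let state_mul1 b c : rn b <= 1 ->
  u (cmul (cadj (cmul b c)) (cmul b c)) <= u (cmul (cadj c) c).
Proof.
move=> b1; set x := cmul (cadj b) b.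
have x1 : rn x <= 1 by rewrite rn_cstar expr_le1 ?rn_ge0.
have [y [yE _ yI]] := cstar_sqrt x1.
have xJ : cadj x = x by rewrite cadjM cadjK.
have yJ : cadj y = y.
  apply: (yI (fun z => cadj z = z)); first exact: cadj0.
    by move=> z hz; rewrite cadjZ cadjD cadjM hz xJ conjc_real.
  move=> w l hw wl; apply: (sconv_unique _ wl).
  have E : w = (fun n => cadj (w n)) by apply/funext => n; rewrite hw.
  rewrite E; apply: (@sconv_lip _ _ _ (@cadj R A) 1) => // n.
  by rewrite -cadjB rn_cadj mul1r.
have := state_ge0 su (c - cmul y c).
rewrite cadjB cmulBl !cmulBr cadjM yJ.
have <- : cmul (cadj c) (cmul y c) = cmul (cmul (cadj c) y) c by rewrite cmulA.
have E : cmul (cmul (cadj c) y) (cmul y c) =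
    cmul (cadj c) (cmul y c) + cmul (cadj c) (cmul y c) - cmul (cadj c) (cmul x c).
  rewrite -cmulDr -cmulBr -cmulDl -cmulBl yE [x + _]addrC addrK.
  by rewrite !cmulA.
rewrite E cadjM !stateB !(stateD su).
have -> : cmul (cmul (cadj c) (cadj b)) (cmul b c) = cmul (cadj c) (cmul x c).
  by rewrite /x !cmulA.
lra.
Qed.

Lemma state_mul b c :
  u (cmul (cadj (cmul b c)) (cmul b c)) <= rn b ^+ 2 * u (cmul (cadj c) c).
Proof.
have [->|b0] := eqVneq b 0.
  rewrite cmul0l cmul0r rn0 expr0n mul0r (_ : 0 = (0 : R)%:C%C *: (0 : A)) ?scale0r //.
  by rewrite -[X in u X](scale0r 0) (stateZ su 0) mul0r.
have rb : 0 < rn b.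
  by rewrite lt_neqAle rn_ge0 andbT eq_sym; apply: contra_neq b0 => /rn_eq0.
have E : rn (((rn b)^-1)%:C%C : R[i]) = (rn b)^-1.
  by rewrite rn_real ger0_norm // invr_ge0 ltW.
have := @state_mul1 (((rn b)^-1)%:C%C *: b) c; rewrite rnZ E mulVf ?gt_eqF //.
move=> /(_ (lexx _)); rewrite !cmulZl cadjZ conjc_real !cmulZl cmulZr !(stateZ su) mulrA.
by rewrite -expr2 exprVn ler_pdivrMl ?exprn_gt0.
Qed.

Lemma state_le a : `|u a| <= rn a.
Proof.
rewrite -ler_sqr ?nnegrE ?rn_ge0 // real_normK ?num_real //.
apply: le_trans (state_sqr a) _.
by have := state_mul a one; rewrite cmul1r oneJ cmul1l (state1 su) mulr1.
Qed.

(** The complex-linear functional f with real part [u]: its imaginary part is determined by Im f(a)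
    = - Re f(i a). *)
Definition cstate a : R[i] := Complex (u a) (- u ('i%C *: a)).

Let ucomplex (c : R[i]) a : u (c *: a) = Re c * u a + Im c * u ('i%C *: a).
Proof.
case: c => x y /=.
have -> : Complex x y *: a = x%:C%C *: a + y%:C%C *: ('i%C *: a).
  rewrite scalerA -scalerDl; congr (_ *: _).
  by apply/eqP; rewrite eq_complex /=; apply/andP; split; apply/eqP; ring.
by rewrite (stateD su) !(stateZ su).
Qed.

Lemma cstateL c a b : cstate (c *: a + b) = c * cstate a + cstate b.
Proof.
rewrite /cstate scalerDr scalerA !(stateD su) (ucomplex c a) (ucomplex ('i%C * c) a).
case: c => x y; apply/eqP; rewrite eq_complex /=; apply/andP; split; apply/eqP; ring.
Qed.

Lemma cstateJ a : cstate (cadj a) = (cstate a)^*%C.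
Proof.
rewrite /cstate /= (stateJ su); congr Complex.
have iJ : (- 'i%C)^*%C = 'i%C :> R[i].
  by apply/eqP; rewrite eq_complex /= oppr0 opprK !eqxx.
have -> : 'i%C *: cadj a = cadj (- 'i%C *: a) by rewrite cadjZ iJ.
by rewrite (stateJ su) scaleNr stateN.
Qed.

Definition state_form a b : R[i] := cstate (cmul (cadj b) a).

Lemma state_form_linear c x y z :
  state_form (c *: x + y) z = c * state_form x z + state_form y z.
Proof. by rewrite /state_form cmulDr cmulZr cstateL. Qed.

Lemma state_formC x y : state_form y x = (state_form x y)^*%C.
Proof. by rewrite /state_form -cstateJ cadjM cadjK. Qed.

Lemma state_form_ge0 x : 0 <= state_form x x.
Proof.
rewrite lecE /= (state_ge0 su) andbT.
have := congr1 (@complex.Im R) (state_formC x x); rewrite /= opprK => h.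
by apply/eqP; lra.
Qed.

(** Left multiplication is bounded for the form by [state_mul], hence extends to the completion; the
    cyclic vector is the image of the unit. The algebraic identities pass to limits of sequences
    from the dense subspace. *)
Lemma gns : exists (K : hilbertSpace R) (rho : A -> K -> K) (xi : K),
  [/\ star_rep rho, (forall a, hdot (rho a xi) xi = cstate a),
    (forall v, rho one v = v) &
    forall (v : K) (e : R), 0 < e -> exists a, rn (v - rho a xi) < e].
Proof.
have [K [j [jL jdot jdense]]] :=
  hilbert_completion state_form_linear state_formC state_form_ge0.
have rnj a : rn (j a) ^+ 2 = u (cmul (cadj a) a) by rewrite rn_sqE jdot.
have jB a b : j a - j b = j (a - b).
  have -> : a - b = (-1) *: b + a by rewrite scaleN1r addrC.
  by rewrite jL scaleN1r addrC.
have jmul a b : rn (j (cmul a b)) <= rn a * rn (j b).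
  rewrite -ler_sqr ?nnegrE ?mulr_ge0 ?rn_ge0 // exprMn !rnj; exact: state_mul.
have dense' (x : K) (e : R) : 0 < e -> exists2 i, True & rn (x - j i) < e.
  by move=> /(jdense x)[a ha]; exists a.
have /choice[rho hrho] : forall a, exists T : K -> K, forall x b,
    rn (T x - j (cmul a b)) <= rn a * rn (x - j b).
  move=> a; have lip i k : True -> True ->
      rn (j (cmul a i) - j (cmul a k)) <= rn a * rn (j i - j k).
    by move=> _ _; rewrite !jB -cmulBr; exact: jmul.
  have [T hT] := extend_dense (rn_ge0 a) lip dense'.
  by exists T => x b; exact: hT.
have rhoj a b : rho a (j b) = j (cmul a b).
  apply/eqP; rewrite -subr_eq0; apply/eqP/rn_eps => e e0.
  by apply: le_trans (hrho _ _ b) _; rewrite subrr rn0 mulr0 ltW.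
have seq (x : K) : exists b : nat -> A, sconv (fun n => j (b n)) x.
  have [v vj vx] := approx_sconv (A := fun y => exists b, j b = y) (x := x) (fun e e0 =>
    let: ex_intro b hb := jdense x e e0 in ex_intro2 _ _ (j b) (ex_intro _ b erefl)
      (eq_ind_r (fun t => t < e) hb (rn_distC (j b) x))).
  have /choice[b hb] := vj; exists b.
  by rewrite (_ : (fun n => j (b n)) = v) //; apply/funext.
have rho_seq a x (b : nat -> A) : sconv (fun n => j (b n)) x ->
    sconv (fun n => j (cmul a (b n))) (rho a x).
  move=> bx e e0; have a1 : 0 < rn a + 1 by rewrite ltr_wpDl ?rn_ge0.
  have [|n0 h0] := bx (e / (rn a + 1)); first by rewrite divr_gt0.
  exists n0 => n /h0; rewrite ltr_pdivlMr // => h; apply: le_lt_trans h.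
  rewrite rn_distC; apply: le_trans (hrho _ _ _) _; rewrite rn_distC mulrC.
  by rewrite ler_wpM2l ?rn_ge0 // lerDl.
have rho_bound a x : rn (rho a x) <= rn a * rn x.
  have j0 : j 0 = 0 by have := jB 0 0; rewrite subrr subr0 => <-.
  by have := hrho a x 0; rewrite cmul0r j0 !subr0.
have sconvZ (c : R[i]) (w : nat -> K) l : sconv w l -> sconv (fun n => c *: w n) (c *: l).
  by apply: (@sconv_lip _ _ _ (fun z => c *: z) (rn c)) => n; rewrite -scalerBr rnZ.
have rho_lin a : linear (rho a).
  move=> c x y; have [b bx] := seq x; have [d dy] := seq y.
  have h : sconv (fun n => j (c *: b n + d n)) (c *: x + y).
    rewrite (_ : (fun n => _) = (fun n => c *: j (b n) + j (d n))).
      exact: sconvD (sconvZ c _ _ bx) dy.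
    by apply/funext => n; rewrite jL.
  apply: (sconv_unique (rho_seq a _ _ h)).
  rewrite (_ : (fun n => _) = (fun n => c *: j (cmul a (b n)) + j (cmul a (d n)))).
    exact: sconvD (sconvZ c _ _ (rho_seq a _ _ bx)) (rho_seq a _ _ dy).
  by apply/funext => n; rewrite cmulDr cmulZr jL.
have sr : star_rep rho.
  split.
  - move=> a; apply/bounded_operatorP; split=> //; exists (rn a) => //; exact: rn_ge0.
  - move=> c a b x; have [d dx] := seq x; apply: (sconv_unique (rho_seq _ _ _ dx)).
    rewrite (_ : (fun n => _) = (fun n => c *: j (cmul a (d n)) + j (cmul b (d n)))).
      exact: sconvD (sconvZ c _ _ (rho_seq a _ _ dx)) (rho_seq b _ _ dx).
    by apply/funext => n; rewrite cmulDl cmulZl jL.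
  - move=> a b x; have [d dx] := seq x; apply: (sconv_unique (rho_seq _ _ _ dx)).
    rewrite (_ : (fun n => _) = (fun n => j (cmul a (cmul b (d n))))).
      exact: rho_seq (rho_seq _ _ _ dx).
    by apply/funext => n; rewrite cmulA.
  - move=> a v w; have [b bv] := seq v; have [d dw] := seq w.
    have lim1 : sconv (fun n => hdot (rho (cadj a) (j (b n))) w) (hdot (rho (cadj a) v) w).
      apply: (@sconv_lip _ _ _ (fun x => hdot (rho (cadj a) x) w) (rn a * rn w)) => // n.
      have [_ lB] := linear_opP (rho_lin (cadj a)).
      rewrite -hdotBl -lB; apply: le_trans (cauchy_schwarz _ _) _.
      by rewrite mulrAC ler_wpM2r ?rn_ge0 // -(rn_cadj a); exact: rho_bound.
    have lim2 : sconv (fun n => hdot (j (b n)) (rho a w)) (hdot v (rho a w)).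
      apply: (@sconv_lip _ _ _ (fun x => hdot x (rho a w)) (rn (rho a w))) => // n.
      by rewrite -hdotBl mulrC; exact: cauchy_schwarz.
    apply: (sconv_unique lim1); rewrite (_ : (fun n => _) = (fun n => hdot (j (b n)) (rho a w))) //.
    apply/funext => m; apply: (@sconv_unique _ _ (fun n => hdot (rho (cadj a) (j (b m))) (j (d n)))).
      apply: (@sconv_lip _ _ _ (fun x => hdot (rho (cadj a) (j (b m))) x)
        (rn (rho (cadj a) (j (b m))))) => // n.
      by rewrite -hdotBr; exact: cauchy_schwarz.
    rewrite (_ : (fun n => _) = (fun n => hdot (j (b m)) (j (cmul a (d n))))).
      apply: (@sconv_lip _ _ _ (fun x => hdot (j (b m)) x) (rn (j (b m)))); last exact: rho_seq.
      by move=> n; rewrite -hdotBr; exact: cauchy_schwarz.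
    by apply/funext => n; rewrite rhoj !jdot /state_form cadjM cmulA.
exists K, rho, (j one); split=> //.
- by move=> a; rewrite rhoj jdot /state_form oneJ cmul1l cmul1r.
- move=> v; have [b bv] := seq v; apply: (sconv_unique (rho_seq _ _ _ bv)).
  rewrite (_ : (fun n => _) = (fun n => j (b n))) //.
  by apply/funext => n; rewrite cmul1l.
- by move=> v e e0; have [a ha] := jdense v e e0; exists a; rewrite rhoj cmul1r.
Qed.

End OneState.
End States.

(** * Pure states and irreducible representations *)

Section PureStates.
Variable R : realType.

Lemma continuous_realB (T : topologicalType) (h k : T -> R) :
  continuous h -> continuous k -> continuous (fun x => h x - k x).
Proof. by move=> ch ck x; apply: cvgB; [exact: ch | exact: ck]. Qed.

Lemma continuous_realZ (T : topologicalType) (r : R) (h : T -> R) :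
  continuous h -> continuous (fun x => r * h x).
Proof. by move=> ch x; apply: cvgM; [exact: cvg_cst | exact: ch]. Qed.

Lemma continuous_realBc (T : topologicalType) (h : T -> R) (r : R) :
  continuous h -> continuous (fun x => h x - r).
Proof. by move=> ch x; apply: cvgB; [exact: ch | exact: cvg_cst]. Qed.

(** A subspace invariant under an operator and its adjoint is reducing. *)
Lemma projection_commutes (H : hilbertSpace R) (V : set H) (P T T' : H -> H) :
  closed_subspace V -> projection P -> (forall x, V (P x)) -> (forall x, V x -> P x = x) ->
  (forall x y, hdot (T x) y = hdot x (T' y)) ->
  (forall x, V x -> V (T x)) -> (forall x, V x -> V (T' x)) ->
  forall x, P (T x) = T (P x).
Proof.
move=> cV [_ _ Psym] VP PV TT' VT VT' x.
have T'T y z : hdot (T' y) z = hdot y (T z) by rewrite hdotC -TT' -hdotC.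
have PT y z : hdot (T (P y)) z = hdot (T (P y)) (P z).
  by rewrite -Psym (PV (T (P y))) //; apply: VT.
apply: hdot_inj => z; rewrite Psym TT' -[T' (P z)]PV; last exact: VT'.
by rewrite -Psym -TT' -PT.
Qed.

Variables (A : cstarAlgebra R) (one : A).
Hypotheses (cmul1l : forall a, cmul one a = a) (cmul1r : forall a, cmul a one = a).

Let oneJ : cadj one = one.
Proof. by rewrite -[LHS]cmul1r -{2}[one]cadjK -cadjM cmul1r cadjK. Qed.

Lemma vector_state (H : hilbertSpace R) (rho : A -> H -> H) (w : H) :
  star_rep rho -> rho one w = w -> rn w = 1 ->
  state one (fun a => Re (hdot (rho a w) w)).
Proof.
move=> sr rho1 w1; split.
- by move=> a b; rewrite (srD sr) hdotDl ReD.
- by move=> r a; rewrite (srZ sr) hdotZl ReM_real.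
- by move=> a; rewrite (srJ sr) Re_hdotC.
- by move=> a; rewrite (srM sr) (srJ sr) -rn_sqE sqr_ge0.
- by rewrite rho1 -rn_sqE w1 expr1n.
Qed.

Local Notation X := (prod_topology (fun _ : A => R)).

Lemma states_closed : closed [set u : X | state one u].
Proof.
have key (C : set X) : closed C -> [set u : X | state one u] `<=` C ->
    closure [set u : X | state one u] `<=` C.
  by move=> clC h; rewrite (closure_id C).1 //; exact: closureS.
move=> u clu.
have ev a : continuous (fun v : X => v a) := @eval_continuous R A a.
have eq0 (f : X -> R) : continuous f -> (forall v, state one v -> f v = 0) -> f u = 0.
  by move=> cf h; apply: (key [set v | f v = 0]) => //; exact: continuous_closed_eq0.
split.
- move=> a b; apply/eqP; rewrite -subr_eq0 opprD addrA; apply/eqP.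
  apply: (eq0 (fun v => v (a + b) - v a - v b)); last first.
    by move=> v sv; rewrite (stateD sv); ring.
  exact: (continuous_realB (continuous_realB (ev _) (ev a)) (ev b)).
- move=> r a; apply/eqP; rewrite -subr_eq0; apply/eqP.
  apply: (eq0 (fun v => v (r%:C%C *: a) - r * v a)); last first.
    by move=> v sv; rewrite (stateZ sv) subrr.
  exact: (continuous_realB (ev _) (continuous_realZ (r := r) (ev a))).
- move=> a; apply/eqP; rewrite -subr_eq0; apply/eqP.
  apply: (eq0 (fun v => v (cadj a) - v a)); last first.
    by move=> v sv; rewrite (stateJ sv) subrr.
  exact: (continuous_realB (ev _) (ev a)).
- move=> a; apply: (key [set v | 0 <= v (cmul (cadj a) a)]) => //.
    exact: (continuous_closed_ge (c := 0) (ev _)).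
  by move=> v sv; exact: state_ge0 sv a.
- apply/eqP; rewrite -subr_eq0; apply/eqP.
  apply: (eq0 (fun v => v one - 1)); last by move=> v sv; rewrite (state1 sv) subrr.
  exact: (continuous_realBc (r := 1) (ev one)).
Qed.

Lemma states_compact : compact [set u : X | state one u].
Proof.
apply: (@bounded_closed_compact _ _ _ (fun a => rn a)); first exact: states_closed.
by move=> u a su; exact: (state_le cmul1l cmul1r su).
Qed.

(** If an invariant subspace has projection P with P xi different from 0 and xi, then u is a proper
    convex combination of the vector states of P xi and xi - P xi. Extremality forces P xi to be a
    multiple r xi with 0 < r < 1, against P^2 = P. *)
Lemma pure_state_irreducible (u : A -> R) : state one u ->
  (forall v w (r : R), state one v -> state one w -> 0 < r < 1 ->
    (forall a, u a = r * v a + (1 - r) * w a) -> v = u) ->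
  exists (K : hilbertSpace R) (rho : A -> K -> K) (xi : K),
    [/\ star_rep rho, irreducible_operators (range rho), (forall v, rho one v = v) &
      forall a, u a = Re (hdot (rho a xi) xi)].
Proof.
move=> su ext; have [K [rho [xi [sr rhoxi rho1 cyc]]]] := gns cmul1l cmul1r su.
have uE a : u a = Re (hdot (rho a xi) xi) by rewrite rhoxi.
have xi1 : rn xi = 1.
  apply/eqP; rewrite -(@eqrXn2 _ 2) ?rn_ge0 // expr1n.
  by rewrite rn_sqE -{1}[xi]rho1 -uE (state1 su).
exists K, rho, xi; split=> //; split.
  by exists xi; apply/eqP => x0; move: xi1; rewrite x0 rn0 => /eqP; rewrite eq_sym oner_eq0.
move=> V cV VT; have [P [prP VP PV]] := projection_exists cV.
have VTa a x : V x -> V (rho a x) by apply: VT; exists a.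
have comm a x : P (rho a x) = rho a (P x).
  exact: (projection_commutes cV prP VP PV (srJr sr a) (VTa a) (VTa (cadj a))).
have [bP PP Psym] := prP.
have [[[PD PZ] PN] PB] := linear_opP bP.1.
have PPx x : P (P x) = P x by have := congr1 (fun f => f x) PP.
have cyc0 (Q : K -> K) (c : R) : (forall x, rn (Q x) <= c * rn x) ->
    (forall x y, Q (x - y) = Q x - Q y) -> (forall a, Q (rho a xi) = 0) -> forall x, Q x = 0.
  move=> Qb QB Q0 x.
  apply: (@lipschitz_eq _ _ (fun=> True) _ _ (fun a => rho a xi) Q (fun=> 0) `|c|) => //.
  - move=> y z; rewrite -QB; apply: le_trans (Qb _) _.
    by rewrite ler_wpM2r ?rn_ge0 // ler_norm.
  - by move=> y z; rewrite subrr rn0 mulr_ge0 ?rn_ge0.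
  - by move=> y e /(cyc y)[a ha]; exists a.
have Pb x : rn (P x) <= 1 * rn x.
  rewrite mul1r; have := cauchy_schwarz (P x) x.
  rewrite -{1}[P x]PPx Psym hdotxx rn_real ger0_norm ?sqr_ge0 // expr2.
  have [->|n0] := eqVneq (rn (P x)) 0; first by rewrite rn_ge0.
  by rewrite ler_pM2l // lt_neqAle eq_sym n0 rn_ge0.
have P'b x : rn (x - P x) <= 2 * rn x.
  by apply: le_trans (rn_triangle _ _) _; rewrite rnN mulrDl mul1r lerD // -[leRHS]mul1r.
have pyth x : rn x ^+ 2 = rn (P x) ^+ 2 + rn (x - P x) ^+ 2.
  rewrite rnB_sq; have -> : Re (hdot x (P x)) = rn (P x) ^+ 2.
    by rewrite rn_sqE Psym PPx.
  by ring.
have [p0|p0] := eqVneq (rn (P xi)) 0.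
  have {}p0 := rn_eq0 p0; left; apply/seteqP; split=> x /=; last by move=> ->; case: cV.
  move=> Vx; rewrite -[x]PV //; apply: (cyc0 P 1) => // a.
  by rewrite comm p0 (srv0 sr).
have [p1|p1] := eqVneq (rn (xi - P xi)) 0.
  have {}p1 := rn_eq0 p1; right; apply/seteqP; split=> x //= _.
  have -> : x = P x; last exact: VP.
  apply/eqP; rewrite -subr_eq0; apply/eqP.
  apply: (cyc0 (fun x => x - P x) 2) => //.
    by move=> y z; rewrite PB !opprB [P z - P y]addrC addrACA [- z + _]addrC.
  by move=> a; rewrite comm -(srvB sr) p1 (srv0 sr).
(* The weights of the convex combination are r = |P xi|^2 and 1 - r = |xi - P xi|^2. *)
exfalso; pose r := rn (P xi) ^+ 2.
have rE : 1 - r = rn (xi - P xi) ^+ 2.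
  by have := pyth xi; rewrite xi1 expr1n /r => ->; rewrite addrC addKr.
have r01 : 0 < r < 1.
  apply/andP; split.
    by rewrite /r exprn_gt0 // lt_neqAle eq_sym p0 rn_ge0.
  by rewrite -subr_gt0 rE exprn_gt0 // lt_neqAle eq_sym p1 rn_ge0.
have normalize (x : K) : rn x != 0 ->
    rn (((rn x)^-1)%:C%C *: x) = 1 /\
    forall a, rn x ^+ 2 * Re (hdot (rho a (((rn x)^-1)%:C%C *: x)) (((rn x)^-1)%:C%C *: x)) =
      Re (hdot (rho a x) x).
  move=> x0; have xi0 : 0 < rn x by rewrite lt_neqAle eq_sym x0 rn_ge0.
  split; first by rewrite rnZ rn_real ger0_norm ?invr_ge0 ?(ltW xi0) // mulVf.
  move=> a; rewrite (srvZ sr) hdotZl hdotZr conjc_real !ReM_real.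
  by field.
have [w1 wE] := normalize _ p0; have [w1' wE'] := normalize _ p1.
have sv := vector_state sr (rho1 _) w1; have sw := vector_state sr (rho1 _) w1'.
have cross a : hdot (rho a (P xi)) (xi - P xi) = 0.
  by rewrite -comm Psym PB PPx subrr hdot0r.
have cross' a : hdot (rho a (xi - P xi)) (P xi) = 0.
  by rewrite -Psym comm PB PPx subrr (srv0 sr) hdot0l.
have vu : (fun a => Re (hdot (rho a (((rn (P xi))^-1)%:C%C *: P xi)) (((rn (P xi))^-1)%:C%C *: P xi))) = u.
  apply: (ext _ _ r sv sw r01) => a; rewrite rE /r wE wE' uE.
  have xiE : xi = P xi + (xi - P xi) by rewrite addrC subrK.
  rewrite {1 2}xiE; move: cross cross'; move: (xi - P xi) => q cross cross'.
  by rewrite (srvD sr) hdotDl !hdotDr cross cross' addr0 add0r ReD.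
(* The normalized state of P xi is u itself, so <rho(a) xi, P xi> and r <rho(a) xi, xi> have the
   same real part; as xi is cyclic, P xi - r xi is orthogonal to everything in real part. *)
have Re0 a : Re (hdot (rho a xi) (P xi - r%:C%C *: xi)) = 0.
  rewrite hdotBr hdotZr conjc_real ReB ReM_real -uE -[u a](congr1 (fun f => f a) vu).
  by rewrite /r wE -comm Psym PPx subrr.
have Pxi : P xi = r%:C%C *: xi.
  apply/eqP; rewrite -subr_eq0; apply/eqP/rn_eq0/eqP; rewrite -sqrf_eq0 rn_sqE.
  set z := P xi - _; rewrite -/z in Re0.
  apply/eqP/le_anti/andP; split; last by rewrite -rn_sqE sqr_ge0.
  apply/ler_addgt0Pr => e e0; rewrite add0r.
  have z1 : 0 < rn z + 1 by rewrite ltr_wpDl ?rn_ge0.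
  have [|a ha] := cyc z (e / (rn z + 1)); first by rewrite divr_gt0.
  have -> : Re (hdot z z) = Re (hdot (z - rho a xi) z) by rewrite hdotBl ReB Re0 subr0.
  apply: le_trans (Re_le_rn _) _; apply: le_trans (cauchy_schwarz _ _) _.
  move: ha; rewrite ltr_pdivlMr // => /ltW; apply: le_trans.
  by rewrite ler_wpM2l ?rn_ge0 // lerDl.
have := PPx xi; rewrite Pxi PZ Pxi scalerA => /eqP.
rewrite -subr_eq0 -scalerBl => /eqP/(congr1 (@rn R K)).
rewrite rnZ xi1 mulr1 rn0 -rmorphM -rmorphB rn_real => /normr0_eq0 /=.
by case/andP: r01 => r0 r1; nra.
Qed.

Variables (H : hilbertSpace R) (op : A -> H -> H).
Hypotheses (op_sr : star_rep op) (op1 : forall v, op one v = v).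

Lemma irreducible_rep_exists (a_ : nat -> A) :
  (forall n, rn (a_ n) <= 1) ->
  (forall n, exists w, rn w = 1 /\ forall k, (k <= n)%N -> op (a_ k) w = w) ->
  exists (K : hilbertSpace R) (rho : A -> K -> K),
    [/\ star_rep rho, irreducible_operators (range rho), (forall v, rho one v = v) &
      forall n, exists v, rho (a_ n) v != 0].
Proof.
move=> a1 /choice[w hw].
pose KS : set X := [set u : X | state one u].
pose F : set X := [set u : X | state one u /\ forall n, u (a_ n) = 1].
pose v (n : nat) : X := fun a => Re (hdot (op a (w n)) (w n)).
have sv n : KS (v n) by apply: vector_state => //; exact: (hw n).1.
have clF : closed F.
  have -> : F = KS `&` \bigcap_n [set u : X | u (a_ n) - 1 = 0].
    apply/seteqP; split=> u /=.
      by move=> [su h]; split=> // n _ /=; rewrite h subrr.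
    by move=> [su h]; split=> // n; apply/eqP; rewrite -subr_eq0; apply/eqP; exact: h.
  apply: closedI; first exact: states_closed.
  apply: closed_bigI => n _; apply: continuous_closed_eq0.
  exact: (continuous_realBc (r := 1) (@eval_continuous R A (a_ n))).
have F0 : F !=set0.
  (* A cluster point of the vector states at [w n] works: for each k, all but finitely many of them
     take the value 1 at [a_ k]. *)
  have vKS : (v @ \oo) KS by exists 0%N => // n _; exact: sv.
  have [p [Kp clp]] := @states_compact (v @ \oo) _ vKS.
  exists p; split=> // n; apply/eqP; rewrite -subr_eq0; apply/eqP.
  have cl : closed [set u : X | u (a_ n) - 1 = 0].
    apply: continuous_closed_eq0.
    exact: (continuous_realBc (r := 1) (@eval_continuous R A (a_ n))).
  apply: cl => B nB; apply: (clp [set u : X | u (a_ n) - 1 = 0] B) => //.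
  exists n => // m /= nm; rewrite /v (hw m).2 // -rn_sqE (hw m).1 expr1n.
  exact: subrr.
(* States are at most 1 at [a_ n] because |a_n| <= 1, so a proper convex combination has value 1
   only if both states do. *)
have fF : face KS F.
  split; first by move=> u [].
  move=> u x y r [su un] sx sy /andP[r0 r1] E.
  have le1 z n : KS z -> z (a_ n) <= 1.
    move=> sz; apply: le_trans (a1 n); apply: le_trans (ler_norm _) _.
    exact: (state_le cmul1l cmul1r sz).
  by split; split=> // n; have := E (a_ n); have := le1 x n sx; have := le1 y n sy;
    rewrite un; nra.
have [u [su un] ext] := krein_milman states_compact clF F0 fF.
have [K [rho [xi [sr irr rho1 uE]]]] := pure_state_irreducible su ext.
exists K, rho; split=> // n; exists xi; apply/eqP => h.
by have := uE (a_ n); rewrite un h hdot0l /= => /eqP; rewrite oner_eq0.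
Qed.

End PureStates.

(** * Operator algebras *)

Section OperatorAlgebra.
Variables (R : realType) (H : hilbertSpace R).

Record operator_cstar_algebra (B : set (H -> H)) : Prop := OperatorCstarAlgebra {
  oca_bounded : forall T, B T -> bounded_operator T;
  oca_zero : B (fun=> 0);
  oca_linear : forall c S T, B S -> B T -> B (fun v => c *: S v + T v);
  oca_comp : forall S T, B S -> B T -> B (fun v => S (T v));
  oca_adj : forall T, B T ->
    exists2 T', B T' & forall v w, hdot (T v) w = hdot v (T' w);
  oca_lim : forall T, bounded_operator T ->
    (forall e : R, 0 < e -> exists2 S, B S & forall v, rn (S v - T v) <= e * rn v) ->
    B T
}.

Variable B : set (H -> H).
Hypothesis Balg : operator_cstar_algebra B.

Definition oca_pred : {pred H -> H} := fun T => `[< B T >].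

Lemma oca_closed : subsemimod_closed oca_pred.
Proof.
split; first split.
- by apply/asboolP; exact: oca_zero Balg.
- move=> S T /asboolP BS /asboolP BT; apply/asboolP.
  have := oca_linear Balg 1 BS BT; congr B; apply/funext => v.
  by rewrite scale1r.
- move=> c T /asboolP BT; apply/asboolP.
  have := oca_linear Balg c BT (oca_zero Balg); congr B; apply/funext => v.
  by rewrite addr0.
Qed.

Definition oca : Type := {T : H -> H | oca_pred T}.

HB.instance Definition _ := SubChoice.on oca.
HB.instance Definition _ := GRing.SubChoice_isSubLmodule.Build R[i] (H -> H)
  oca_pred oca oca_closed.

Definition oca_op (T : oca) : H -> H := val T.
Definition mk_oca T (BT : B T) : oca := exist _ T (asboolT BT).

Lemma oca_opP T : B (oca_op T).
Proof. by have := valP T => /asboolP. Qed.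

Lemma oca_op_inj S T : (forall v, oca_op S v = oca_op T v) -> S = T.
Proof. by move=> h; apply/val_inj/funext. Qed.

Let opD S T v : oca_op (S + T) v = oca_op S v + oca_op T v. Proof. by []. Qed.
Let opZ c S v : oca_op (c *: S) v = c *: oca_op S v. Proof. by []. Qed.
Let opB S T v : oca_op (S - T) v = oca_op S v - oca_op T v. Proof. by []. Qed.

Let op_lin T : linear (oca_op T).
Proof. by have [] := oca_bounded Balg (oca_opP T). Qed.

Definition oca_norm (T : oca) : R :=
  inf [set c | 0 <= c /\ forall v, rn (oca_op T v) <= c * rn v].

Let nset_neq0 T : [set c : R | 0 <= c /\ forall v, rn (oca_op T v) <= c * rn v] !=set0.
Proof.
have /bounded_operatorP[_ [c c0 h]] := oca_bounded Balg (oca_opP T).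
by exists c.
Qed.

Let nset_lb T : has_lbound [set c : R | 0 <= c /\ forall v, rn (oca_op T v) <= c * rn v].
Proof. by exists 0 => c []. Qed.

Lemma oca_norm_ge0 T : 0 <= oca_norm T.
Proof. by apply: lb_le_inf => // c []. Qed.

Lemma oca_norm_le T c : 0 <= c -> (forall v, rn (oca_op T v) <= c * rn v) -> oca_norm T <= c.
Proof. by move=> c0 h; apply: ge_inf. Qed.

Lemma oca_norm_bound T v : rn (oca_op T v) <= oca_norm T * rn v.
Proof.
have [v0|v0] := eqVneq (rn v) 0.
  by rewrite (rn_eq0 v0) (linear_op0 (op_lin T)) !rn0 mulr0.
have v1 : 0 < rn v by rewrite lt_neqAle eq_sym v0 rn_ge0.
rewrite -ler_pdivrMr //; apply: lb_le_inf => // c [c0 h].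
by rewrite ler_pdivrMr.
Qed.

Definition oca_normC (T : oca) : R[i] := (oca_norm T)%:C%C.

Let normC_triangle x y : oca_normC (x + y) <= oca_normC x + oca_normC y.
Proof.
rewrite /oca_normC -rmorphD lecR /=; apply: oca_norm_le.
  by rewrite addr_ge0 ?oca_norm_ge0.
move=> z; apply: le_trans (rn_triangle _ _) _.
by rewrite mulrDl lerD ?oca_norm_bound.
Qed.

Let normZ_le a x : oca_norm (a *: x) <= rn a * oca_norm x.
Proof.
apply: oca_norm_le; first by rewrite mulr_ge0 ?rn_ge0 ?oca_norm_ge0.
by move=> z; rewrite opZ rnZ -mulrA ler_wpM2l ?rn_ge0 ?oca_norm_bound.
Qed.

Let normCZ (l : R[i]) x : oca_normC (l *: x) = `|l| * oca_normC x.
Proof.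
rewrite /oca_normC rnE -rmorphM /=; congr real_complex_def.
apply/eqP; rewrite eq_le normZ_le /=.
have [->|l0] := eqVneq l 0; first by rewrite rn0 mul0r oca_norm_ge0.
have rl : 0 < rn l.
  by rewrite lt_neqAle rn_ge0 andbT eq_sym; apply: contra_neq l0 => /rn_eq0.
rewrite -ler_pdivlMl // -rnV.
by apply: le_trans (normZ_le _ _); rewrite scalerA mulVf // scale1r.
Qed.

Let normC_eq0 x : oca_normC x = 0 -> x = 0.
Proof.
move=> /complexI x0; apply: oca_op_inj => z; apply: rn_eq0; apply/eqP.
by rewrite eq_le rn_ge0 andbT; have := oca_norm_bound x z; rewrite x0 mul0r.
Qed.

HB.instance Definition _ :=
  Lmodule_isNormed.Build R[i] oca normC_triangle normCZ normC_eq0.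

Let rn_oca (T : oca) : rn T = oca_norm T.
Proof. by []. Qed.

Let op_bound (T : oca) v : rn (oca_op T v) <= rn T * rn v.
Proof. exact: oca_norm_bound. Qed.

(** The pointwise limit is uniform on bounded sets, hence bounded, and [oca_lim] puts it into
    [B]. *)
Let cauchy_sconv (u : nat -> oca) : scauchy u -> exists l, sconv u l.
Proof.
move=> cu.
have /choice[T hT] : forall v, exists z, sconv (fun n => oca_op (u n) v) z.
  move=> v; apply: scomplete => e e0.
  have v1 : 0 < rn v + 1 by rewrite ltr_wpDl ?rn_ge0.
  have [|n0 h0] := cu (e / (rn v + 1)); first by rewrite divr_gt0.
  exists n0 => m n hm hn; rewrite -opB; apply: le_lt_trans (op_bound _ _) _.
  have := h0 _ _ hm hn; rewrite ltr_pdivlMr // => h; apply: le_lt_trans h.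
  by rewrite ler_wpM2l ?rn_ge0 // lerDl.
have hbound e : 0 < e -> exists n0, forall n, (n0 <= n)%N ->
    forall v, rn (T v - oca_op (u n) v) <= e * rn v.
  move=> /cu[n0 h0]; exists n0 => n hn v.
  apply: (sconv_le (hT v) (n1 := n0)) => m hm; rewrite -opB.
  apply: le_trans (op_bound _ _) _.
  by rewrite ler_wpM2r ?rn_ge0 // ltW // h0.
have bT : bounded_operator T.
  apply/bounded_operatorP; split=> [a x y|].
    apply: (sconv_unique (hT _)).
    have E n : oca_op (u n) (a *: x + y) = a *: oca_op (u n) x + oca_op (u n) y.
      exact: op_lin.
    rewrite (funext E); apply: sconvD (hT y).
    apply: (@sconv_lip _ _ _ (fun z => a *: z) (rn a) _ _ _ (hT x)) => n.
    by rewrite -scalerBr rnZ.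
  have [n0 h0] := hbound 1 ltr01; exists (1 + rn (u n0)).
    by rewrite addr_ge0 ?rn_ge0.
  move=> x; rewrite mulrDl -[T x](subrK (oca_op (u n0) x)).
  apply: le_trans (rn_triangle _ _) _; rewrite lerD ?op_bound //.
  exact: h0.
have BT : B T.
  apply: (oca_lim Balg bT) => e /hbound[n0 h0]; exists (oca_op (u n0)); first exact: oca_opP.
  by move=> v; rewrite rn_distC; exact: h0.
exists (mk_oca BT) => e e0; have e2 : 0 < e / 2 by rewrite divr_gt0.
have [n0 h0] := hbound _ e2; exists n0 => n hn.
apply: (@le_lt_trans _ _ (e / 2)); last by rewrite ltr_pdivrMr // ltr_pMr // ltr1n.
rewrite rn_oca; apply: oca_norm_le; first exact: ltW.
by move=> v; rewrite opB rn_distC; exact: h0.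
Qed.

HB.instance Definition _ :=
  Uniform_isComplete.Build oca (seq_complete_cvg cauchy_sconv).

Let mul (S T : oca) : oca := mk_oca (oca_comp Balg (oca_opP S) (oca_opP T)).

Let adj_ex (T : oca) : exists S : oca, forall v w,
  hdot (oca_op T v) w = hdot v (oca_op S w).
Proof.
by have [T' BT' h] := oca_adj Balg (oca_opP T); exists (mk_oca BT').
Qed.

Let adj (T : oca) : oca := projT1 (cid (adj_ex T)).
Let adjP T v w : hdot (oca_op T v) w = hdot v (oca_op (adj T) w).
Proof. exact: projT2 (cid (adj_ex T)) v w. Qed.
Let adjP' T v w : hdot (oca_op (adj T) v) w = hdot v (oca_op T w).
Proof. by rewrite hdotC -adjP -hdotC. Qed.

Let mulA : associative mul.
Proof. by move=> S T U; exact: oca_op_inj. Qed.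
Let mul_linearl c S T U : mul (c *: S + T) U = c *: mul S U + mul T U.
Proof. exact: oca_op_inj. Qed.
Let mul_linearr c S T U : mul U (c *: S + T) = c *: mul U S + mul U T.
Proof.
apply: oca_op_inj => v.
exact: (op_lin U c (oca_op S v) (oca_op T v)).
Qed.
Let normM S T : `|mul S T| <= `|S| * `|T|.
Proof.
rewrite !rnE -rmorphM lecR /= [rn (mul S T)]rn_oca; apply: oca_norm_le.
  by rewrite mulr_ge0 ?rn_ge0.
move=> v; apply: le_trans (op_bound S (oca_op T v)) _.
by rewrite -mulrA ler_wpM2l ?rn_ge0 ?op_bound.
Qed.
Let adjK : involutive adj.
Proof.
by move=> T; apply: oca_op_inj => v; apply: hdot_inj => w; rewrite adjP' -adjP.
Qed.
Let adj_antilinear c S T : adj (c *: S + T) = (c^*%C) *: adj S + adj T.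
Proof.
apply: oca_op_inj => v; apply: hdot_inj => w.
by rewrite adjP' opD opZ hdotDr hdotZr opD opZ hdotDl hdotZl !adjP'.
Qed.
Let adjM S T : adj (mul S T) = mul (adj T) (adj S).
Proof.
apply: oca_op_inj => v; apply: hdot_inj => w.
by rewrite adjP' [RHS]adjP' adjP'.
Qed.
(** The nontrivial inequality comes from |T v|^2 = <T^* T v, v>. *)
Let norm_adj T : rn (mul (adj T) T) = rn T ^+ 2.
Proof.
have le_sq (c : R) : 0 <= c -> (forall v, rn (oca_op T v) ^+ 2 <= c * rn v ^+ 2) -> rn T ^+ 2 <= c.
  move=> c0 h; have c1 : 0 <= Num.sqrt c by exact: sqrtr_ge0.
  have : rn T <= Num.sqrt c.
    rewrite rn_oca; apply: oca_norm_le => // v.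
    rewrite -ler_sqr ?nnegrE ?mulr_ge0 ?rn_ge0 // exprMn sqr_sqrtr //.
  by rewrite -ler_sqr ?nnegrE ?rn_ge0 // sqr_sqrtr.
have nadj : rn (adj T) <= rn T.
  rewrite [rn (adj T)]rn_oca; apply: oca_norm_le; first exact: rn_ge0.
  apply: hdot_bound; first exact: rn_ge0.
  move=> x y; rewrite adjP'; apply: le_trans (cauchy_schwarz _ _) _.
  have := ler_wpM2l (rn_ge0 x) (op_bound T y); rewrite mulrCA mulrA; exact.
apply/eqP; rewrite eq_le; apply/andP; split.
  have := normM (adj T) T; rewrite !rnE -rmorphM lecR /= => /le_trans; apply.
  by rewrite expr2 ler_wpM2r ?rn_ge0.
apply: le_sq; first exact: rn_ge0.
move=> v; rewrite rn_sqE -adjP'; apply: le_trans (Re_le_rn _) _.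
apply: le_trans (cauchy_schwarz _ _) _.
by rewrite expr2 mulrA ler_wpM2r ?rn_ge0 //; exact: (op_bound (mul (adj T) T) v).
Qed.
Let cstar_id T : `|mul (adj T) T| = `|T| ^+ 2.
Proof. by rewrite !rnE norm_adj rmorphXn. Qed.

Let oca_cstar : cstarAlgebra R :=
  CstarAlgebra mulA mul_linearl mul_linearr normM adjK adj_antilinear adjM cstar_id.

(** Makes a norm-closed self-adjoint algebra of operators into an abstract C*-algebra. The second
    clause, together with [sr_contractive], says that [op] is isometric; later sections use only
    these clauses. *)
Lemma operator_algebra : exists (A : cstarAlgebra R) (op : A -> H -> H),
  [/\ star_rep op,
    (forall a (c : R), 0 <= c -> (forall v, rn (op a v) <= c * rn v) -> rn a <= c) &
    forall T, B T <-> exists a, op a = T].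
Proof.
exists oca_cstar, oca_op; split.
- split; [| | |by move=> T v w; exact: (adjP' T v w)].
  + by move=> a; exact: oca_bounded Balg _ (oca_opP a).
  + by move=> c a b v; rewrite opD opZ.
  + by [].
- exact: oca_norm_le.
- move=> T; split=> [BT|[a <-]]; last exact: oca_opP.
  by exists (mk_oca BT).
Qed.

End OperatorAlgebra.

(** * Integrated forms *)

Section AutomaticAdjoint.
Variables (R : realType) (A : cstarAlgebra R) (H : hilbertSpace R).
Variable rho : A -> H -> H.
Hypotheses
  (rho_lin : forall c a b v, rho (c *: a + b) v = c *: rho a v + rho b v)
  (rho_vlin : forall a, linear (rho a))
  (rho_mul : forall a b v, rho (cmul a b) v = rho a (rho b v))
  (rho_bound : forall a v, rn (rho a v) <= rn a * rn v)
  (rho_nondeg : forall v (e : R), 0 < e ->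
    exists2 b, rn b <= 1 & rn (rho b v - v) <= e).

Let dot0 a v w := hdot (rho a v) w - hdot v (rho a w).

(* For self-adjoint [a], [|b + i t a b|^2 <= 1 + t^2 |a|^2] when [|b| <= 1]; letting
   [rho b v] tend to [v], the term linear in [t] has to vanish. *)
Let selfadj_bound a v (r : R) : cadj a = a ->
  rn (v + (r%:C%C * 'i%C) *: rho a v) ^+ 2 <= (1 + r ^+ 2 * rn a ^+ 2) * rn v ^+ 2.
Proof.
move=> aJ; set z := r%:C%C * 'i%C; set M := 1 + r ^+ 2 * rn a ^+ 2.
have M0 : 0 <= M by rewrite addr_ge0 // mulr_ge0 ?sqr_ge0.
have zJ : z^*%C = - z by rewrite /z; apply/eqP; rewrite eq_complex /= !(mul0r, mulr0, mulr1, subr0, addr0, oppr0) !eqxx.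
have zz : z^*%C * z = (r ^+ 2)%:C%C.
  by rewrite /z; apply/eqP; rewrite eq_complex /= !(mul0r, mulr0, mulr1, subr0, addr0, oppr0, sub0r, add0r, mulrN, mulNr, opprK) expr2 !eqxx.
have rnz : rn z = `|r|.
  rewrite /z rnM rn_real (_ : rn ('i%C : R[i]) = 1) ?mulr1 //.
  apply/eqP; rewrite -sqrp_eq1 ?rn_ge0 //; apply/eqP.
  by rewrite rn_sqr /= expr0n /= add0r expr1n.
(* In the C*-identity the two cross terms cancel, because a is self-adjoint and z is purely
   imaginary. *)
have bnd b : rn b <= 1 -> rn (b + z *: cmul a b) ^+ 2 <= M.
  move=> b1.
  rewrite -rn_cstar cadjD cadjZ cadjM aJ cmulDl !cmulDr !cmulZl !cmulZr zJ.
  have -> : cmul (cmul (cadj b) a) b = cmul (cadj b) (cmul a b) by rewrite cmulA.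
  rewrite -addrA [- z *: cmul (cadj b) _]scaleNr addNKr scalerA -zJ zz.
  apply: le_trans (rn_triangle _ _) _; apply: lerD.
    by rewrite rn_cstar expr_le1 ?rn_ge0.
  rewrite rnZ rn_real ger0_norm ?sqr_ge0 //; rewrite ler_wpM2l ?sqr_ge0 //.
  apply: le_trans (rn_cmul _ _) _.
  have h1 : rn (cmul a b) <= rn a.
    by apply: le_trans (rn_cmul _ _) _; rewrite ler_piMr ?rn_ge0.
  have h2 : rn (cmul (cadj b) a) <= rn a.
    by apply: le_trans (rn_cmul _ _) _; rewrite rn_cadj ler_piMl ?rn_ge0.
  by rewrite expr2; apply: ler_pM; rewrite ?rn_ge0.
(* Applied to b with rho(b) v close to v, the bound on the algebra element becomes a bound at the
   vector v. *)
have h e : 0 < e -> rn (v + z *: rho a v) <= Num.sqrt M * rn v + e.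
  move=> e0; set k := 1 + `|r| * rn a.
  have k0 : 0 < k by rewrite ltr_wpDr ?mulr_ge0 ?rn_ge0.
  have [|b b1 hb] := @rho_nondeg v (e / k); first by rewrite divr_gt0.
  rewrite -[v + _](subrK (rho (b + z *: cmul a b) v)) addrC.
  apply: le_trans (rn_triangle _ _) _; apply: lerD.
    apply: le_trans (rho_bound _ _) _; rewrite ler_wpM2r ?rn_ge0 //.
    by rewrite -ler_sqr ?nnegrE ?rn_ge0 ?sqrtr_ge0 // sqr_sqrtr // bnd.
  have -> : rho (b + z *: cmul a b) v = rho b v + z *: rho a (rho b v).
    by rewrite addrC rho_lin rho_mul addrC.
  rewrite opprD addrACA -scalerBr -(linear_opP (rho_vlin a)).
  apply: le_trans (rn_triangle _ _) _; rewrite rnZ rnz.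
  apply: (@le_trans _ _ (k * rn (v - rho b v))).
    by rewrite mulrDl mul1r lerD2l -mulrA ler_wpM2l ?rho_bound.
  by rewrite mulrC -ler_pdivlMr // rn_distC.
rewrite -[M](sqr_sqrtr M0) -exprMn ler_sqr ?nnegrE ?mulr_ge0 ?rn_ge0 ?sqrtr_ge0 //.
by apply/ler_addgt0Pr.
Qed.

Let selfadj a v w : cadj a = a -> hdot (rho a v) w = hdot v (rho a w).
Proof.
move=> aJ.
have diag u : dot0 a u u = 0.
  have d0 : Re (hdot u ('i%C *: rho a u)) = 0.
    have : Re (hdot u ('i%C *: rho a u)) ^+ 2 <= 0 * (rn a ^+ 2 * rn u ^+ 2).
      apply: quadratic_bound => [|r]; first by rewrite mulr_ge0 ?sqr_ge0.
      have := selfadj_bound u r aJ; rewrite rnD_sq -scalerA hdotZr conjc_real ReM_real.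
      have : 0 <= rn (r%:C%C *: ('i%C *: rho a u)) ^+ 2 by exact: sqr_ge0.
      move: (Re _) (rn _ ^+ 2) (rn u ^+ 2) (rn a ^+ 2) => d q U m q0 h; lra.
    by rewrite mul0r => h; apply/eqP; rewrite -sqrf_eq0 eq_le h sqr_ge0.
  move: d0; rewrite hdotZr /dot0 (hdotC u (rho a u)).
  case: (hdot u (rho a u)) => x y /= d0.
  apply/eqP; rewrite eq_complex /= subrr eqxx /=.
  move: d0; rewrite mul0r sub0r mulN1r opprK => ->.
  by rewrite oppr0 addr0.
have D x y x' y' : dot0 a (x + x') (y + y') = dot0 a x y + dot0 a x' y' + (dot0 a x y' + dot0 a x' y).
  rewrite /dot0 (linear_opP (rho_vlin a)) (linear_opP (rho_vlin a)) !hdotDl !hdotDr.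
  ring.
have Z c x y : dot0 a (c *: x) y = c * dot0 a x y.
  by rewrite /dot0 (linear_opP (rho_vlin a)) !hdotZl mulrBr.
have Zr c x y : dot0 a x (c *: y) = c^*%C * dot0 a x y.
  by rewrite /dot0 (linear_opP (rho_vlin a)) !hdotZr mulrBr.
(* Polarization: the diagonal terms at v + w and at v + i w vanish, which leaves the off-diagonal
   ones. *)
have e1 := diag (v + w); rewrite D !diag addr0 add0r in e1.
have e2 := diag (v + 'i%C *: w); rewrite D !diag addr0 add0r Z Zr in e2.
have iJ : ('i%C : R[i])^*%C = - 'i%C by apply/eqP; rewrite eq_complex /= oppr0 !eqxx.
have i0 : ('i%C : R[i]) != 0 by rewrite eq_complex /= oner_eq0 andbF.
rewrite iJ mulNr addrC -mulrBr in e2.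
move/eqP: e2; rewrite mulf_eq0 (negbTE i0) /= subr_eq0 => /eqP e2.
move: e1; rewrite e2 -mulr2n => /eqP; rewrite mulrn_eq0 /= => /eqP h.
by apply/eqP; rewrite -subr_eq0; apply/eqP.
Qed.

(* Applied to integrated forms, this avoids the involution of [Cc] and with it the
   modular function. *)
Lemma automatic_star_rep : star_rep rho.
Proof.
split=> // [a|a v w].
  by apply/bounded_operatorP; split=> //; exists (rn a); [exact: rn_ge0|exact: rho_bound].
have rD x y u : rho (x + y) u = rho x u + rho y u.
  by have := rho_lin 1 x y u; rewrite !scale1r.
have rB x y u : rho (x - y) u = rho x u - rho y u.
  by have := rho_lin (- 1) y x u; rewrite !scaleN1r addrC [RHS]addrC.
have iJ : ('i%C : R[i])^*%C = - 'i%C by apply/eqP; rewrite eq_complex /= oppr0 !eqxx.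
have i0 : ('i%C : R[i]) != 0 by rewrite eq_complex /= oner_eq0 andbF.
have rZ c x u : rho (c *: x) u = c *: rho x u.
  by have := rho_lin c x 0 u; rewrite addr0 -(subrr x) rB subrr addr0.
have h1 : hdot (rho (a + cadj a) v) w = hdot v (rho (a + cadj a) w).
  by apply: selfadj; rewrite cadjD cadjK addrC.
have h2 : hdot (rho ('i%C *: (a - cadj a)) v) w = hdot v (rho ('i%C *: (a - cadj a)) w).
  by apply: selfadj; rewrite cadjZ iJ cadjB cadjK scaleNr -scalerN opprB.
move: h1 h2; rewrite !rD !rZ !rB hdotDl hdotDr hdotZl hdotZr iJ hdotBl hdotBr mulNr -mulrN.
move=> h1 /(mulfI i0) h2.
have : 2%:R * hdot (rho (cadj a) v) w = 2%:R * hdot v (rho a w).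
  rewrite !mulr_natl !mulr2n.
  have -> : hdot (rho (cadj a) v) w + hdot (rho (cadj a) v) w =
    (hdot (rho a v) w + hdot (rho (cadj a) v) w) - (hdot (rho a v) w - hdot (rho (cadj a) v) w).
    by ring.
  by rewrite h1 h2; ring.
by apply: mulfI; rewrite pnatr_eq0.
Qed.

End AutomaticAdjoint.

(** * The operator norm *)

Section OperatorNorm.
Variables (R : realType) (H : hilbertSpace R) (T : H -> H) (c : R).
Hypotheses (T_lin : linear T) (c0 : 0 <= c) (T_bound : forall v, rn (T v) <= c * rn v).

Let ball_im := [set Re `|T x| | x in [set x | `|x| <= 1]].

Let le1 (x : H) : (`|x| <= 1) = (rn x <= 1).
Proof. by rewrite rnE -(rmorph1 (real_complex R)) lecR. Qed.

Let ball_ub : ubound ball_im c.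
Proof.
move=> _ [x /= + <-]; rewrite le1 => x1; apply: le_trans (T_bound x) _.
by rewrite ler_piMr.
Qed.

Let ball_sup : has_sup ball_im.
Proof.
split; last by exists c; exact: ball_ub.
by exists (Re `|T 0|), 0 => //=; rewrite le1 rn0.
Qed.

Lemma opnorm_le : opnorm T <= c.
Proof. by apply: ge_sup => //; case: ball_sup. Qed.

Lemma opnorm_bound v : rn (T v) <= opnorm T * rn v.
Proof.
have [v0|v0] := eqVneq (rn v) 0.
  by rewrite (rn_eq0 v0) (linear_op0 T_lin) !rn0 mulr0.
have v1 : 0 < rn v by rewrite lt_neqAle eq_sym v0 rn_ge0.
rewrite -ler_pdivrMr //.
have -> : rn (T v) / rn v = Re `|T ((rn v)^-1%:C%C *: v)|.
  rewrite (linear_opP T_lin) -/(rn _) rnZ rn_real ger0_norm ?invr_ge0 ?rn_ge0 //.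
  exact: mulrC.
apply: ub_le_sup; first by case: ball_sup.
exists ((rn v)^-1%:C%C *: v) => //=.
by rewrite le1 rnZ rn_real ger0_norm ?invr_ge0 ?rn_ge0 // mulVf.
Qed.

End OperatorNorm.

Lemma sconv_dom (R : realType) (V W : normedZmodType R[i]) (u : nat -> V) a
    (w : nat -> W) b (c : R) :
  (forall n, rn (w n - b) <= c * rn (u n - a)) -> sconv u a -> sconv w b.
Proof.
move=> h cu e e0; have c1 : 0 < `|c| + 1 by rewrite ltr_wpDl.
have [|n0 h0] := cu (e / (`|c| + 1)); first by rewrite divr_gt0.
exists n0 => n /h0; rewrite ltr_pdivlMr // => hn; apply: le_lt_trans (h n) _.
apply: le_lt_trans hn; rewrite mulrC ler_wpM2l ?rn_ge0 //.
by rewrite (le_trans (ler_norm c)) // lerDl.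
Qed.

Lemma linear_mapB (R : realType) (V W : lmodType R[i]) (U : V -> W) x y :
  linear U -> U (x - y) = U x - U y.
Proof.
move=> h; have : U (- 1 *: y + x) = - 1 *: U y + U x by exact: h.
by rewrite !scaleN1r [- y + x]addrC [- U y + U x]addrC.
Qed.

Lemma linear_map0 (R : realType) (V W : lmodType R[i]) (U : V -> W) :
  linear U -> U 0 = 0.
Proof. by move=> h; rewrite -(subrr 0) linear_mapB // subrr. Qed.

(** * Integrated forms on the group C*-algebra *)

Section IntegratedForm.
Variables (R : realType) (L : topGroupType) (mu : haarIntegral R L).
Hypothesis hL : hausdorff_space L.
Variable A : groupCstar mu.
Implicit Types (pi : unitaryRep R L) (f g : L -> R[i]).
Local Notation gc := (gc_emb A).

Let norm_set f := [set r | exists pi : unitaryRep R L, r = opnorm (@integrate R L mu pi f)].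

Let norm_ub f : Cc f -> ubound (norm_set f) (mun mu f).
Proof.
move=> cf _ [pi ->]; apply: opnorm_le => [|v]; first exact: mun_ge0.
exact: integrate_bound.
Qed.

Let norm_sup f pi : Cc f -> has_sup (norm_set f).
Proof.
move=> cf; split; first by exists (opnorm (@integrate R L mu pi f)), pi.
by exists (mun mu f); exact: norm_ub.
Qed.

Let rn_gc f : Cc f -> rn (gc f) = cstar_norm mu f.
Proof. by move=> cf; rewrite /rn gc_emb_norm. Qed.

(** [pi] witnesses that the set whose supremum is [cstar_norm] is nonempty. *)
Lemma gc_emb_le pi f : Cc f -> rn (gc f) <= mun mu f.
Proof.
move=> cf; rewrite rn_gc //; apply: ge_sup; last exact: norm_ub.
by have [] := norm_sup pi cf.
Qed.

Lemma integrate_le pi f (v : rep_space pi) : Cc f ->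
  rn (integrate mu f v) <= rn (gc f) * rn v.
Proof.
move=> cf.
have int_le (w : rep_space pi) : rn (integrate mu f w) <= mun mu f * rn w.
  exact: integrate_bound.
apply: le_trans (opnorm_bound (integrate_linear mu cf) (mun_ge0 mu cf) int_le v) _.
rewrite ler_wpM2r ?rn_ge0 // rn_gc //; apply: ub_le_sup; last by exists pi.
by have [] := norm_sup pi cf.
Qed.

Lemma gc_embB f g : Cc f -> Cc g -> gc (fun x => f x - g x) = gc f - gc g.
Proof.
move=> cf cg; have := gc_emb_linear A (- 1) cg cf; rewrite scaleN1r addrC => <-.
by congr (gc_emb A); apply/funext => x; rewrite mulN1r addrC.
Qed.

Lemma gc_dense (a : A) (e : R) : 0 < e -> exists2 f, Cc f & rn (a - gc f) < e.
Proof.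
move=> e0; have : nbhs a [set b | rn (b - a) < e] by apply/nbhs_rnP; exists e.
rewrite nbhsE => -[B [oB Ba] sB].
have [|b [Bb [f cf fb]]] := @gc_emb_dense _ _ _ A B _ oB; first by exists a.
by exists f => //; rewrite rn_distC fb; exact: sB.
Qed.

Lemma gc_seq (a : A) : exists2 f : nat -> L -> R[i],
  (forall n, Cc (f n)) & sconv (fun n => gc (f n)) a.
Proof.
have [e e0|u hu cu] := @approx_sconv _ _ (fun b => exists2 f, Cc f & gc f = b) a.
  by have [f cf h] := gc_dense a e0; exists (gc f); [exists f|rewrite rn_distC].
have /choice[f hf] : forall n, exists f, Cc f /\ gc f = u n.
  by move=> n; have [f cf fu] := hu n; exists f.
exists f => [n|]; first by have [] := hf n.
by rewrite (_ : (fun n => _) = u) //; apply/funext => n; have [] := hf n.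
Qed.

Section OneRep.
Variable pi : unitaryRep R L.
Local Notation H := (rep_space pi).
Local Notation int f := (@integrate R L mu pi f).

(** For each vector, f |-> integrate f v is Lipschitz in the C*-norm and extends from the dense
    image of [Cc]. Products come from [integrate_conv]; adjoints come from [automatic_star_rep],
    whose nondegeneracy condition is [approximate_unit]. *)
Lemma integrated_form_exists : exists rho : A -> H -> H,
  star_rep rho /\ forall f, Cc f -> rho (gc f) = int f.
Proof.
have /choice[T hT] : forall v : H, exists T : A -> H,
    forall x f, Cc f -> rn (T x - int f v) <= rn v * rn (x - gc f).
  move=> v; apply: extend_dense; first exact: rn_ge0.
    move=> f g cf cg; rewrite -integrateB // -gc_embB // mulrC.
    by apply: integrate_le; exact: Cc_sub2.
  by move=> x e; exact: gc_dense.
pose rho a v := T v a.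
have rhoE f v : Cc f -> rho (gc f) v = int f v.
  move=> cf; apply/eqP; rewrite -subr_eq0; apply/eqP/rn_eq0/eqP.
  rewrite eq_le rn_ge0 andbT; apply: le_trans (hT _ _ _ cf) _.
  by rewrite subrr rn0 mulr0.
have lim a v (f : nat -> L -> R[i]) : (forall n, Cc (f n)) ->
    sconv (fun n => gc (f n)) a -> sconv (fun n => int (f n) v) (rho a v).
  move=> cf cu; apply: (@sconv_dom _ _ _ _ _ _ _ (rn v)) cu => n.
  by rewrite rn_distC [X in _ * X]rn_distC; exact: hT.
have lin c a b v : rho (c *: a + b) v = c *: rho a v + rho b v.
  have [f cf fa] := gc_seq a; have [g cg gb] := gc_seq b.
  apply: (@sconv_unique _ _ (fun n => int (fun x => c * f n x + g n x) v)).
    apply: lim => [n|]; first exact: Cc_lin.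
    rewrite (_ : (fun n => _) = fun n => c *: gc (f n) + gc (g n)); last first.
      by apply/funext => n; rewrite gc_emb_linear.
    apply: sconvD gb; apply: (@sconv_lip _ _ _ (fun z : A => c *: z) (rn c) _ _ _ fa) => n.
    by rewrite -scalerBr rnZ.
  rewrite (_ : (fun n => _) = fun n => c *: int (f n) v + int (g n) v); last first.
    by apply/funext => n; rewrite integrateD.
  apply: sconvD (lim _ _ _ cg gb).
  apply: (@sconv_lip _ _ _ (fun z : H => c *: z) (rn c) _ _ _ (lim _ _ _ cf fa)) => n.
  by rewrite -scalerBr rnZ.
have vlin a : linear (rho a).
  move=> c v w; have [f cf fa] := gc_seq a.
  apply: (sconv_unique (lim _ _ _ cf fa)).
  rewrite (_ : (fun n => _) = fun n => c *: int (f n) v + int (f n) w); last first.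
    by apply/funext => n; rewrite integrate_linear.
  apply: sconvD (lim _ _ _ cf fa).
  apply: (@sconv_lip _ _ _ (fun z : H => c *: z) (rn c) _ _ _ (lim _ _ _ cf fa)) => n.
  by rewrite -scalerBr rnZ.
have bound a v : rn (rho a v) <= rn a * rn v.
  apply/ler_addgt0Pr => e e0.
  have v1 : 0 < rn v + rn v + 1 by rewrite ltr_wpDl // addr_ge0 ?rn_ge0.
  have [|f cf fa] := gc_dense a (e := e / (rn v + rn v + 1)); first by rewrite divr_gt0.
  rewrite -[rho a v](subrK (int f v)) addrC.
  apply: le_trans (rn_triangle _ _) _.
  apply: (@le_trans _ _ (rn (gc f) * rn v + rn v * rn (a - gc f))).
    by apply: lerD; [exact: integrate_le|exact: hT].
  have h : rn (gc f) <= rn a + rn (a - gc f).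
    by have := rn_tri3 (gc f) a 0; rewrite !subr0 addrC [rn (gc f - a)]rn_distC.
  move: fa; rewrite ltr_pdivlMr // => fa.
  have := ler_wpM2r (rn_ge0 v) h.
  have := rn_ge0 v; have := rn_ge0 (a - gc f).
  move: fa h; move: (rn v) (rn (gc f)) (rn a) (rn (a - gc f)) => v' f' a' d; nra.
have lipl v a b : rn (rho a v - rho b v) <= rn v * rn (a - b).
  have -> : rho a v - rho b v = rho (a - b) v.
    by have := lin (- 1) b a v; rewrite !scaleN1r addrC [RHS]addrC => ->.
  by rewrite mulrC bound.
have mul1 f b v : Cc f -> rho (cmul (gc f) b) v = int f (rho b v).
  move=> cf; have [g cg gb] := gc_seq b.
  apply: (@sconv_unique _ _ (fun n => int f (int (g n) v))).
    rewrite (_ : (fun n => _) = fun n => int (convolution mu f (g n)) v); last first.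
      by apply/funext => n; rewrite integrate_conv.
    apply: lim => [n|]; first exact: Cc_convolution.
    rewrite (_ : (fun n => _) = fun n => cmul (gc f) (gc (g n))); last first.
      by apply/funext => n; rewrite gc_emb_conv.
    apply: (@sconv_lip _ _ _ (fun z : A => cmul (gc f) z) (rn (gc f)) _ _ _ gb) => n.
    by rewrite -cmulBr rn_cmul.
  apply: (@sconv_lip _ _ _ (fun z : H => int f z) (rn (gc f)) _ _ _ (lim _ _ _ cg gb)) => n.
  by rewrite -(linear_opP (integrate_linear mu cf)) integrate_le.
have mul a b v : rho (cmul a b) v = rho a (rho b v).
  have [f cf fa] := gc_seq a.
  apply: (@sconv_unique _ _ (fun n => int (f n) (rho b v))); last exact: lim.
  rewrite (_ : (fun n => _) = fun n => rho (cmul (gc (f n)) b) v); last first.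
    by apply/funext => n; rewrite mul1.
  apply: (@sconv_dom _ _ _ _ _ _ _ (rn v * rn b)) fa => n.
  apply: le_trans (lipl _ _ _) _; rewrite -cmulBl -mulrA ler_wpM2l ?rn_ge0 //.
  by rewrite mulrC rn_cmul.
exists rho; split; last by move=> f cf; apply/funext => v; exact: rhoE.
apply: automatic_star_rep => // v e e0.
have [f [cf f1 hf]] := approximate_unit mu hL v e0.
exists (gc f); first exact: le_trans (gc_emb_le pi cf) f1.
by rewrite rhoE.
Qed.

Let spec := xgetPex (fun _ _ => 0) integrated_form_exists.

Lemma integrated_form_star : star_rep (@integrated_form R L mu A pi).
Proof. by case: spec. Qed.

Lemma integrated_formE f : Cc f -> integrated_form (gc f) = int f.
Proof. by case: spec => _; apply. Qed.

Lemma integrated_form_nondeg (v : H) (e : R) : 0 < e -> exists2 f, Cc f &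
  rn (gc f) <= 1 /\ rn (integrated_form (gc f) v - v) <= e.
Proof.
move=> e0; have [f [cf f1 hf]] := approximate_unit mu hL v e0.
exists f => //; rewrite integrated_formE //; split=> //.
exact: le_trans (gc_emb_le pi cf) f1.
Qed.

End OneRep.

(** A bounded map that intertwines on [Cc] intertwines everywhere, by density. With the identity as
    [U] this recognizes integrated forms, and with an operator of the commutant it extends
    commutation to the whole C*-algebra. *)
Lemma integrated_form_unique pi (K : hilbertSpace R) (rho : A -> K -> K)
    (U : rep_space pi -> K) (c : R) :
  star_rep rho -> linear U -> (forall v, rn (U v) <= c * rn v) ->
  (forall f v, Cc f -> U (integrate mu f v) = rho (gc f) (U v)) ->
  forall a v, U (integrated_form a v) = rho a (U v).
Proof.
move=> sr U_lin U1 h a v; have sr' := integrated_form_star pi.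
have [v0|v0] := eqVneq (rn v) 0.
  by rewrite (rn_eq0 v0) (srv0 sr') (linear_map0 U_lin) (srv0 sr).
have v1 : 0 < rn v by rewrite lt_neqAle eq_sym v0 rn_ge0.
have c0 : 0 <= c.
  by rewrite -(pmulr_lge0 c v1); apply: le_trans (U1 v); exact: rn_ge0.
move: a; apply: (@lipschitz_eq _ _ (@Cc R L) A K gc _ _ (c * rn v)).
- move=> x y; rewrite -(linear_mapB _ _ U_lin) -(srB sr').
  apply: le_trans (U1 _) _; rewrite -mulrA ler_wpM2l // mulrC.
  exact: (sr_contractive sr').
- move=> x y; rewrite -(srB sr); apply: le_trans (sr_contractive sr _ _) _.
  by rewrite mulrC ler_wpM2r ?rn_ge0.
- by move=> x e; exact: gc_dense.
- by move=> f cf; rewrite integrated_formE // h.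
Qed.

Lemma cker_unitary_equiv pi rho : unitary_equiv pi rho -> cker A pi = cker A rho.
Proof.
move=> [U [U_lin Uiso Usurj Uint]].
have Un v : rn (U v) = rn v.
  by apply/eqP; rewrite -(@eqrXn2 _ 2) ?rn_ge0 //; apply/eqP; rewrite !rn_sqE Uiso.
have E a v : U (integrated_form (A := A) a v) = integrated_form a (U v).
  apply: (@integrated_form_unique _ _ _ _ 1) => //.
  - exact: integrated_form_star.
  - by move=> w; rewrite mul1r Un.
  - move=> f w cf; rewrite integrated_formE //; apply/esym.
    apply: integrate_unique => // z; have [z' <-] := Usurj z.
    rewrite Uiso integrateP //; apply: eq_mu => x.
    by rewrite -Uint Uiso.
apply/seteqP; split=> a /= h w.
  by have [v <-] := Usurj w; rewrite -E h (linear_map0 U_lin).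
by apply: rn_eq0; rewrite -Un E h rn0.
Qed.

(** A closed subspace invariant under the integrals is invariant under the group: s(y) x is a limit
    of integrals of left translates, by y, of approximate units at x. *)
Lemma integrated_form_irreducible (s : irrep R L) :
  irreducible_operators (range (@integrated_form R L mu A s)).
Proof.
have [nz irr] := irrepP s; split=> // V cV sV; apply: irr => // _ x [y _ <-] Vx.
have [_ _ clV] := cV; have sr := integrated_form_star s.
have [u hu cu] : exists2 u, (forall n, V (u n)) & sconv u (s y x).
  apply: approx_sconv => e e0; have e2 : 0 < e / 2 by rewrite divr_gt0.
  have [f cf [_ hf]] := integrated_form_nondeg x e2.
  have cfy : Cc (fun z => f (y^-1 * z)%g) by exact: Cc_shift.
  exists (integrated_form (gc (fun z => f (y^-1 * z)%g)) x).
    by apply: sV => //; exists (gc (fun z => f (y^-1 * z)%g)).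
  rewrite integrated_formE // integrate_shift //.
  rewrite -(linear_opP (@rep_linear _ _ s y)) rn_rep.
  rewrite integrated_formE // in hf; apply: le_lt_trans hf _.
  by rewrite ltr_pdivrMr // ltr_pMr // ltr1n.
exact: closed_sconv hu cu.
Qed.

Lemma dual_ker_primitive c : primitive_ideal (dual_ker A c).
Proof.
exists (rep_space (dual_repr c)), (@integrated_form R L mu A (dual_repr c)); split=> //.
- exact: integrated_form_star.
- exact: integrated_form_irreducible.
- move=> E; have [[x /eqP x0] _] := irrepP (dual_repr c); apply: x0.
  apply: rn_eps => e e0; have [f cf [_ hf]] := integrated_form_nondeg x e0.
  have : dual_ker A c (gc f) by rewrite E.
  by move=> /(_ x) z; rewrite z sub0r rnN in hf.
Qed.

Lemma dual_repr_class (s : irrep R L) : unitary_equiv s (dual_repr (dual_class s)).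
Proof.
rewrite /dual_repr; case: (cid _) => t /= E.
have -> : unitary_equiv s t = unitary_equiv t t := f_equal (fun p => p t) E.
by exists id; split=> // w; exists w.
Qed.

Lemma dual_ker_class (s : irrep R L) : dual_ker A (dual_class s) = cker A s.
Proof. exact/esym/cker_unitary_equiv/dual_repr_class. Qed.

End IntegratedForm.

(** * Separability *)

Section Separability.
Variables (R : realType) (L : topGroupType) (mu : haarIntegral R L).
Hypothesis hL : hausdorff_space L.
Hypothesis L2 : @second_countable L.
Implicit Types (f : L -> R[i]).

Let basis_seq : exists B : nat -> set L, forall (x : L) (U : set L), nbhs x U ->
  exists i, nbhs x (B i) /\ B i `<=` U.
Proof.
have [B /countable_injP[n n_inj] [oB hB]] := L2.
(* Enumerates the countable base along the injection [n]; numbers outside its range get the empty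
   set. *)
exists (fun i => xget set0 [set U | B U /\ n U = i]) => x U nU.
have [V [BV Vx] VU] := hB x U nU.
exists (n V); have -> : xget set0 [set U | B U /\ n U = n V] = V; last first.
  by split=> //; apply: open_nbhs_nbhs; split=> //; exact: oB.
have [BW nW] := @xgetPex _ set0 [set U | B U /\ n U = n V] (ex_intro _ V (conj BV erefl)).
by apply: n_inj; rewrite ?inE.
Qed.

Let bump_fun (V W : set L) (h : L -> R) :=
  (forall x, V x -> 2^-1 < h x) /\ (forall x, h x != 0 -> W x).

(** Indexed by pairs of basic open sets: for each pair, a function above 1/2 on the first and zero
    off the second is chosen if there is one. Countably many functions thus resolve all
    neighbourhoods. *)
Let bump_family : exists b : nat * nat -> L -> R,
  (forall p, Cc (fun x => (b p x)%:C%C : R[i]) /\ forall x, 0 <= b p x) /\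
  forall (x : L) U, nbhs x U -> exists2 p, nbhs x [set y | 2^-1 < b p y] &
    forall y, b p y != 0 -> U y.
Proof.
have [B hB] := basis_seq.
have /choice[b hb] : forall p : nat * nat, exists h : L -> R,
    (Cc (fun x => (h x)%:C%C : R[i]) /\ forall x, 0 <= h x) /\
    ((exists h', (Cc (fun x => (h' x)%:C%C : R[i]) /\ forall x, 0 <= h' x) /\
      bump_fun (B p.1) (B p.2) h') -> bump_fun (B p.1) (B p.2) h).
  move=> p; have [[h [h1 h2]]|no] := pselect (exists h',
    (Cc (fun x => (h' x)%:C%C : R[i]) /\ forall x, 0 <= h' x) /\ bump_fun (B p.1) (B p.2) h').
    by exists h.
  have [f0 cf0 _] := haar_neq0 mu.
  (* The zero function stands for the pairs that admit no such bump. *)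
  by exists (fun=> 0); split=> //; split=> //; exact: Cc0 cf0.
exists b; split=> [p|x U nU]; first by case: (hb p).
have [j [nj jU]] := hB x U nU.
have [h [ch hx h01 hs]] := bump mu hL nj.
have hcont : continuous h by apply/continuous_realP; exact: CcW ch.
have [|i [ni ih]] := hB x [set y | 2^-1 < h y].
  by apply: continuous_nbhs_gt => //; rewrite hx; lra.
have [_ [|h1 h2]] := hb (i, j).
  by exists h; split; split=> // y; have /andP[] := h01 y.
by exists (i, j) => [|y /h2 /jU //]; apply: filterS ni => y /h1.
Qed.

Let rat_approx (z : R[i]) (e : R) : 0 < e ->
  exists q : rat * rat, rn (z - Complex (ratr q.1) (ratr q.2)) <= e.
Proof.
case: z => x y e0.
have near (t : R) : exists q : rat, `|t - ratr q| <= e / 2.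
  have /rat_in_itvoo[q] : t - e / 2 < t + e / 2 by lra.
  rewrite in_itv /= => /andP[h1 h2]; exists q.
  by rewrite ler_norml; apply/andP; split; lra.
have [p hp] := near x; have [q hq] := near y; exists (p, q).
apply: le_trans (rn_ReIm _) _; rewrite /=.
by move: hp hq; move: `|_| `|_| => u v; lra.
Qed.

(** Combinations, with rational complex coefficients, of the normalized bumps of [bump_family]. Such
    a combination approximates f uniformly, and the bumps used live where a fixed majorant of the
    support of f exceeds 1/2, so the error is small in L^1. *)
Lemma Cc_separable : exists f_ : nat -> L -> R[i], (forall n, Cc (f_ n)) /\
  forall f (e : R), Cc f -> 0 < e -> exists n, mun mu (fun x => f x - f_ n x) <= e.
Proof.
have [b [hb bU]] := bump_family.
have cb p : continuous (b p) by apply/continuous_realP; case: (hb p) => /CcW.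
have b0 p x : 0 <= b p x by case: (hb p).
pose code := seq ((rat * rat) * (nat * nat)).
pose S (s : seq (nat * nat)) x := \sum_(p <- s) b p x.
(* After division by [m] the bumps of s add up to at most 1 everywhere, and to exactly 1 where their
   sum was at least 1/2. *)
pose m s x := Num.max (S s x) 2^-1.
have m0 s x : 0 < m s x by rewrite lt_max invr_gt0 ltr0n orbT.
have cm s : continuous (fun x => (m s x)^-1).
  move=> x; apply: cvgV; first by rewrite gt_eqF.
  apply: (@continuous_max _ _ (S s) (fun=> 2^-1)); last exact: cvg_cst.
  exact: continuous_real_sum.
pose u s p x := b p x / m s x.
have u0 s p x : 0 <= u s p x by rewrite divr_ge0 // ltW.
have Ccu s p : Cc (fun x => (u s p x)%:C%C : R[i]).
  have [ccb _] := hb p.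
  have cmC : continuous (fun x => ((m s x)^-1)%:C%C : R[i]) by apply/continuous_realP.
  rewrite (_ : (fun _ => _) = fun x => (b p x)%:C%C * ((m s x)^-1)%:C%C).
    exact: (Cc_mulr ccb cmC).
  by apply/funext => x; rewrite -rmorphM.
pose F s (c : nat * nat -> R[i]) x := \sum_(p <- s) c p * (u s p x)%:C%C.
have CcF s c : Cc (F s c).
  have [f0 cf0 _] := haar_neq0 mu.
  exact: (Cc_sum s cf0 (fun p => Cc_scale (c p) (Ccu s p))).
(* A code lists pairs of a coefficient and the index of a bump, and is numbered by [pickle]. A
   repeated index gets the coefficient of its first occurrence. *)
pose coef (s : code) (p : nat * nat) : R[i] :=
  let q := (nth ((0, 0), (0%N, 0%N)) s (index p (unzip2 s))).1 in
  Complex (ratr q.1) (ratr q.2).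
pose G (s : code) := F (unzip2 s) (coef s).
exists (fun n => G (odflt [::] (unpickle n))); split=> [n|f e cf e0]; first exact: CcF.
suff [s hs] : exists s : code, mun mu (fun x => f x - G s x) <= e.
  by exists (pickle s); rewrite pickleK.
have [chi [cchi chi0 hchi]] := compact_majorant mu hL (Cc_compact cf).
pose M := 2 * mun mu chi + 1.
have M0 : 0 < M by rewrite ltr_wpDl // mulr_ge0 ?mun_ge0.
pose d := e / M / 2.
have d0 : 0 < d by rewrite !divr_gt0.
(* The second condition confines the bumps belonging to points of the support to the region where
   |chi| > 1/2, whence [uchi]. *)
pose W z := [set x | rn (f x - f z) <= d /\ (closure [set x | f x != 0] z -> 2^-1 < rn (chi x))].
have hW z : nbhs z (W z).
  apply: filterI.
    have /continuous_rnP/(_ z d d0) := CcW cf.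
    by apply: filterS => x; exact: ltW.
  have [Kz|nKz] := pselect (closure [set x | f x != 0] z); last first.
    by apply: filterS filterT => x _ /nKz.
  have cr : continuous (fun x => rn (chi x)).
    by apply/continuous_realP; exact: continuous_rn (CcW cchi).
  have : 2^-1 < rn (chi z) by apply: lt_le_trans (hchi _ Kz); lra.
  by move=> /(continuous_nbhs_gt cr); apply: filterS.
have /choice[p hp] : forall z, exists p, nbhs z [set y | 2^-1 < b p y] /\
    forall y, b p y != 0 -> W z y.
  by move=> z; have [p h1 h2] := bU z _ (hW z); exists p.
have [|t [tK ht]] := @compact_finite_cover L _ (fun z => [set x | 2^-1 < b (p z) x]) (Cc_compact cf).
  by move=> z _; case: (hp z).
pose s := undup [seq p z | z <- t].
(* Several points may share a bump; [w] picks one of them, at which f is evaluated. *)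
have /choice[w hw] : forall i, exists z, i \in s -> z \in t /\ i = p z.
  move=> i; have [|_] := boolP (i \in s); last by exists 1%g.
  by rewrite mem_undup => /mapP[z zt ->]; exists z.
have us x : f x != 0 -> \sum_(i <- s) u s i x = 1.
  move=> fx; rewrite -mulr_suml.
  have [|z zt hz] := ht x; first exact: subset_closure.
  have : 2^-1 <= S s x.
    apply: le_trans (ltW hz) _; rewrite /S (big_rem (p z)) //=.
      by rewrite lerDl; apply: sumr_ge0.
    by rewrite mem_undup map_f.
  rewrite -/(S s x) /m => h; move/max_idPl: (h) => ->.
  by rewrite divff // gt_eqF //; apply: lt_le_trans h; rewrite invr_gt0.
have uchi x : \sum_(i <- s) u s i x <= 2 * rn (chi x).
  have [/allP h|] := boolP (all (fun i => b i x == 0) s).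
    rewrite big_seq big1 ?mulr_ge0 ?rn_ge0 // => i /h /eqP bi.
    by rewrite /u bi mul0r.
  move=> /allPn[i si bi]; have [wt iE] := hw i si.
  have [_ h] := hp (w i); rewrite -iE in h.
  have [_ /(_ (tK _ wt)) h2] := h _ bi.
  apply: (@le_trans _ _ 1); last by lra.
  by rewrite -mulr_suml ler_pdivrMr // mul1r le_max lexx.
have /choice[q hq] : forall z, exists q : rat * rat,
    rn (z - Complex (ratr q.1) (ratr q.2)) <= d by move=> z; exact: rat_approx.
exists [seq (q (f (w i)), i) | i <- s].
set cs : code := map _ _.
have zs : unzip2 cs = s by rewrite /unzip2 -map_comp map_id.
have cE i : i \in s -> rn (f (w i) - coef cs i) <= d.
  by move=> si; rewrite /coef zs (nth_map (0%N, 0%N)) ?index_mem // nth_index.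
rewrite /G zs.
apply: (@le_trans _ _ (2 * d * 2 * mun mu chi)); last first.
  rewrite (_ : 2 * d * 2 * mun mu chi = e / M * (2 * mun mu chi)); last by rewrite /d; field; rewrite gt_eqF.
  by rewrite mulrAC ler_pdivrMr //; apply: ler_wpM2l; rewrite ?ltW // /M ltrDl.
apply: (mun_dom mu (Cc_sub2 cf (CcF s (coef cs))) cchi) => x.
apply: (@le_trans _ _ (2 * d * \sum_(i <- s) u s i x)); last first.
  rewrite -[leRHS]mulrA; apply: ler_wpM2l; last exact: uchi. 
  by rewrite mulr_ge0 // ltW.
have -> : f x - F s (coef cs) x = \sum_(i <- s) (f x - coef cs i) * (u s i x)%:C%C.
  under [RHS]eq_bigr do rewrite mulrBl.
  rewrite sumrB -mulr_sumr -rmorph_sum /=; congr (_ - _).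
  by have [->|/us ->] := eqVneq (f x) 0; rewrite ?mul0r ?mulr1.
apply: le_trans (rn_sum _ _ _) _; rewrite mulr_sumr !big_seq; apply: ler_sum => i si.
rewrite rnM rn_real ger0_norm //.
have [->|ui] := eqVneq (u s i x) 0; first by rewrite !mulr0.
rewrite ler_wpM2r //; have [wt iE] := hw i si.
have [_ h] := hp (w i); rewrite -iE in h.
have [|h1 _] := h x; first by apply: contra_neq ui => bi; rewrite /u bi mul0r.
by apply: (rn_le3 h1 (cE i si)); lra.
Qed.

End Separability.

(** * The algebra of conjugates *)

Section BoundedOperators.
Variables (R : realType) (H : hilbertSpace R).
Implicit Types (S T : H -> H).

Lemma bounded_operator_lin (c : R[i]) S T : bounded_operator S -> bounded_operator T ->
  bounded_operator (fun v => c *: S v + T v).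
Proof.
move=> /bounded_operatorP[S_lin [s s0 hs]] /bounded_operatorP[T_lin [t t0 ht]].
apply/bounded_operatorP; split=> [a x y|].
  rewrite (linear_opP S_lin) (linear_opP S_lin) (linear_opP T_lin) (linear_opP T_lin).
  by rewrite !scalerDr !scalerA [c * a]mulrC -!scalerA addrACA.
exists (rn c * s + t); first by rewrite addr_ge0 // mulr_ge0 ?rn_ge0.
move=> v; apply: le_trans (rn_triangle _ _) _; rewrite mulrDl rnZ -mulrA.
by apply: lerD => //; rewrite ler_wpM2l ?rn_ge0.
Qed.

Lemma bounded_operator_comp S T : bounded_operator S -> bounded_operator T ->
  bounded_operator (fun v => S (T v)).
Proof.
move=> /bounded_operatorP[S_lin [s s0 hs]] /bounded_operatorP[T_lin [t t0 ht]].
apply/bounded_operatorP; split=> [a x y|].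
  by rewrite !(linear_opP T_lin) !(linear_opP S_lin).
exists (s * t); first by rewrite mulr_ge0.
move=> v; apply: le_trans (hs _) _.
by rewrite -mulrA ler_wpM2l.
Qed.

Lemma rep_bounded (L : topGroupType) (pi : unitaryRep R L) x : bounded_operator (pi x).
Proof.
apply/bounded_operatorP; split; first exact: rep_linear.
by exists 1 => // v; rewrite mul1r rn_rep.
Qed.

Lemma rep_mulVK (L : topGroupType) (pi : unitaryRep R L) x v : pi x^-1%g (pi x v) = v.
Proof. by rewrite -repM mulVg rep1. Qed.

Lemma orthogonal_closed (I : Type) (s : I -> H) :
  closed_subspace [set w : H | forall i, hdot w (s i) = 0].
Proof.
split.
- by move=> i; rewrite hdot0l.
- by move=> c x y hx hy i; rewrite hdotDl hdotZl hx hy mulr0 addr0.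
apply: closed_rnP => x hx i; apply: rn_eps => e e0.
have k1 : 0 < rn (s i) + 1 by rewrite ltr_wpDl ?rn_ge0.
have [|y hy xy] := hx (e / (rn (s i) + 1)); first by rewrite divr_gt0.
rewrite -[hdot _ _]subr0 -(hy i) -hdotBl; apply: le_trans (cauchy_schwarz _ _) _.
move: xy; rewrite rn_distC ltr_pdivlMr // => /ltW; apply: le_trans.
by rewrite ler_wpM2l ?rn_ge0 // lerDl.
Qed.

Lemma equalizer_closed S T : bounded_operator S -> bounded_operator T ->
  closed_subspace [set x | S x = T x].
Proof.
move=> bS bT; have := bounded_operator_lin (- 1) bS bT.
move=> /bounded_operatorP[D_lin [c c0 hc]].
have SE x : S x = T x <-> - 1 *: S x + T x = 0.
  rewrite scaleN1r addrC; split=> [->|/eqP]; first by rewrite subrr.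
  by rewrite subr_eq0 => /eqP.
split.
- by apply/SE; exact: (linear_op0 D_lin).
- by move=> a x y /SE hx /SE hy; apply/SE; rewrite D_lin hx hy scaler0 addr0.
apply: closed_rnP => x hx; apply/SE/rn_eps => e e0.
have c1 : 0 < c + 1 by rewrite ltr_wpDl.
have [|y /SE hy xy] := hx (e / (c + 1)); first by rewrite divr_gt0.
rewrite -[X in rn X]subr0 -hy -(linear_opP D_lin); apply: le_trans (hc _) _.
move: xy; rewrite rn_distC ltr_pdivlMr // mulrC => /ltW; apply: le_trans.
by rewrite ler_wpM2r ?rn_ge0 // lerDl.
Qed.

End BoundedOperators.

Section ConjugationAlgebra.
Variables (R : realType) (G : topGroupType) (N : normalSubgroup G).
Local Notation T := (nsubType N).
Variables (A : cstarAlgebra R) (pi : unitaryRep R G).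
Local Notation H := (rep_space pi).
Variable rA : A -> H -> H.
Hypothesis sr : star_rep rA.

(* [pi g rA(a) pi g^-1] stands for the action of [g] on [a], so that the effect of
   conjugation on [mu] never has to be computed. *)
Inductive conj_alg : (H -> H) -> Prop :=
| conj_alg_rep (n : T) : conj_alg (fun v => pi (nsub_val n) v)
| conj_alg_int g a : conj_alg (fun v => pi g (rA a (pi g^-1%g v)))
| conj_alg_lin c S U : conj_alg S -> conj_alg U -> conj_alg (fun v => c *: S v + U v)
| conj_alg_comp S U : conj_alg S -> conj_alg U -> conj_alg (fun v => S (U v))
| conj_alg_lim U (S : nat -> H -> H) : bounded_operator U -> (forall n, conj_alg (S n)) ->
    (forall e : R, 0 < e -> exists n0, forall n, (n0 <= n)%N ->
      forall v, rn (S n v - U v) <= e * rn v) ->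
    conj_alg U.

Let opE (U U' : H -> H) : (forall v, U v = U' v) -> conj_alg U -> conj_alg U'.
Proof. by move=> /funext ->. Qed.

Let alg_bounded U : conj_alg U -> bounded_operator U.
Proof.
elim=> {U} [n|g a|c S U _ bS _ bU|S U _ bS _ bU|] //; first exact: rep_bounded.
- apply: bounded_operator_comp (rep_bounded pi g) _.
  exact: bounded_operator_comp (sr_bounded sr a) (rep_bounded pi _).
- exact: bounded_operator_lin.
- exact: bounded_operator_comp.
Qed.

Let alg_adj U : conj_alg U ->
  exists2 U', conj_alg U' & forall v w, hdot (U v) w = hdot v (U' w).
Proof.
elim=> {U} [n|g a|c S U _ [S' hS' ES] _ [U' hU' EU]|S U _ [S' hS' ES] _ [U' hU' EU]|U S bU _ ih hU].
- exists (fun v => pi (nsub_val n^-1%g) v); first exact: conj_alg_rep.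
  by move=> v w; rewrite rep_adj.
- exists (fun v => pi g (rA (cadj a) (pi g^-1%g v))); first exact: conj_alg_int.
  by move=> v w; rewrite rep_adj (srJr sr) rep_adj invgK.
- exists (fun v => c^*%C *: S' v + U' v); first exact: conj_alg_lin.
  by move=> v w; rewrite hdotDl hdotZl hdotDr hdotZr conjcK ES EU.
- exists (fun v => U' (S' v)); first exact: conj_alg_comp.
  by move=> v w; rewrite ES EU.
have [U' [bU' EU]] := adjoint_exists bU; exists U' => //.
have /choice[S' hS'] : forall n, exists S', conj_alg S' /\
    forall v w, hdot (S n v) w = hdot v (S' w).
  by move=> n; have [S' h1 h2] := ih n; exists S'.
apply: (@conj_alg_lim _ S') => // [n|e e0]; first by case: (hS' n).
have [n0 h0] := hU e e0; exists n0 => n hn.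
apply: (@hdot_bound _ _ (fun v => S' n v - U' v)); first exact: ltW.
move=> x y; have [_ ES] := hS' n.
have -> : hdot (S' n x - U' x) y = (hdot (S n y - U y) x)^*%C.
  by rewrite -hdotC hdotBr hdotBl hdotC -ES [hdot (U' x) y]hdotC -EU -!hdotC.
rewrite rn_conj; apply: le_trans (cauchy_schwarz _ _) _.
by rewrite mulrAC ler_wpM2r ?rn_ge0 // h0.
Qed.

Lemma conj_alg_oca : operator_cstar_algebra conj_alg.
Proof.
split=> //.
- apply: (opE _ (conj_alg_lin (- 1) (conj_alg_rep 1%g) (conj_alg_rep 1%g))) => v.
  by rewrite scaleN1r addNr.
- by move=> c S U; exact: conj_alg_lin.
- by move=> S U; exact: conj_alg_comp.
move=> U bU hU.
have /choice[S hS] : forall n : nat, exists S, conj_alg S /\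
    forall v, rn (S v - U v) <= n.+1%:R^-1 * rn v.
  by move=> n; have [|S h1 h2] := hU n.+1%:R^-1; [rewrite invr_gt0|exists S].
apply: (@conj_alg_lim _ S) => // [n|e e0]; first by case: (hS n).
have [n0 h0] := inv_lt_eps e0; exists n0 => n hn v.
have [_ /(_ v) h] := hS n; apply: le_trans h _.
by rewrite ler_wpM2r ?rn_ge0 // ltW // h0.
Qed.

Let alg_conj g U : conj_alg U -> conj_alg (fun v => pi g (U (pi g^-1%g v))).
Proof.
have pg_lin := @rep_linear _ _ pi g.
elim=> {U} [n|h a|c S U _ hS _ hU|S U _ hS _ hU|U S bU _ ih hU].
- apply: opE (conj_alg_rep (nsub_mk (nsubJ g (nsub_valP n)))) => v.
  by rewrite -!repM.
- apply: opE (conj_alg_int (g * h)%g a) => v.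
  by rewrite invgM !repM.
- by apply: opE (conj_alg_lin c hS hU) => v; rewrite !(linear_opP pg_lin).
- by apply: opE (conj_alg_comp hS hU) => v; rewrite rep_mulVK.
apply: (@conj_alg_lim _ (fun n v => pi g (S n (pi g^-1%g v)))) => //.
  apply: bounded_operator_comp (rep_bounded pi g) _.
  exact: bounded_operator_comp (rep_bounded pi _).
move=> e /hU[n0 h0]; exists n0 => n hn v.
have <- : rn (pi g^-1%g v) = rn v by exact: rn_rep.
rewrite -(linear_opP pg_lin) rn_rep.
exact: h0.
Qed.

(** Presents the algebra abstractly: [u] is the image of N, [j] that of C*(N), and [al] the action
    of G by conjugation. The final clause is induction over [E]: a norm-closed subalgebra containing
    the generators is everything. *)
Lemma conjugation_algebra : exists (E : cstarAlgebra R) (op : E -> H -> H)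
    (u : T -> E) (al : G -> E -> E) (j : A -> E),
  [/\ star_rep op,
    (forall b (c : R), 0 <= c -> (forall v, rn (op b v) <= c * rn v) -> rn b <= c),
    (forall n v, op (u n) v = pi (nsub_val n) v),
    (forall g b v, op (al g b) v = pi g (op b (pi g^-1%g v))) &
    (forall a v, op (j a) v = rA a v)] /\
  forall I : E -> Prop, (forall n, I (u n)) -> (forall g a, I (al g (j a))) ->
    (forall c x y, I x -> I y -> I (c *: x + y)) ->
    (forall x y, I x -> I y -> I (cmul x y)) ->
    (forall w l, (forall n, I (w n)) -> sconv w l -> I l) -> forall b, I b.
Proof.
have [E [op [osr onorm opP]]] := operator_algebra conj_alg_oca.
have inj := op_inj osr onorm.
have /choice[u hu] : forall n : T, exists b, op b = (fun v => pi (nsub_val n) v).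
  by move=> n; apply/opP; exact: conj_alg_rep.
have /choice[al hal] : forall p : G * E, exists b,
    op b = (fun v => pi p.1 (op p.2 (pi p.1^-1%g v))).
  by move=> [g b]; apply/opP; apply: alg_conj; apply/opP; exists b.
have /choice[j hj] : forall a, exists b, op b = rA a.
  move=> a; apply/opP; apply: opE (conj_alg_int 1%g a) => v.
  by rewrite invg1 !rep1.
exists E, op, u, (fun g b => al (g, b)), j; split; first split=> //.
- by move=> n v; rewrite hu.
- by move=> g b v; rewrite hal.
- by move=> a v; rewrite hj.
move=> I Iu Ij Ilin Imul Ilim b.
suff K U : conj_alg U -> forall b, op b = U -> I b.
  by apply: (K (op b)) => //; apply/opP; exists b.
elim=> {b U} [n|g a|c S U hS iS hU iU|S U hS iS hU iU|U S bU hS ih hU] b hb.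
- by rewrite (inj b (u n)) // => v; rewrite hu hb.
- by rewrite (inj b (al (g, j a))) // => v; rewrite hal hb hj.
- have /opP[x xS] := hS; have /opP[y yU] := hU.
  rewrite (inj b (c *: x + y)); first by apply: Ilin; [exact: iS|exact: iU].
  by move=> v; rewrite (srL osr) hb xS yU.
- have /opP[x xS] := hS; have /opP[y yU] := hU.
  rewrite (inj b (cmul x y)); first by apply: Imul; [exact: iS|exact: iU].
  by move=> v; rewrite (srM osr) hb xS yU.
have /choice[w hw] : forall n, exists x, op x = S n by move=> n; apply/opP.
apply: (Ilim w) => [n|e e0]; first exact: ih (hw n).
have e2 : 0 < e / 2 by rewrite divr_gt0.
have [n0 h0] := hU _ e2; exists n0 => n hn.
apply: (@le_lt_trans _ _ (e / 2)); last by rewrite ltr_pdivrMr // ltr_pMr // ltr1n.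
apply: onorm; first exact: ltW.
by move=> v; rewrite (srB osr) hw hb; exact: h0.
Qed.

End ConjugationAlgebra.

Lemma nsub_conj_continuous (G : topGroupType) (N : normalSubgroup G) g :
  continuous (nsub_conj g : nsubType N -> nsubType N).
Proof.
apply: nsub_continuous.
rewrite (_ : _ \o _ = (fun y => (g^-1 * y)%g) \o ((fun y => (y * g)%g) \o @nsub_val G N)); last first.
  by apply/funext => x /=; rewrite nsub_conjE mulgA.
move=> x; apply: continuous_comp; last exact: continuous_mull.
apply: continuous_comp; last exact: continuous_mulr.
exact: nsub_val_continuous.
Qed.

Lemma nsub_conj1 (G : topGroupType) (N : normalSubgroup G) g :
  nsub_conj g (1%g : nsubType N) = 1%g.
Proof. by apply: nsub_val_inj; rewrite nsub_conjE nsub_val1 mulg1 mulVg. Qed.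

Lemma nsub_conjM (G : topGroupType) (N : normalSubgroup G) g h (x : nsubType N) :
  nsub_conj g (nsub_conj h x) = nsub_conj (h * g)%g x.
Proof. by apply: nsub_val_inj; rewrite !nsub_conjE invgM !mulgA. Qed.

Lemma nsub_conj_id (G : topGroupType) (N : normalSubgroup G) (x : nsubType N) :
  nsub_conj 1%g x = x.
Proof. by apply: nsub_val_inj; rewrite nsub_conjE invg1 mul1g mulg1. Qed.

(** * The action of G and the norm-continuous elements *)

Section Dynamics.
Variables (R : realType) (G : topGroupType) (N : normalSubgroup G).
Local Notation T := (nsubType N).
Hypothesis hN : hausdorff_space T.
Variables (mu : haarIntegral R T) (A : groupCstar mu) (pi : unitaryRep R G).
Local Notation H := (rep_space pi).
Local Notation rA := (@integrated_form R T mu A (restriction N pi)).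
Local Notation gc := (gc_emb A).
Variables (E : cstarAlgebra R) (op : E -> H -> H).
Variables (u : T -> E) (al : G -> E -> E) (j : A -> E).
Hypotheses (osr : star_rep op)
  (onorm : forall b (c : R), 0 <= c -> (forall v, rn (op b v) <= c * rn v) -> rn b <= c)
  (opu : forall n v, op (u n) v = pi (nsub_val n) v)
  (opal : forall g b v, op (al g b) v = pi g (op b (pi g^-1%g v)))
  (opj : forall a v, op (j a) v = rA a v)
  (Eind : forall I : E -> Prop, (forall n, I (u n)) -> (forall g a, I (al g (j a))) ->
    (forall c x y, I x -> I y -> I (c *: x + y)) ->
    (forall x y, I x -> I y -> I (cmul x y)) ->
    (forall w l, (forall n, I (w n)) -> sconv w l -> I l) -> forall b, I b).

Let inj := op_inj osr onorm.
Let sr : star_rep rA := integrated_form_star hN A (restriction N pi).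

Lemma u_one b : cmul (u 1%g) b = b.
Proof. by apply: inj => v; rewrite (srM osr) opu nsub_val1 rep1. Qed.

Lemma u_oner b : cmul b (u 1%g) = b.
Proof. by apply: inj => v; rewrite (srM osr) opu nsub_val1 rep1. Qed.

Lemma u_mul m n : u (m * n)%g = cmul (u m) (u n).
Proof. by apply: inj => v; rewrite (srM osr) !opu nsub_valM repM. Qed.

Lemma u_adj n : cadj (u n) = u n^-1%g.
Proof.
apply: inj => v; apply: hdot_inj => w.
have -> : op (u n^-1%g) v = pi (nsub_val n)^-1%g v by rewrite opu.
by rewrite (srJ osr) opu rep_adj invgK.
Qed.

Lemma al_lin g c x y : al g (c *: x + y) = c *: al g x + al g y.
Proof.
apply: inj => v; rewrite opal !(srL osr) !opal.
by rewrite !(linear_opP (@rep_linear _ _ pi g)).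
Qed.

Lemma al_mul g x y : al g (cmul x y) = cmul (al g x) (al g y).
Proof. by apply: inj => v; rewrite opal !(srM osr) !opal rep_mulVK. Qed.

Lemma al_adj g b : al g (cadj b) = cadj (al g b).
Proof.
apply: inj => v; apply: hdot_inj => w.
by rewrite (srJ osr) !opal rep_adj (srJ osr) rep_adj invgK.
Qed.

Lemma al_comp g h b : al g (al h b) = al (g * h)%g b.
Proof. by apply: inj => v; rewrite !opal invgM !repM. Qed.

Lemma al_id b : al 1%g b = b.
Proof. by apply: inj => v; rewrite opal invg1 !rep1. Qed.

Lemma al_sub g x y : al g (x - y) = al g x - al g y.
Proof. by have := al_lin g (- 1) y x; rewrite !scaleN1r addrC [RHS]addrC. Qed.

Let al_le g b : rn (al g b) <= rn b.
Proof.
apply: onorm => [|v]; first exact: rn_ge0.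
rewrite opal rn_rep; apply: le_trans (sr_contractive osr _ _) _.
by rewrite rn_rep.
Qed.

Lemma rn_al g b : rn (al g b) = rn b.
Proof.
apply/eqP; rewrite eq_le al_le /= -{1}[b]al_id -(mulVg g) -al_comp.
exact: al_le.
Qed.

Lemma al_u g n : al g (u n) = u (nsub_conj g^-1%g n).
Proof.
by apply: inj => v; rewrite opal !opu nsub_conjE invgK !repM.
Qed.

Lemma j_lin c x y : j (c *: x + y) = c *: j x + j y.
Proof. by apply: inj => v; rewrite (srL osr) !opj (srL sr). Qed.

Lemma j_sub x y : j (x - y) = j x - j y.
Proof. by have := j_lin (- 1) y x; rewrite !scaleN1r addrC [RHS]addrC. Qed.

Lemma rn_j a : rn (j a) <= rn a.
Proof.
apply: onorm => [|v]; first exact: rn_ge0.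
by rewrite opj; exact: (sr_contractive sr).
Qed.

Lemma rn_u n b : rn (cmul (u n) b) <= rn b.
Proof.
apply: onorm => [|v]; first exact: rn_ge0.
by rewrite (srM osr) opu rn_rep; exact: (sr_contractive osr).
Qed.

(** The map n |-> [u n] itself is not assumed continuous in norm. In any representation of [E], the
    vectors in the range of such a b have continuous orbits under N. *)
Definition norm_continuous (b : E) :=
  forall e : R, 0 < e -> \forall n \near (1%g : T), rn (cmul (u n) b - b) <= e.

Lemma norm_continuous_mulr b x : norm_continuous b -> norm_continuous (cmul b x).
Proof.
move=> hb e e0; have x1 : 0 < rn x + 1 by rewrite ltr_wpDl ?rn_ge0.
have := hb (e / (rn x + 1)); rewrite divr_gt0 // => /(_ isT); apply: filterS => n.
rewrite ler_pdivlMr // => h; rewrite cmulA -cmulBl.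
apply: le_trans (rn_cmul _ _) _; apply: le_trans h.
by rewrite ler_wpM2l ?rn_ge0 // lerDl.
Qed.

Lemma norm_continuous_lin c x y :
  norm_continuous x -> norm_continuous y -> norm_continuous (c *: x + y).
Proof.
move=> hx hy e e0; have c1 : 0 < rn c + 1 by rewrite ltr_wpDl ?rn_ge0.
have := hx (e / 2 / (rn c + 1)); rewrite !divr_gt0 // => /(_ isT) nx.
have := hy (e / 2); rewrite divr_gt0 // => /(_ isT) ny.
near=> n.
have h1 : rn (cmul (u n) x - x) <= e / 2 / (rn c + 1) by near: n.
have h2 : rn (cmul (u n) y - y) <= e / 2 by near: n.
rewrite cmulDr cmulZr opprD addrACA -scalerBr.
apply: le_trans (rn_triangle _ _) _; rewrite rnZ [e]splitr lerD //.
move: h1; rewrite ler_pdivlMr // mulrC; apply: le_trans.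
by rewrite ler_wpM2r ?rn_ge0 // lerDl.
Unshelve. all: by end_near. Qed.

Lemma norm_continuous_lim w l :
  (forall k, norm_continuous (w k)) -> sconv w l -> norm_continuous l.
Proof.
move=> hw wl e e0; have e3 : 0 < e / 3 by rewrite divr_gt0.
have [k0 /(_ k0 (leqnn _))/ltW hk] := wl _ e3.
have := hw k0 _ e3; apply: filterS => n h.
have h1 : rn (cmul (u n) l - cmul (u n) (w k0)) <= e / 3.
  by rewrite -cmulBr; apply: le_trans (rn_u _ _) _; rewrite rn_distC.
apply: (rn_le3 h1 (b := e / 3 + e / 3)); last by lra.
by apply: (rn_le3 h hk); rewrite lexx.
Qed.

Let u_j_gc n f : Cc f -> cmul (u n) (j (gc f)) = j (gc (fun x => f (n^-1 * x)%g)).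
Proof.
move=> cf; apply: inj => v.
have cfn : Cc (fun x => f (n^-1 * x)%g) by exact: Cc_shift.
rewrite (srM osr) opu !opj (integrated_formE hN) // (integrated_formE hN) //.
by rewrite (integrate_shift mu hN).
Qed.

(** For a in [Cc] this is the L^1-continuity of translations, as the C*-norm is at most the
    L^1-norm. *)
Lemma norm_continuous_j a : norm_continuous (j a).
Proof.
have [f cf fa] := gc_seq a.
apply: (@norm_continuous_lim (fun k => j (gc (f k)))); last first.
  by apply: (@sconv_dom _ _ _ _ _ _ _ 1) fa => k; rewrite -j_sub mul1r rn_j.
move=> k e e0; have := mun_translation mu hN (cf k) e0.
apply: filterS => n; apply: le_trans.
have cfn : Cc (fun x => f k (n^-1 * x)%g) by exact: Cc_shift.
rewrite u_j_gc // -j_sub -gc_embB //; apply: le_trans (rn_j _) _.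
exact: (gc_emb_le A (restriction N pi) (Cc_sub2 cfn (cf k))).
Qed.

Lemma norm_continuous_al g b : norm_continuous b -> norm_continuous (al g b).
Proof.
move=> hb e e0.
have nb : nbhs (nsub_conj g (1%g : T)) [set n | rn (cmul (u n) b - b) <= e].
  by rewrite nsub_conj1; exact: hb.
have nb' : nbhs (1%g : T) [set n | rn (cmul (u (nsub_conj g n)) b - b) <= e].
  exact: (@nsub_conj_continuous G N g 1%g _ nb).
apply: filterS nb' => n /= h.
have -> : u n = al g (u (nsub_conj g n)).
  by rewrite al_u nsub_conjM mulgV nsub_conj_id.
by rewrite -al_mul -al_sub rn_al.
Qed.

(** Together with [norm_continuous_mulr], the norm-continuous elements form a two-sided ideal. The
    claim is checked on generators: the conjugates of C*(N) are themselves norm-continuous, and the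
    elements [u m] only conjugate the variable. *)
Lemma norm_continuous_mull x b : norm_continuous b -> norm_continuous (cmul x b).
Proof.
move: b; apply: (Eind (I := fun x => forall b, norm_continuous b -> norm_continuous (cmul x b)));
  move: x => _.
(* u(n) u(m) = u(m) u(m^-1 n m), and m^-1 n m tends to 1 together with n. *)
- move=> m b hb e e0.
  have nb : nbhs (1%g : T) [set n | rn (cmul (u n) b - b) <= e] by exact: hb.
  have nm : nbhs (m^-1 * m)%g [set n | rn (cmul (u n) b - b) <= e] by rewrite mulVg.
  have := @continuous_mulr T m 1%g _; rewrite /continuous_at mul1g => cm.
  have {}nm := cm _ (nbhs_mull nm).
  have {}nb : nbhs (1%g : T) [set n | rn (cmul (u (m^-1 * (n * m))%g) b - b) <= e] by exact: nm.
  apply: filterS nb => n /= h.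
  have -> : cmul (u n) (cmul (u m) b) = cmul (u m) (cmul (u (m^-1 * (n * m))%g) b).
    by rewrite !cmulA -!u_mul !mulgA mulgV mul1g.
  by rewrite -cmulBr; apply: le_trans (rn_u _ _) h.
- move=> g a b _; apply: norm_continuous_mulr; apply: norm_continuous_al.
  exact: norm_continuous_j.
- move=> c x y hx hy b hb; rewrite cmulDl cmulZl.
  by apply: norm_continuous_lin; [exact: hx|exact: hy].
- by move=> x y hx hy b hb; rewrite -cmulA; apply: hx; exact: hy.
move=> w l hw wl b hb.
apply: (@norm_continuous_lim (fun k => cmul (w k) b)); first by move=> k; exact: hw.
apply: (@sconv_dom _ _ _ _ _ _ _ (rn b)) wl => k.
by rewrite -cmulBl mulrC rn_cmul.
Qed.

Lemma norm_continuous_neq0 : (exists x : H, x != 0) ->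
  exists2 d, norm_continuous d & d != 0.
Proof.
move=> [x x0]; have x1 : 0 < rn x.
  by rewrite lt_neqAle rn_ge0 andbT eq_sym; apply: contra_neq x0; exact: rn_eq0.
have x2 : 0 < rn x / 2 by rewrite divr_gt0.
have [f cf [_ hf]] := integrated_form_nondeg hN A (pi := restriction N pi) x x2.
exists (j (gc f)); first exact: norm_continuous_j.
apply/eqP => z; move: hf; rewrite -opj z (sr0 osr) sub0r rnN.
by rewrite leNgt ltr_pdivrMr // ltr_pMr // ltr1n.
Qed.

End Dynamics.

(** * Cut-off elements of a normalized element *)

Section BumpFamily.
Variables (R : realType) (H : hilbertSpace R) (E : cstarAlgebra R) (op : E -> H -> H).
Hypotheses (osr : star_rep op)
  (onorm : forall b (c : R), 0 <= c -> (forall v, rn (op b v) <= c * rn v) -> rn b <= c).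

(** [bump_elements] for t = c/|c|. As t^* t is c^* times something, p and a lie in every closed
    right ideal containing c^*, and whatever fixes c^* from the left fixes p. *)
Lemma normalized_bump (c : E) : c != 0 -> exists p a : E,
  [/\ p != 0, cmul a p = p & rn a <= 1] /\
  [/\ (forall e, cmul e (cadj c) = cadj c -> cmul e p = p),
    (forall I : E -> Prop, (forall x z, I x -> I (cmul x z)) ->
      (forall k x z, I x -> I z -> I (k *: x + z)) ->
      (forall w l, (forall n, I (w n)) -> sconv w l -> I l) ->
      I (cadj c) -> I p /\ I a) &
    forall (K : hilbertSpace R) (rho : E -> K -> K), star_rep rho ->
      (forall d : R, d < 2^-1 ->
        (forall v, rn (rho c v) ^+ 2 <= d * rn c ^+ 2 * rn v ^+ 2) ->
        forall v, rho p v = 0) /\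
      ((forall v, rho c v = 0) -> forall v, rho a v = 0)].
Proof.
move=> c0; have rc : 0 < rn c.
  by rewrite lt_neqAle rn_ge0 andbT eq_sym; apply: contra_neq c0; exact: rn_eq0.
set t := (rn c)^-1%:C%C *: c.
have t1 : rn t = 1.
  by rewrite /t rnZ rn_real ger0_norm ?invr_ge0 ?rn_ge0 // mulVf // gt_eqF.
have [|p [a [[ap a1 hp hI] hrho]]] := bump_elements osr onorm (t := t); first by rewrite t1.
have ttE : cmul (cadj t) t = cmul (cadj c) ((rn c)^-1%:C%C^*%C *: ((rn c)^-1%:C%C *: c)).
  by rewrite /t cadjZ cmulZl !cmulZr.
exists p, a; split; split=> //.
(* p = 0 would give |t|^2 <= 1/2, while t has norm 1. *)
- apply/eqP => p0; have [_ _ h] := hrho _ _ osr.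
  have {}h v : rn (op t v) <= Num.sqrt 2^-1 * rn v.
    rewrite -ler_sqr ?nnegrE ?mulr_ge0 ?sqrtr_ge0 ?rn_ge0 // exprMn sqr_sqrtr ?invr_ge0 //.
    by apply: h => w; rewrite p0 (sr0 osr).
  have := onorm (sqrtr_ge0 _) h; rewrite t1 => h1.
  have : 1 ^+ 2 <= (Num.sqrt 2^-1 : R) ^+ 2 by rewrite ler_sqr ?nnegrE ?sqrtr_ge0.
  by rewrite sqr_sqrtr ?invr_ge0 // expr1n; lra.
- by move=> e he; apply: hp; rewrite ttE cmulA he.
- by move=> I Ir Il Ilim Ic; apply: hI => //; rewrite ttE; exact: Ir.
move=> K rho rsr; have [h1 h2 _] := hrho K rho rsr; split.
  move=> d d1 h; refine (h1 d d1 _) => v.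
  rewrite (srZ rsr) rnZ rn_real ger0_norm ?invr_ge0 ?rn_ge0 // exprMn exprVn.
  by rewrite ler_pdivrMl ?exprn_gt0 // mulrA [rn c ^+ 2 * d]mulrC.
by move=> h; refine (h2 _) => v; rewrite (srZ rsr) h scaler0.
Qed.

End BumpFamily.

(** * Linking elements through the factor condition *)

Section FactorDynamics.
Variables (R : realType) (G : topGroupType) (N : normalSubgroup G).
Local Notation T := (nsubType N).
Hypothesis hN : hausdorff_space T.
Variables (mu : haarIntegral R T) (A : groupCstar mu) (pi : unitaryRep R G).
Local Notation H := (rep_space pi).
Local Notation rA := (@integrated_form R T mu A (restriction N pi)).
Local Notation gc := (gc_emb A).
Variables (E : cstarAlgebra R) (op : E -> H -> H).
Variables (u : T -> E) (al : G -> E -> E) (j : A -> E).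
Hypotheses (osr : star_rep op)
  (onorm : forall b (c : R), 0 <= c -> (forall v, rn (op b v) <= c * rn v) -> rn b <= c)
  (opu : forall n v, op (u n) v = pi (nsub_val n) v)
  (opal : forall g b v, op (al g b) v = pi g (op b (pi g^-1%g v)))
  (opj : forall a v, op (j a) v = rA a v)
  (Eind : forall I : E -> Prop, (forall n, I (u n)) -> (forall g a, I (al g (j a))) ->
    (forall c x y, I x -> I y -> I (c *: x + y)) ->
    (forall x y, I x -> I y -> I (cmul x y)) ->
    (forall w l, (forall n, I (w n)) -> sconv w l -> I l) -> forall b, I b).
Hypothesis pi_factor : factor_rep pi.

Let inj := op_inj osr onorm.
Let sr : star_rep rA := integrated_form_star hN A (restriction N pi).
Local Notation M := (commutant (range (rep_op pi))).

Let commutantE S : M S <-> bounded_operator S /\ forall g v, S (pi g v) = pi g (S v).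
Proof.
split=> [[bS hS]|[bS hS]]; split=> //.
  move=> g v; have := hS (pi g) (ex_intro2 _ _ g I erefl).
  by move=> /(congr1 (fun f => f v)).
by move=> _ [g _ <-]; apply/funext => v; exact: hS.
Qed.

Let commutes_rA S : M S -> forall a v, S (rA a v) = rA a (S v).
Proof.
move=> /commutantE[bS hS].
have [S_lin [c c0 Sc]] := (bounded_operatorP S).1 bS.
apply: (@integrated_form_unique R T mu hN A (restriction N pi) H rA S c) => // f v cf.
have [S' [_ SS']] := adjoint_exists bS.
rewrite (integrated_formE hN) //; apply/esym.
apply: (@integrate_unique R T mu (restriction N pi) f (S v) _ cf) => w.
rewrite SS' (@integrateP R T mu (restriction N pi) f) //; apply: eq_mu => x; congr (_ * _).
by rewrite -SS'; congr hdot; exact: hS.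
Qed.

Lemma commutes_generators (K : hilbertSpace R) (rho : E -> K -> K) (S : K -> K) :
  star_rep rho -> bounded_operator S ->
  (forall n v, S (rho (u n) v) = rho (u n) (S v)) ->
  (forall g a v, S (rho (al g (j a)) v) = rho (al g (j a)) (S v)) ->
  forall b v, S (rho b v) = rho b (S v).
Proof.
move=> rsr bS hu hj; have [S_lin [c c0 Sc]] := (bounded_operatorP S).1 bS.
apply: (Eind (I := fun b => forall v, S (rho b v) = rho b (S v))) => //
  [k x y hx hy v|x y hx hy v|w l hw wl v].
- by rewrite !(srL rsr) -hx -hy !(linear_opP S_lin).
- by rewrite !(srM rsr) hx hy.
apply: (@sconv_unique _ _ (fun k => rho (w k) (S v))); last first.
  apply: (@sconv_dom _ _ _ _ _ _ _ (rn (S v))) wl => k.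
  by rewrite -(srB rsr) mulrC (sr_contractive rsr).
rewrite (_ : (fun k => _) = fun k => S (rho (w k) v)); last by apply/funext => k.
apply: (@sconv_dom _ _ _ _ _ _ _ (c * rn v)) wl => k.
rewrite -(linear_opP S_lin) -(srB rsr); apply: le_trans (Sc _) _.
by rewrite -mulrA ler_wpM2l // mulrC (sr_contractive rsr).
Qed.

Let commutes_op S : M S -> forall b v, op b (S v) = S (op b v).
Proof.
move=> MS b v; have [bS hS] := (commutantE S).1 MS; apply/esym.
apply: (commutes_generators osr bS) => [n w|g a w]; first by rewrite !opu hS.
by rewrite !opal !opj hS commutes_rA // hS.
Qed.

(* The projection onto the orthogonal complement [W] of the span of the ranges of
   the operators [pi g b] is central, hence a scalar. *)
Lemma factor_link d b : d != 0 -> b != 0 -> exists g, cmul d (al g b) != 0.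
Proof.
move=> d0 b0; apply: contrapT => no.
have {}no g : cmul d (al g b) = 0.
  by apply/eqP; apply: contrapT => /negP h; apply: no; exists g.
have {no} db g v : op d (pi g (op b v)) = 0.
  have := congr1 (fun x => op x (pi g v)) (no g).
  by rewrite (srM osr) opal rep_mulVK (sr0 osr).
pose W := [set w : H | forall i : G * H, hdot w (pi i.1 (op b i.2)) = 0].
have cW : closed_subspace W by exact: orthogonal_closed.
have [P [Pproj WP PW]] := projection_exists cW; have [bP PP Psym] := Pproj.
have Wpi g w : W w -> W (pi g w).
  by move=> hw [h v]; rewrite /= rep_adj -repM (hw (_, _)).
have MP : M P.
  apply/commutantE; split=> // g v.
  apply: (@projection_commutes R H W P (pi g) (pi g^-1%g)) => //; last exact: Wpi.
  - by move=> x y; rewrite rep_adj.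
  - exact: Wpi.
(* Operators of the commutant commute with pi(G) and with [op b], and so do their adjoints; hence
   they leave [W] invariant. *)
have MMP : commutant M P.
  split=> // S MS; have [bS hS] := (commutantE S).1 MS.
  have [S' [bS' SS']] := adjoint_exists bS.
  have MS' : M S'.
    apply/commutantE; split=> // g v; apply: hdot_inj => w.
    rewrite hdotC -SS' rep_adj [RHS]hdotC; congr (_^*%C).
    by rewrite -SS' hS rep_adj invgK.
  have WS w : W w -> W (S w).
    move=> hw [g v]; have [_ hS'] := (commutantE S').1 MS'.
    by rewrite /= SS' hS' -(commutes_op MS') (hw (_, _)).
  have WS' w : W w -> W (S' w).
    move=> hw [g v].
    by rewrite /= hdotC -SS' hS -(commutes_op MS) -hdotC (hw (_, _)).
  apply/funext => v /=.
  exact: (@projection_commutes R H W P S S').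
have [_ cen] := pi_factor.
have : center (generated_algebra (pi := pi)) P.
  split; first exact: MMP.
  split=> // S hS; have [_ /(_ P MP)] := hS.
  by move=> ->.
rewrite cen => -[c hc].
(* The projection is a scalar c. If c = 0, then [W] is zero; otherwise [W] is the whole space, which
   makes b orthogonal to itself. *)
have W0 w : W w -> w = 0.
  move=> Ww; have [c0|c0] := eqVneq c 0.
    by rewrite -(PW w Ww) hc c0 scale0r.
  have Wall x : W x.
    have := WP (c^-1 *: x); rewrite hc scalerA divff // scale1r; exact.
  have : b = 0.
    apply: inj => v; rewrite (sr0 osr); apply: hdot_eq0.
    by have := Wall (op b v) (1%g, v); rewrite rep1.
  by move=> /eqP; rewrite (negbTE b0).
move: d0 => /eqP; apply; rewrite -[d]cadjK.
suff -> : cadj d = 0 by rewrite cadj0.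
(* Since d pi(g) b = 0 for all g, the range of d^* lies in [W]. *)
apply: inj => v; rewrite (sr0 osr); apply: W0 => -[g w].
by rewrite /= (srJ osr) db hdot0r.
Qed.

Local Notation ncont := (norm_continuous u).

Let al_star g (K : hilbertSpace R) (rho : E -> K -> K) : star_rep rho ->
  star_rep (fun b => rho (al g b)).
Proof.
move=> rsr; split=> [b|c x y v|x y v|x v w].
- exact: (sr_bounded rsr).
- by rewrite (al_lin osr onorm opal) (srL rsr).
- by rewrite (al_mul osr onorm opal) (srM rsr).
- by rewrite (al_adj osr onorm opal) (srJ rsr).
Qed.

(** With q a cut-off element of c, the factor condition gives g such that x = d al_g(q) is nonzero;
    d' and a are the cut-off elements of x^*. What fixes d fixes x and hence d'. A representation
    small on the conjugate al_g(c) kills al_g(q), so x^*, so a. *)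
Let step (c d : E) : d != 0 -> ncont d -> exists d' a,
  [/\ d' != 0, ncont d', ncont a, cmul a d' = d' & rn a <= 1] /\
  (forall e, cmul e d = d -> cmul e d' = d') /\
  (c != 0 -> exists g, forall (K : hilbertSpace R) (rho : E -> K -> K), star_rep rho ->
    forall r : R, r < 2^-1 ->
    (forall v, rn (rho (al g c) v) ^+ 2 <= r * rn c ^+ 2 * rn v ^+ 2) ->
    forall v, rho a v = 0).
Proof.
move=> d0 nd.
have bump x : x != 0 -> ncont x -> exists p a,
    [/\ p != 0, ncont p, ncont a, cmul a p = p & rn a <= 1] /\
    [/\ (forall e, cmul e x = x -> cmul e p = p) &
      forall (K : hilbertSpace R) (rho : E -> K -> K), star_rep rho ->
      (forall v, rho (cadj x) v = 0) -> forall v, rho a v = 0].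
  move=> x0 nx; have xJ0 : cadj x != 0.
    by apply: contra_neq x0 => h; rewrite -[x]cadjK h cadj0.
  have [p [a [[p0 ap a1] [hp hI hrho]]]] := normalized_bump osr onorm xJ0.
  have [np na] : ncont p /\ ncont a.
    apply: hI.
    - exact: norm_continuous_mulr.
    - exact: norm_continuous_lin.
    - by move=> w l; exact: (norm_continuous_lim osr onorm opu).
    - by rewrite cadjK.
  exists p, a; split=> //; split=> [e he|K rho rsr].
    by apply: hp; rewrite cadjK.
  by have [_] := hrho K rho rsr.
(* For c = 0 there is no condition to impose, and the chain is continued from d itself. *)
have [c0|c0] := eqVneq c 0.
  by have [p [a [h1 [h2 _]]]] := bump d d0 nd; exists p, a.
have [q [qa [[q0 _ _] [_ _ hq]]]] := normalized_bump osr onorm c0.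
have [g r0] := factor_link d0 q0.
have [||p [a [h1 [h2 h3]]]] := bump (cmul d (al g q)) => //.
  exact: norm_continuous_mulr.
exists p, a; split=> //; split=> [e he|_]; first by apply: h2; rewrite cmulA he.
exists g => K rho rsr r r1 small; apply: (h3 K rho rsr).
have [/(_ r r1 small) hq0 _] := hq K _ (al_star g rsr).
move=> v; apply: hdot_inj => w; rewrite (srJ rsr) (srM rsr) hq0 (srv0 rsr).
by rewrite hdot0l hdot0r.
Qed.

(** Iterating [step] gives nonzero d_n such that a_0, ..., a_n all fix d_(n+1), hence fix a unit
    vector in its range. This is the input of [irreducible_rep_exists], whose representation kills
    no a_n. *)
Lemma spread_irreducible_rep (c_ : nat -> E) :
  exists (K : hilbertSpace R) (rho : E -> K -> K),
  [/\ star_rep rho, irreducible_operators (range rho), (forall v, rho (u 1%g) v = v),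
    (exists2 b, ncont b & exists v, rho b v != 0) &
    forall n, c_ n != 0 -> exists g, forall r : R, r < 2^-1 ->
      ~ forall v, rn (rho (al g (c_ n)) v) ^+ 2 <= r * rn (c_ n) ^+ 2 * rn v ^+ 2].
Proof.
have [nzH _] := pi_factor.
have [dd ndd dd0] := norm_continuous_neq0 hN osr onorm opu opj nzH.
have /choice[F hF] : forall q : nat * E, exists p : E * E, q.2 != 0 -> ncont q.2 ->
  [/\ p.1 != 0, ncont p.1, ncont p.2, cmul p.2 p.1 = p.1 & rn p.2 <= 1] /\
  (forall e, cmul e q.2 = q.2 -> cmul e p.1 = p.1) /\
  (c_ q.1 != 0 -> exists g, forall (K : hilbertSpace R) (rho : E -> K -> K), star_rep rho ->
    forall r : R, r < 2^-1 ->
    (forall v, rn (rho (al g (c_ q.1)) v) ^+ 2 <= r * rn (c_ q.1) ^+ 2 * rn v ^+ 2) ->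
    forall v, rho p.2 v = 0).
  move=> [n d] /=; have [[d0 nd]|h] := pselect (d != 0 /\ ncont d).
    by have [d' [a h]] := step (c_ n) d0 nd; exists (d', a).
  (* A dummy value outside the domain of [step]. *)
  by exists (0, 0) => d0 nd; case: h.
pose d_ := fix f n := if n is m.+1 then (F (m, f m)).1 else dd.
have hd n : d_ n != 0 /\ ncont (d_ n).
  elim: n => [|n [h1 h2]] //=.
  by have [[]] := hF (n, d_ n) h1 h2.
pose a_ n := (F (n, d_ n)).2.
have ha n := hF (n, d_ n) (hd n).1 (hd n).2.
have fixd n k : (k <= n)%N -> cmul (a_ k) (d_ n.+1) = d_ n.+1.
  elim: n => [|n ih]; rewrite leq_eqVlt => /orP[/eqP ->|].
  - by case: (ha 0%N) => -[].
  - by [].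
  - by case: (ha n.+1) => -[].
  - by rewrite ltnS => /ih; case: (ha n.+1) => _ [h _]; exact: h.
have fixv n : exists w, rn w = 1 /\ forall k, (k <= n)%N -> op (a_ k) w = w.
  have [v v0] : exists v, op (d_ n.+1) v != 0.
    apply: contrapT => no; have [/eqP + _] := hd n.+1; apply; apply: inj => v.
    by rewrite (sr0 osr); apply/eqP; apply: contrapT => /negP h; apply: no; exists v.
  have r0 : rn (op (d_ n.+1) v) != 0 by apply: contra_neq v0; exact: rn_eq0.
  exists (op (d_ n.+1) ((rn (op (d_ n.+1) v))^-1%:C%C *: v)); split=> [|k kn].
    by rewrite (srvZ osr) rnZ rn_real ger0_norm ?invr_ge0 ?rn_ge0 // mulVf.
  by rewrite -(srM osr) fixd.
have a1 n : rn (a_ n) <= 1 by case: (ha n) => -[].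
have op1 v : op (u 1%g) v = v by rewrite opu nsub_val1 rep1.
have [K [rho [rsr irr rho1 rhoa]]] := irreducible_rep_exists
  (u_one osr onorm opu) (u_oner osr onorm opu) osr op1 a1 fixv.
exists K, rho; split=> //.
  (* [a_ 0] is norm-continuous and not killed, which is what makes the restriction of rho to N
     continuous. *)
  by exists (a_ 0%N); [case: (ha 0%N) => -[]|exact: rhoa].
move=> n cn; have [_ [_ /(_ cn)[g hg]]] := ha n; exists g => r r1 small.
have [v /eqP] := rhoa n; apply.
exact: (hg K rho rsr r r1 small).
Qed.

End FactorDynamics.

Lemma unitary_equiv_conj (R : realType) (G : topGroupType) (N : normalSubgroup G) g
    (s t : unitaryRep R (nsubType N)) :
  unitary_equiv s t -> unitary_equiv (conj_rep g s) (conj_rep g t).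
Proof. by move=> [U [h1 h2 h3 h4]]; exists U; split=> // x v; exact: h4. Qed.

(** * The representation of N carried by rho *)

Section SpreadRep.
Variables (R : realType) (G : topGroupType) (N : normalSubgroup G).
Local Notation T := (nsubType N).
Hypothesis hN : hausdorff_space T.
Variables (mu : haarIntegral R T) (A : groupCstar mu) (pi : unitaryRep R G).
Local Notation H := (rep_space pi).
Local Notation rA := (@integrated_form R T mu A (restriction N pi)).
Local Notation gc := (gc_emb A).
Variables (E : cstarAlgebra R) (op : E -> H -> H).
Variables (u : T -> E) (al : G -> E -> E) (j : A -> E).
Hypotheses (osr : star_rep op)
  (onorm : forall b (c : R), 0 <= c -> (forall v, rn (op b v) <= c * rn v) -> rn b <= c)
  (opu : forall n v, op (u n) v = pi (nsub_val n) v)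
  (opal : forall g b v, op (al g b) v = pi g (op b (pi g^-1%g v)))
  (opj : forall a v, op (j a) v = rA a v)
  (Eind : forall I : E -> Prop, (forall n, I (u n)) -> (forall g a, I (al g (j a))) ->
    (forall c x y, I x -> I y -> I (c *: x + y)) ->
    (forall x y, I x -> I y -> I (cmul x y)) ->
    (forall w l, (forall n, I (w n)) -> sconv w l -> I l) -> forall b, I b).
Variables (K : hilbertSpace R) (rho : E -> K -> K).
Local Notation ncont := (norm_continuous u).
Hypotheses (rsr : star_rep rho) (irr : irreducible_operators (range rho))
  (rho1 : forall v, rho (u 1%g) v = v)
  (rho_ncont : exists2 b, ncont b & exists v, rho b v != 0).

Let sr : star_rep rA := integrated_form_star hN A (restriction N pi).
Let inj := op_inj osr onorm.

(** The orthogonal complement of the vectors rho(b) x with b norm-continuous is invariant, because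
    these b form a left ideal; it is not the whole space, so irreducibility makes it zero. *)
Let total (V : set K) : closed_subspace V ->
  (forall b x, ncont b -> V (rho b x)) -> forall y, V y.
Proof.
move=> cV hV.
pose I := ({b : E | ncont b} * K)%type.
pose s (i : I) := rho (projT1 i.1) i.2.
have cY := orthogonal_closed s; set Y := [set w : K | _] in cY.
have Y0 y : Y y -> y = 0.
  have [|Y0|YT] := irr.2 Y cY; last first.
  - have [b nb [v]] := rho_ncont; move=> /eqP nz _; case: nz.
    apply: hdot_eq0.
    have : Y (rho b v) by rewrite YT.
    by move=> /(_ (exist _ b nb, v)).
  - by rewrite Y0.
  move=> _ z [c _ <-] hz [[b nb] x]; rewrite /s /= (srJr rsr) -(srM rsr).
  have nb' : ncont (cmul (cadj c) b).
    exact: (norm_continuous_mull hN osr onorm opu opal opj Eind).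
  exact: (hz (exist _ _ nb', x)).
have [P [[bP PP Psym] VP PV]] := projection_exists cV => y.
suff -> : y = P y by [].
apply/eqP; rewrite -subr_eq0; apply/eqP/Y0 => -[[b nb] x]; rewrite /s /=.
by rewrite hdotBl Psym (PV _ (hV _ _ nb)) subrr.
Qed.

Let s_op (n : T) : K -> K := rho (u n).
Let s_unitary n v w : hdot (s_op n v) (s_op n w) = hdot v w.
Proof.
rewrite /s_op (srJr rsr) -(srM rsr) (u_adj osr onorm opu) -(u_mul osr onorm opu).
by rewrite mulVg rho1.
Qed.
Let s_mul m n v : s_op (m * n)%g v = s_op m (s_op n v).
Proof. by rewrite /s_op (u_mul osr onorm opu) (srM rsr). Qed.
Let s_rn n v : rn (s_op n v) = rn v.
Proof.
by apply/eqP; rewrite -(@eqrXn2 _ 2) ?rn_ge0 //; apply/eqP; rewrite !rn_sqE s_unitary.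
Qed.

(** The vectors with a continuous orbit at 1 form a closed subspace that contains rho(b) x for
    norm-continuous b; by [total] it is everything. *)
Let s_near (v : K) (e : R) : 0 < e -> \forall n \near (1%g : T), rn (s_op n v - v) <= e.
Proof.
pose V := [set v : K | forall e : R, 0 < e ->
  \forall n \near (1%g : T), rn (s_op n v - v) <= e].
suff : V v by move=> /(_ e).
apply: total => [|b x nb {}e e0]; last first.
  have x1 : 0 < rn x + 1 by rewrite ltr_wpDl ?rn_ge0.
  have := nb (e / (rn x + 1)); rewrite divr_gt0 // => /(_ isT); apply: filterS => n.
  rewrite ler_pdivlMr // => h; rewrite /s_op -(srM rsr) -(srB rsr).
  apply: le_trans (sr_contractive rsr _ _) _; apply: le_trans h.
  by rewrite ler_wpM2l ?rn_ge0 // lerDl.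
split.
- move=> {}e e0; apply: filterS filterT => n _.
  by rewrite /s_op (srv0 rsr) subrr rn0 ltW.
- move=> c x y hx hy {}e e0; have c1 : 0 < rn c + 1 by rewrite ltr_wpDl ?rn_ge0.
  have := hx (e / 2 / (rn c + 1)); rewrite !divr_gt0 // => /(_ isT) nx.
  have := hy (e / 2); rewrite divr_gt0 // => /(_ isT).
  apply: filterS2 nx => n h1 h2.
  rewrite /s_op (sr_lin rsr) opprD addrACA -scalerBr.
  apply: le_trans (rn_triangle _ _) _; rewrite rnZ [e]splitr lerD //.
  move: h1; rewrite ler_pdivlMr // mulrC; apply: le_trans.
  by rewrite ler_wpM2r ?rn_ge0 // lerDl.
apply: closed_rnP => x hx {}e e0; have e3 : 0 < e / 3 by rewrite divr_gt0.
have [y hy /ltW xy] := hx _ e3; have := hy _ e3; apply: filterS => n h.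
have h1 : rn (s_op n x - s_op n y) <= e / 3.
  by rewrite /s_op -(srvB rsr) -/(s_op n _) s_rn rn_distC.
apply: (rn_le3 h1 (b := e / 3 + e / 3)); last by lra.
by apply: (rn_le3 h xy); rewrite lexx.
Qed.

Let s_cont v : continuous (fun n => s_op n v).
Proof.
apply/continuous_rnP => m e e0; have e2 : 0 < e / 2 by rewrite divr_gt0.
have nb : nbhs (m^-1 * m)%g [set n | rn (s_op n v - v) <= e / 2].
  by rewrite mulVg; exact: s_near.
apply: filterS (nbhs_mull nb) => n /= h.
have -> : s_op n v = s_op m (s_op (m^-1 * n)%g v) by rewrite -s_mul mulgA mulgV mul1g.
rewrite /s_op -(srvB rsr) -/(s_op m _) s_rn; apply: le_lt_trans h _.
by rewrite ltr_pdivrMr // ltr_pMr // ltr1n.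
Qed.

Let sigma : unitaryRep R T :=
  UnitaryRep (fun n => sr_lin rsr (u n)) rho1 s_mul s_unitary s_cont.

Let nbhs_orbit g b (e : R) (m : T) : ncont b -> 0 < e ->
  nbhs m [set n : T | rn (cmul (u (nsub_conj g n)) b - cmul (u (nsub_conj g m)) b) <= e].
Proof.
move=> nb e0; set m' := nsub_conj g m.
have nb1 : nbhs (m'^-1 * m')%g [set n | rn (cmul (u n) b - b) <= e].
  by rewrite mulVg; exact: nb.
have := @nsub_conj_continuous G N g m _ (nbhs_mull nb1).
rewrite /= => nb2.
have {}nb2 : nbhs m [set n : T | rn (cmul (u (m'^-1 * nsub_conj g n)%g) b - b) <= e].
  exact: nb2.
apply: filterS nb2 => n /= h.
have -> : u (nsub_conj g n) = cmul (u m') (u (m'^-1 * nsub_conj g n)%g).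
  by rewrite -(u_mul osr onorm opu) mulgA mulgV mul1g.
by rewrite -cmulA -cmulBr; apply: le_trans (rn_u osr onorm opu _ _) h.
Qed.

Section Riemann.
Variables (g : G) (b : E) (nb : ncont b) (f : T -> R[i]) (cf : Cc f).
Let k (n : T) := u (nsub_conj g n).

(** The sum is chosen before the representation [th]. Taken for [op] it approximates an element of
    [E] in norm; taken for [rho] it approximates the integral of a conjugate of [sigma]. *)
Let riemann_rep (e : R) : 0 < e -> exists s : seq (R[i] * T),
  forall (pi' : unitaryRep R T) (th : E -> rep_space pi' -> rep_space pi'),
    star_rep th -> (forall n v, pi' n v = th (k n) v) ->
    forall v w,
      rn (hdot (integrate mu f (th b v)) w -
          hdot (th (cmul (\sum_(p <- s) p.1 *: k p.2) b) v) w)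
        <= e * rn v * rn w * mun mu f.
Proof.
move=> e0.
have [s [_ hs]] := riemann mu hN cf (fun m => nbhs_orbit g m nb e0).
exists s => pi' th tsr hth v w; rewrite integrateP //.
have -> : hdot (th (cmul (\sum_(p <- s) p.1 *: k p.2) b) v) w =
    \sum_(p <- s) p.1 * hdot (pi' p.2 (th b v)) w.
  rewrite (srM tsr); elim: (s) => [|p s' ih].
    by rewrite !big_nil (sr0 tsr) hdot0l.
  by rewrite !big_cons (srL tsr) hdotDl hdotZl ih hth.
apply: hs.
- by rewrite !mulr_ge0 ?rn_ge0 // ltW.
- exact: continuous_matrix_coef.
move=> m n /= h; rewrite -hdotBl !hth -!(srM tsr) -(srB tsr).
apply: le_trans (cauchy_schwarz _ _) _; rewrite ler_wpM2r ?rn_ge0 //.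
apply: le_trans (sr_contractive tsr _ _) _.
by rewrite ler_wpM2r ?rn_ge0.
Qed.

Let Tf := al g^-1%g (j (gc f)).

(** The element [Tf] of [E] acts on [H] as the integral of f for the conjugated restriction, without
    any computation of how conjugation changes [mu]. *)
Let op_Tf v : op Tf v = @integrate R T mu (conj_rep g (restriction N pi)) f v.
Proof.
apply/esym; apply: (@integrate_unique R T mu (conj_rep g (restriction N pi)) f v _ cf) => w.
have adj (x y : H) : hdot (pi g^-1%g x) y = hdot x (pi g y) by rewrite rep_adj invgK.
rewrite /Tf opal opj (integrated_formE hN) // invgK.
apply: etrans (adj _ _) _.
apply: etrans (@integrateP R T mu (restriction N pi) f _ _ cf) _.
apply: eq_mu => n; congr (_ * _); apply: etrans (esym (adj _ _)) _.
have E1 : pi g^-1%g (pi (nsub_val n) (pi g v)) = pi (nsub_val (nsub_conj g n)) v.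
  by rewrite nsub_conjE !repM.
exact: (congr1 (fun z => hdot z w) E1).
Qed.

(** rho is only known to respect norm limits in [E]. Multiplied by the norm-continuous b, the
    Riemann sums converge to [Tf] times b in norm, so rho carries this integral to the one for
    [sigma]. *)
Lemma integrate_sigma_ncont z : rho Tf (rho b z) =
  @integrate R T mu (conj_rep g sigma) f (rho b z).
Proof.
apply: hdot_inj => w; apply/eqP; rewrite -subr_eq0; apply/eqP/rn_eps => e e0.
set M := rn z * rn w * mun mu f + 1.
have M0 : 0 < M by rewrite ltr_wpDl // !mulr_ge0 ?rn_ge0 ?mun_ge0.
have d0 : 0 < e / M / 2 by rewrite !divr_gt0.
set d := e / M / 2 in d0.
have [s hs] := riemann_rep d0.
set S := \sum_(p <- s) p.1 *: k p.2 in hs.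
have h1 : rn (cmul Tf b - cmul S b) <= d * mun mu f.
  apply: onorm => [|v]; first by rewrite mulr_ge0 ?mun_ge0 ?ltW.
  apply: (@hdot_bound _ _ (op (cmul Tf b - cmul S b))).
    by rewrite mulr_ge0 ?mun_ge0 ?ltW.
  move=> x y; rewrite (srB osr) hdotBl (srM osr Tf) op_Tf.
  have := hs (conj_rep g (restriction N pi)) op osr _ x y.
  rewrite mulrAC [X in X * _]mulrAC; apply=> n v'.
  by rewrite /k opu.
have h2 := hs (conj_rep g sigma) rho rsr (fun _ _ => erefl) z w.
rewrite -rnN opprB.
have h3 : rn (hdot (rho (cmul S b) z) w - hdot (rho Tf (rho b z)) w)
    <= d * mun mu f * rn z * rn w.
  rewrite -hdotBl -(srM rsr Tf) -(srB rsr).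
  apply: le_trans (cauchy_schwarz _ _) _; rewrite ler_wpM2r ?rn_ge0 //.
  apply: le_trans (sr_contractive rsr _ _) _.
  by rewrite ler_wpM2r ?rn_ge0 // rn_distC.
apply: (rn_le3 h2 h3).
have -> : d * rn z * rn w * mun mu f + d * mun mu f * rn z * rn w =
    e / M * (rn z * rn w * mun mu f).
  by rewrite /d; field; rewrite gt_eqF.
rewrite mulrAC ler_pdivrMr //; apply: ler_wpM2l; first exact: ltW.
by rewrite /M lerDl.
Qed.

End Riemann.

Let al_j_star g : star_rep (fun a v => rho (al g (j a)) v).
Proof.
have jM x y : j (cmul x y) = cmul (j x) (j y).
  by apply: inj => v; rewrite (srM osr) !opj (srM sr).
have jJ x : j (cadj x) = cadj (j x).
  apply: inj => v; apply: hdot_inj => w.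
  by rewrite (srJ osr) !opj (srJ sr).
split=> [a|c x y v|x y v|x v w].
- exact: (sr_bounded rsr).
- by rewrite (j_lin hN osr onorm opj) (al_lin osr onorm opal) (srL rsr).
- by rewrite jM (al_mul osr onorm opal) (srM rsr).
- by rewrite jJ (al_adj osr onorm opal) (srJ rsr).
Qed.

Let integrate_sigma g f x : Cc f ->
  @integrate R T mu (conj_rep g sigma) f x = rho (al g^-1%g (j (gc f))) x.
Proof.
move=> cf.
have := @total [set x | @integrate R T mu (conj_rep g sigma) f x = rho (al g^-1%g (j (gc f))) x].
apply.
  apply: equalizer_closed; last exact: (sr_bounded rsr).
  exact: (@integrate_bounded R T mu (conj_rep g sigma) f cf).
by move=> b z nb; exact/esym/integrate_sigma_ncont.
Qed.

Let integrated_sigma g a (x : K) :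
  @integrated_form R T mu A (conj_rep g sigma) a x = rho (al g^-1%g (j a)) x.
Proof.
apply: (@integrated_form_unique R T mu hN A (conj_rep g sigma) K
  (fun a v => rho (al g^-1%g (j a)) v) id 1 (al_j_star g^-1%g)) => //.
- by move=> v; rewrite mul1r.
- by move=> f v cf; exact: integrate_sigma.
Qed.

(** The projection onto a subspace invariant under N commutes with the integrals of all conjugates
    of [sigma], thus with all generators of [E]. *)
Lemma sigma_irreducible : irreducible_operators (range (rep_op sigma)).
Proof.
split=> [|V cV sV]; first by have [] := irr.
have [P [[bP PP Psym] VP PV]] := projection_exists cV.
have Pu n v : P (rho (u n) v) = rho (u n) (P v).
  apply: (@projection_commutes _ K V P (rho (u n)) (rho (u n^-1%g))) => //.
  - by move=> x y; rewrite (srJr rsr) (u_adj osr onorm opu).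
  - by move=> x; apply: sV; exists n.
  - by move=> x; apply: sV; exists n^-1%g.
have Pj g a v : P (rho (al g (j a)) v) = rho (al g (j a)) (P v).
  rewrite -[g]invgK -!integrated_sigma.
  have [P_lin [c c0 Pc]] := (bounded_operatorP P).1 bP.
  apply: (@integrated_form_unique R T mu hN A (conj_rep g^-1%g sigma) K
    (@integrated_form R T mu A (conj_rep g^-1%g sigma)) P c) => //.
    exact: (integrated_form_star hN A (conj_rep g^-1%g sigma)).
  move=> f w cf; rewrite (integrated_formE hN) //; apply/esym.
  apply: (@integrate_unique R T mu (conj_rep g^-1%g sigma) f _ _ cf) => y.
  rewrite Psym (@integrateP R T mu (conj_rep g^-1%g sigma) f) //.
  apply: eq_mu => n; congr (_ * _); rewrite -Psym; congr hdot.
  exact: Pu.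
apply: irr.2 => // _ x [b _ <-] Vx.
rewrite -(PV x Vx) -(commutes_generators Eind rsr bP Pu Pj); exact: VP.
Qed.

Lemma cker_conj_spread_rep : exists s : irrep R T, forall g a,
  cker A (conj_rep g s) a <-> forall x, rho (al g^-1%g (j a)) x = 0.
Proof.
exists (Irrep sigma_irreducible) => g a.
by split=> h x; have := h x; rewrite integrated_sigma.
Qed.

End SpreadRep.

(** * Orbits *)

Section ExistenceOfOrbit.
Variables (R : realType) (G : topGroupType) (N : normalSubgroup G).
Local Notation T := (nsubType N).
Hypotheses (hN : hausdorff_space T) (N2 : @second_countable T).
Variables (mu : haarIntegral R T) (A : groupCstar mu).

Lemma dual_ker_act g (s : irrep R T) :
  dual_ker A (dual_act g (dual_class s)) = cker A (conj_rep g s).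
Proof.
rewrite (dual_ker_class hN); apply/esym/(cker_unitary_equiv hN).
exact/unitary_equiv_conj/dual_repr_class.
Qed.

(** The kernel of pi on C*(N) is the kernel of [j], which gives one inclusion. For the other, an a
    with j(a) nonzero in all the kernels would force rho to be small on every conjugate of some c_n
    near j(a). *)
Lemma exists_orbit (pi : unitaryRep R G) : factor_rep pi -> exists c : dual R T,
  cker A (restriction N pi) = \bigcap_(g in [set: G]) dual_ker A (dual_act g c).
Proof.
move=> pi_factor; have sr := integrated_form_star hN A (restriction N pi).
have [E [op [u [al [j [[osr onorm opu opal opj] Eind]]]]]] :=
  @conjugation_algebra R G N A pi _ sr.
have [f_ [Cf_ f_dense]] := Cc_separable mu hN N2.
pose c_ n := j (gc_emb A (f_ n)).
have [K [rho [rsr irr rho1 rhon spread]]] :=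
  spread_irreducible_rep hN osr onorm opu opal opj Eind pi_factor c_.
have [s hs] :=
  cker_conj_spread_rep hN osr onorm opu opal opj Eind rsr irr rho1 rhon.
have inj := op_inj osr onorm.
have rho_le g b v : rn (rho (al g b) v) <= rn b * rn v.
  by rewrite -(rn_al osr onorm opal g b) (sr_contractive rsr).
exists (dual_class s); apply/seteqP; split=> [a ka g _|a ka].
  rewrite dual_ker_act; apply/hs => x.
  have -> : j a = 0 by apply: inj => v; rewrite opj (sr0 osr); exact: ka.
  apply: rn_eq0; apply/eqP; rewrite eq_le rn_ge0 andbT.
  by have := rho_le g^-1%g 0 x; rewrite rn0 mul0r.
have {}ka g x : rho (al g (j a)) x = 0.
  by move: x; rewrite -[g]invgK; apply/hs; rewrite -dual_ker_act; exact: ka.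
suff ja0 : j a = 0 by move=> v; rewrite -opj ja0 (sr0 osr).
apply: contrapT => /eqP ja0; set m := rn (j a).
have m0 : 0 < m.
  by rewrite lt_neqAle rn_ge0 andbT eq_sym; apply: contra_neq ja0; exact: rn_eq0.
(* Two errors of m/8 give |j(a) - c_n| <= m/4 and |c_n| >= 3m/4, so rho is at most |c_n|/3 on the
   conjugates of c_n. The square of the ratio, 1/9, is below the threshold 1/2. *)
have m8 : 0 < m / 8 by rewrite divr_gt0.
have [f cf fa] := gc_dense a m8.
have [n hn] := f_dense f _ cf m8.
have near_c : rn (j a - c_ n) <= m / 4.
  rewrite /c_ -(j_sub hN osr onorm opj).
  apply: le_trans (rn_j hN onorm opj _) _.
  apply: (rn_le3 (ltW fa) (b := m / 8)); last by lra.
  rewrite -gc_embB //.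
  exact: le_trans (gc_emb_le A (restriction N pi) (Cc_sub2 cf (Cf_ n))) hn.
have c_big : 3 / 4 * m <= rn (c_ n).
  have := rn_tri3 (j a) (c_ n) 0; rewrite !subr0 -/m.
  by move: near_c; move: (rn _) (rn _) => x y; lra.
have c0 : c_ n != 0.
  by apply/eqP => z; move: c_big; rewrite z rn0; move: m0; lra.
have [g /(_ 9^-1)] := spread n c0; apply; first by lra.
move=> v; have -> : rho (al g (c_ n)) v = rho (al g (c_ n - j a)) v.
  by rewrite (al_sub osr onorm opal) (srB rsr) ka subr0.
rewrite (_ : 9^-1 = 3^-1 ^+ 2 :> R); last by rewrite exprVn -natrX.
rewrite -!exprMn ler_sqr ?nnegrE ?mulr_ge0 ?rn_ge0 //.
apply: le_trans (rho_le _ _ _) _; rewrite ler_wpM2r ?rn_ge0 // rn_distC.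
by move: near_c c_big m0; move: (rn _) (rn _) => x y; lra.
Qed.

End ExistenceOfOrbit.

(** * Orbits in the dual and uniqueness *)

Section DualOrbits.
Variables (R : realType).

Lemma unitary_equiv_sym (L : topGroupType) (s t : unitaryRep R L) :
  unitary_equiv s t -> unitary_equiv t s.
Proof.
move=> [U [U_lin Uiso /choice[V VK] Uint]].
have U_inj x y : U x = U y -> x = y.
  by move=> E; apply: hdot_inj => z; rewrite -Uiso E Uiso.
exists V; split.
- by move=> c x y; apply: U_inj; rewrite U_lin !VK.
- by move=> v w; rewrite -Uiso !VK.
- by move=> w; exists (U w); apply: U_inj; rewrite VK.
- by move=> x v; apply: U_inj; rewrite Uint !VK.
Qed.

Lemma unitary_equiv_trans (L : topGroupType) (r s t : unitaryRep R L) :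
  unitary_equiv r s -> unitary_equiv s t -> unitary_equiv r t.
Proof.
move=> [U [U_lin Uiso Usurj Uint]] [V [V_lin Viso Vsurj Vint]].
exists (V \o U); split=> [c x y|v w|w|x v] /=.
- by rewrite U_lin V_lin.
- by rewrite Viso Uiso.
- by have [z <-] := Vsurj w; have [y <-] := Usurj z; exists y.
- by rewrite Uint Vint.
Qed.

Lemma dual_class_eq (L : topGroupType) (s t : irrep R L) :
  unitary_equiv s t -> dual_class s = dual_class t.
Proof.
move=> st; apply: eq_exist; apply/funext => r; apply/propext; split=> h.
  exact: unitary_equiv_trans (unitary_equiv_sym st) h.
exact: unitary_equiv_trans st h.
Qed.

Lemma dual_reprK (L : topGroupType) (c : dual R L) : dual_class (dual_repr c) = c.
Proof.
case: c => P hP; apply: eq_exist => /=.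
by rewrite /dual_repr /=; case: (cid _) => s /= ->.
Qed.

Variables (G : topGroupType) (N : normalSubgroup G).
Local Notation T := (nsubType N).
Implicit Types (c d : dual R T).

Lemma dual_act_comp g h c : dual_act h (dual_act g c) = dual_act (h * g)%g c.
Proof.
apply: dual_class_eq.
apply: (@unitary_equiv_trans _ _ (conj_rep h (conj_rep g (dual_repr c)))).
  apply: unitary_equiv_conj; apply: unitary_equiv_sym.
  exact: (dual_repr_class (conj_irrep g (dual_repr c))).
exists id; split=> // [w|x v]; first by exists w.
have E : nsub_conj g (nsub_conj h x) = nsub_conj (h * g)%g x by exact: nsub_conjM.
exact: (congr1 (fun y => dual_repr c y v) E).
Qed.

Lemma dual_act1 c : dual_act 1%g c = c.
Proof.
rewrite -[RHS]dual_reprK; apply: dual_class_eq.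
exists id; split=> // [w|x v]; first by exists w.
exact: (congr1 (fun y => dual_repr c y v) (nsub_conj_id x)).
Qed.

Lemma dual_orbit_refl c : dual_orbit c c.
Proof. by exists 1%g; rewrite dual_act1. Qed.

Lemma dual_orbit_eq c d : dual_orbit c d -> dual_orbit c = dual_orbit d.
Proof.
move=> [g ->]; apply/funext => e; apply/propext; split=> -[h ->].
  by exists (h * g^-1)%g; rewrite dual_act_comp mulgVK.
by exists (h * g)%g; rewrite dual_act_comp.
Qed.

Hypothesis hN : hausdorff_space T.
Variables (mu : haarIntegral R T) (A : groupCstar mu).

(** The inclusion says that d lies in the closure of the orbit of c. Were the orbit disjoint from X,
    the closed complement of the corresponding open set of primitive ideals would contain its
    kernels and hence that of d. *)
Lemma dual_open_meets (X : dual R T -> Prop) c d : dual_open A X -> X d ->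
  \bigcap_(g in [set: G]) dual_ker A (dual_act g c) `<=` dual_ker A d ->
  exists g, X (dual_act g c).
Proof.
move=> [W [_ [_ Wcl]] XW] /XW Wd cd; apply: contrapT => no.
have prim e := dual_ker_primitive hN A e.
have [|_] := Wcl (dual_ker A d) (prim d); last by apply.
apply: (subset_trans _ cd) => a ha g _; apply: ha; split; first exact: prim.
by move=> /XW h; apply: no; exists g.
Qed.

Lemma dual_orbit_inj c c' : dual_locally_closed A (dual_orbit c) ->
  \bigcap_(g in [set: G]) dual_ker A (dual_act g c) =
    \bigcap_(g in [set: G]) dual_ker A (dual_act g c') ->
  dual_orbit c = dual_orbit c'.
Proof.
move=> [F [U [oF oU hFU]]] E.
have [g Ug] : exists g, U (dual_act g c').
  apply: (dual_open_meets (d := c) oU); first by case: ((hFU c).1 (dual_orbit_refl c)).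
  rewrite -E => a /(_ 1%g I); by rewrite dual_act1.
(* Otherwise the complement of [F] would be an open neighbourhood of a point in the closure of the
   orbit of c, and would meet that orbit, which lies in [F]. *)
have Fg : F (dual_act g c').
  apply: contrapT => nF.
  have [|h] := dual_open_meets (c := c) oF nF.
    by rewrite E => a; apply.
  by apply; case: ((hFU (dual_act h c)).1 (ex_intro _ h erefl)).
have : dual_orbit c (dual_act g c') by apply/hFU.
move=> /dual_orbit_eq ->; apply/esym/dual_orbit_eq.
by exists g.
Qed.

End DualOrbits.

Lemma nsub_hausdorff (G : topGroupType) (N : normalSubgroup G) :
  hausdorff_space G -> hausdorff_space (nsubType N).
Proof.
move=> hG p q pq; apply: nsub_val_inj; apply: hG => U V nU nV.
have [x [Ux Vx]] := pq _ _ (nsub_val_continuous nU) (nsub_val_continuous nV).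
by exists (nsub_val x).
Qed.

Theorem theorem38 (R : realType) (G : topGroupType) (N : normalSubgroup G)
    (mu : haarIntegral R (nsubType N)) (A : groupCstar mu) :
  hausdorff_space G -> locally_compact [set: G] -> hereditary_lindelof G ->
  closed (nsub_set N) -> @second_countable (nsubType N) ->
  type_I_group R (nsubType N) ->
  (forall c : dual R (nsubType N), dual_locally_closed A (dual_orbit c)) ->
  forall pi : unitaryRep R G, factor_rep pi ->
    exists! O : dual R (nsubType N) -> Prop,
      exists2 c, O = dual_orbit c &
        cker A (restriction N pi) = \bigcap_(g in [set: G]) dual_ker A (dual_act g c).
Proof.
move=> hG _ _ _ N2 _ lc pi pi_factor; have hN := nsub_hausdorff (N := N) hG.
have [c hc] := exists_orbit hN N2 A pi_factor.
exists (dual_orbit c); split; first by exists c.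
move=> _ [c' -> hc']; apply: (dual_orbit_inj hN (lc c)).
by rewrite -hc hc'.
Qed.
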